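(* Let $d\ge 1$. Assume that $(F_n)_{n\ge 1}$ is a sequence of distribution functions such that $F_n\in\mathcal{D}$ for all $n$, and that there is a distribution function $G\in\mathcal{D}_1$ such that $G\le F_n$ for all $n$. If $d=2$, suppose furthermore that there exists a constant $\lambda>0$ such that $F_n(\lambda)=0$ for all $n$. Let $F\in\mathcal{D}$. If $F_n\stackrel{w}{\to}F$, then $\lim_{n\to\infty}\alpha_{F_n}(x)=\alpha_F(x)$ for all $x\in\mathbb{Z}^d$.
   Context: $(S_n)_{n\ge 0}$ is the simple (symmetric, nearest-neighbour) random walk on $\mathbb{Z}^d$; $P_x,E_x$ denote its law and expectation when started at $x$. Independently of the walk, the potential $V(x,\omega)$, $x\in\mathbb{Z}^d$, is a family of i.i.d. non-negative random variables with distribution function $F$, defined on a probability space $(\Omega,\mathcal{F},\mathbb{P})$ with expectation $\mathbb{E}$. $\mathcal{D}$ is the set of distribution functions $F$ which assign zero measure to $(-\infty,0)$ and satisfy $F(0)<1$; $\mathcal{D}_1$ is the subset of those $F\in\mathcal{D}$ with finite mean. For distribution functions, $F\le G$ means $F(t)\le G(t)$ for all $t\in\mathbb{R}$, and $F_n\stackrel{w}{\to}F$ denotes weak convergence (convergence in distribution). For $y\in\mathbb{Z}^d$, $H(y)=\inf\{n\ge 0:S_n=y\}$ (with $\inf\emptyset=+\infty$). For $x,y\in\mathbb{Z}^d$, $e(x,y,\omega)=E_x\big[\exp(-\sum_{m=0}^{H(y)-1}V(S_m,\omega))\mathbf{1}_{\{H(y)<\infty\}}\big]$ (equal to $1$ if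 $x=y$), and $a(x,y,\omega)=-\ln e(x,y,\omega)$. Quenched Lyapunov exponent: for $F\in\mathcal{D}_1$ and $x\in\mathbb{Z}^d$, $\alpha_F(x)=\lim_{n\to\infty}\frac1n\mathbb{E}[a(0,nx,\omega)]=\inf_{n\ge 1}\frac1n\mathbb{E}[a(0,nx,\omega)]$, where the potential has distribution function $F$ (it is a known theorem that this limit exists and is also the $\mathbb{P}$-a.s. and $L^1(\mathbb{P})$ limit of $\frac1n a(0,nx,\omega)$). Under the hypotheses of the claim, $F_n$ and $F$ belong to $\mathcal{D}_1$. *)

(* Defs.v *)
From HB Require Import structures.
From mathcomp Require Import all_boot all_order all_algebra finmap.
From mathcomp Require Import all_classical all_reals all_analysis.
Set Implicit Arguments.
Unset Strict Implicit.
Unset Printing Implicit Defensive.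
Import Order.TTheory GRing.Theory Num.Theory.
Import numFieldNormedType.Exports.
Local Open Scope classical_set_scope.
Local Open Scope ring_scope.

(* The lattice Z^d is ['rV[int]_d].  A distribution function on the line is
   an element of [cumulativeBounded 0 1]: nondecreasing, right-continuous, with
   limits 0 and 1 at -oo and +oo.  With this convention F t is the mass of
   ]-oo, t]. *)
Notation distribution_function R := (cumulativeBounded (0 : R) (1 : R)).

Definition class_D (R : realType) (F : distribution_function R) : Prop :=
  lebesgue_stieltjes_measure F `]-oo, (0 : R)[ = 0%E /\ F 0 < 1.

Definition class_D1 (R : realType) (F : distribution_function R) : Prop :=
  class_D F /\
  (\int[lebesgue_stieltjes_measure F]_(t in [set: R]) `|t|%:E < +oo)%E.

Definition weak_cvg (R : realType)
    (Fn : nat -> distribution_function R) (F : distribution_function R) : Prop :=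
  forall t : R, {for t, continuous F} -> Fn n t @[n --> \oo] --> F t.

Definition mutually_independent (R : realType) (dO : measure_display)
    (Omega : measurableType dO) (P : probability Omega R) (I : choiceType)
    (X : I -> {RV P >-> R}) : Prop :=
  forall (J : {fset I}) (B : I -> set R), (forall i, measurable (B i)) ->
    (P (\bigcap_(i in [set` J]) (X i @^-1` B i)) =
     \prod_(i <- J) P (X i @^-1` B i))%E.

Definition iid_potential (R : realType) (d : nat) (dO : measure_display)
    (Omega : measurableType dO) (P : probability Omega R)
    (V : 'rV[int]_d -> {RV P >-> R}) (F : distribution_function R) : Prop :=
  [/\ forall x omega, 0 <= V x omega,
      forall x t, cdf (V x) t = (F t)%:E &
      mutually_independent V].

Definition srw_kernel (R : realType) (d : nat) (x y : 'rV[int]_d) : R :=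
  if (\sum_(i < d) absz (y 0 i - x 0 i)%R)%N == 1%N then (2 * d)%:R^-1 else 0.

(* [Pw x] is the law under which [S] starts at [x].  The random environment
   lives on a sample space other than [W], so that it is independent of the
   walk. *)
Definition simple_random_walk (R : realType) (d : nat) (dW : measure_display)
    (W : measurableType dW) (Pw : 'rV[int]_d -> probability W R)
    (S : nat -> W -> 'rV[int]_d) : Prop :=
  (forall n z, measurable (S n @^-1` [set z])) /\
  (forall x n (s : nat -> 'rV[int]_d),
    Pw x (\bigcap_(i in `I_n.+1) (S i @^-1` [set s i])) =
    ((s 0%N == x)%:R * \prod_(i < n) srw_kernel R (s i) (s i.+1))%:E).

(* [None] stands for +oo. *)
Definition hitting_time (d : nat) (s : nat -> 'rV[int]_d) (y : 'rV[int]_d) :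
    option nat :=
  if pselect (exists n, s n == y) is left h then Some (ex_minn h) else None.

Definition path_weight (R : realType) (d : nat) (v : 'rV[int]_d -> R)
    (s : nat -> 'rV[int]_d) (y : 'rV[int]_d) : R :=
  if hitting_time s y is Some h then expR (- \sum_(0 <= m < h) v (s m)) else 0.

Section travel_cost.
Context (R : realType) (d : nat) (dW : measure_display) (W : measurableType dW).
Variables (Pw : 'rV[int]_d -> probability W R) (S : nat -> W -> 'rV[int]_d).

(* For [v >= 0] the expectation lies in [0, 1], so [fine] loses nothing. *)
Definition travel_e (v : 'rV[int]_d -> R) (x y : 'rV[int]_d) : R :=
  fine 'E_(Pw x)[fun w => path_weight v (S ^~ w) y].

Definition travel_a (v : 'rV[int]_d -> R) (x y : 'rV[int]_d) : R :=
  - ln (travel_e v x y).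

(* The limit is taken in the extended reals, so that no convention for
   infinite expectations is involved.  The term n = 0 is irrelevant. *)
Definition lyapunov (dO : measure_display) (Omega : measurableType dO)
    (P : probability Omega R) (V : 'rV[int]_d -> {RV P >-> R})
    (x : 'rV[int]_d) : \bar R :=
  lim ((n%:R^-1)%:E *
       'E_P[fun omega => travel_a (fun z => V z omega) 0 (x *+ n)]
       @[n --> \oo])%E.

End travel_cost.

(* Main.v *)
Require Import Defs.
From HB Require Import structures.
From mathcomp Require Import all_boot all_order all_algebra finmap.
From mathcomp Require Import all_classical all_reals all_analysis.
From mathcomp Require Import measurable_realfun.
From mathcomp Require Import ring lra zify.
Set Implicit Arguments.
Unset Strict Implicit.
Unset Printing Implicit Defensive.
Import Order.TTheory GRing.Theory Num.Theory.
Import numFieldNormedType.Exports.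
Local Open Scope classical_set_scope.
Local Open Scope ring_scope.

(** Write [a] for the travel cost and [E] for the mean over the potential. In
    dimension at least two the exponent is a Lipschitz function of the law, with
    a constant common to the laws considered, for the distance of transport (the
    integral of the absolute difference of the distribution functions), and
    domination by [G] upgrades weak convergence to convergence in that distance
    ([wass_small]).

    For the Lipschitz bound let two i.i.d. potentials be coupled site by site,
    and let [Y <= X] be the minimum of both and the first of them. The cost is
    concave in the potential and its derivative at [z] is the mean local time at
    [z] under the polymer measure, so [a(X) - a(Y)] is at most the sum over [z]
    of [(X - Y)(z)] times that local time for [Y] ([cost_sub_le]). Local times
    at visited sites have bounded mean, by transience in dimension at least
    three and by killing at rate [lambda] in dimension two
    ([local_time_bound]). There remains the polymer probability of a visit to
    [z]. It depends on the potential at [z], but it increases when that value is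
    lowered to a constant, it stays comparable to its original value with
    probability at least one half, and after the change it is independent of
    [(X - Y)(z)], so that the mean factorizes ([visit_le_qvisit],
    [qvisit_le_visit]). Finally the mean number of visited sites grows at most
    linearly with the distance: every new site costs a factor [E exp(-Y) < 1] in
    the annealed path measure, and an entropy inequality transfers this to the
    polymer measure ([range_entropy], [menv_visits_le]). Altogether
    [E a(0,kx)] changes by at most a constant times [k E(X - Y)]
    ([menv_cost_lipschitz]), and dividing by [k] gives the claim.

    In dimension one nothing bounds the local times, but a walk on the line
    passes through all intermediate points. The cost is then additive, the
    exponent equals [E a(0,x)] ([lyapunov_line]), and it suffices to have
    continuity of the mean cost between two fixed points
    ([mean_cost_continuous]), where finitely many sites matter up to a small
    error.

    The estimates are proved for walks stopped after [N] steps and for potentials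
    with values in a finite grid, where all means are finite sums. The
    Lipschitz constant depends neither on [N] nor on the mesh. Monotone convergence in [N]
    ([cvg_esum_to]) and rounding of the potential ([transfer]) lead back to the
    original objects. Since such means depend on the law of the potential only,
    this also yields the invariance under translations ([mean_cost_shift]) and
    with it, by subadditivity ([fekete]), the existence of the exponent
    ([lyapunovP]). *)

(** * Path sums *)

Section walks.
Context (R : realType) (d : nat).
Local Notation site := 'rV[int]_d.
Implicit Types (x y z : site) (l : seq site) (v : site -> R)
  (Phi Psi : seq site -> R) (N : nat).

(** A step is coded by an axis and a sign, so that the [2 * d] unit vectors are
    enumerated without repetition by a finite type. *)
Definition step (s : 'I_d * bool) : site := (-1) ^+ s.2 *: delta_mx 0 s.1.

Definition nbmean (f : site -> R) x : R :=
  (2 * d)%:R^-1 * \sum_(s : 'I_d * bool) f (x + step s).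

(** Expectation over the walk from [x], on the event that [y] is hit within [N]
    steps, of [Phi] applied to the list of sites occupied before the hitting
    time. The recursion is the Markov property at time one; in this form no
    probability space is needed until the very end. *)
Fixpoint pathsum y N x Phi : R :=
  if x == y then Phi [::]
  else if N is N'.+1 then
    nbmean (fun x' => pathsum y N' x' (fun l => Phi (x :: l))) x
  else 0.

(** The sites that a path of [pathsum y N x] can meet, with repetitions. *)
Fixpoint ball N x : seq site :=
  if N is N'.+1 then
    x :: flatten [seq ball N' (x + step s) | s <- enum {: 'I_d * bool}]
  else [::].

Lemma nbmean_le f g x :
  (forall s, f (x + step s) <= g (x + step s)) -> nbmean f x <= nbmean g x.
Proof. by move=> fg; rewrite ler_wpM2l// ler_sum. Qed.

Lemma eq_nbmean f g x :
  (forall s, f (x + step s) = g (x + step s)) -> nbmean f x = nbmean g x.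
Proof. by move=> fg; rewrite /nbmean; under eq_bigr do rewrite fg. Qed.

Lemma nbmean_ge0 f x : (forall z, 0 <= f z) -> 0 <= nbmean f x.
Proof. by move=> f0; rewrite mulr_ge0// sumr_ge0. Qed.

Lemma nbmeanZ a f x : nbmean (fun z => a * f z) x = a * nbmean f x.
Proof. by rewrite /nbmean -mulr_sumr mulrCA. Qed.

Lemma nbmeanD f g x : nbmean (fun z => f z + g z) x = nbmean f x + nbmean g x.
Proof. by rewrite /nbmean big_split mulrDr. Qed.

Lemma nbmean_cst (c : R) x : (0 < d)%N -> nbmean (fun=> c) x = c.
Proof.
move=> d0; rewrite /nbmean sumr_const card_prod card_ord card_bool mulnC.
by rewrite -[c *+ _]mulr_natl mulKf// pnatr_eq0 muln_eq0/=; case: (d) d0.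
Qed.

Lemma ball_step N x s : {subset ball N (x + step s) <= ball N.+1 x}.
Proof.
move=> z zb; rewrite /= inE; apply/orP; right.
by apply/flatten_mapP; exists s => //; rewrite mem_enum.
Qed.

Lemma pathsum_le y N x Phi Psi :
  (forall l, {subset l <= ball N x} -> (size l <= N)%N -> Phi l <= Psi l) ->
  pathsum y N x Phi <= pathsum y N x Psi.
Proof.
elim: N x Phi Psi => [|N IH] x Phi Psi PP /=; case: ifP => _ //; try exact: PP.
apply: nbmean_le => s; apply: IH => l lb lN; apply: PP => // z.
rewrite inE => /predU1P[->|/lb]; first by rewrite /= inE eqxx.
exact: ball_step.
Qed.

Lemma eq_pathsum y N x Phi Psi :
  (forall l, {subset l <= ball N x} -> (size l <= N)%N -> Phi l = Psi l) ->
  pathsum y N x Phi = pathsum y N x Psi.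
Proof.
by move=> PP; apply/eqP; rewrite eq_le !pathsum_le// => l lb lN; rewrite PP.
Qed.

Lemma pathsumZ y N x a Phi :
  pathsum y N x (fun l => a * Phi l) = a * pathsum y N x Phi.
Proof.
elim: N x Phi => [|N IH] x Phi /=; case: ifP => _ //; first by rewrite mulr0.
by rewrite -nbmeanZ; apply: eq_nbmean => s; rewrite IH.
Qed.

Lemma pathsumD y N x Phi Psi :
  pathsum y N x (fun l => Phi l + Psi l) = pathsum y N x Phi + pathsum y N x Psi.
Proof.
elim: N x Phi Psi => [|N IH] x Phi Psi /=; case: ifP => _ //; first by rewrite addr0.
by rewrite -nbmeanD; apply: eq_nbmean => s; rewrite IH.
Qed.

Lemma pathsum0 y N x : pathsum y N x (fun=> 0) = 0.
Proof.
transitivity (pathsum y N x (fun l => 0 * (size l)%:R)).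
  by apply: eq_pathsum => l _ _; rewrite mul0r.
by rewrite pathsumZ mul0r.
Qed.

Lemma pathsum_sum (I : Type) (r : seq I) (P : pred I) y N x
    (F : I -> seq site -> R) :
  pathsum y N x (fun l => \sum_(i <- r | P i) F i l) =
  \sum_(i <- r | P i) pathsum y N x (F i).
Proof.
elim: r => [|i r IH].
  by rewrite big_nil -[RHS](pathsum0 y N x); apply: eq_pathsum => l _ _; rewrite big_nil.
rewrite big_cons -IH; case: ifP => Pi; [rewrite -pathsumD|];
  by apply: eq_pathsum => l _ _; rewrite big_cons Pi.
Qed.

Lemma pathsum_ge0 y N x Phi :
  (forall l, 0 <= Phi l) -> 0 <= pathsum y N x Phi.
Proof.
by move=> P0; rewrite -[leLHS](pathsum0 y N x); apply: pathsum_le => l _ _.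
Qed.

Lemma pathsum_mono y N M x Phi : (forall l, 0 <= Phi l) -> (N <= M)%N ->
  pathsum y N x Phi <= pathsum y M x Phi.
Proof.
elim: N M x Phi => [|N IH] [|M] x Phi P0 //= NM; case: ifP => // _.
  by apply: nbmean_ge0 => z; apply: pathsum_ge0.
by apply: nbmean_le => s; apply: IH.
Qed.

(** Tangent-line form of the inequality of Jensen for the measure with density
    [Phi]: [expR] lies above its tangent at the mean [m] of [f]. It is used
    three times, to compare two potentials, to compare a lowered visit
    probability with the true one, and to bound the range by its entropy. *)
Lemma pathsum_jensen y N x Phi (f : seq site -> R) :
  (forall l, 0 <= Phi l) -> 0 < pathsum y N x Phi ->
  pathsum y N x Phi *
    expR (pathsum y N x (fun l => Phi l * f l) / pathsum y N x Phi) <=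
  pathsum y N x (fun l => Phi l * expR (f l)).
Proof.
move=> P0 S0; set S := pathsum y N x Phi in S0 *.
set T := pathsum _ _ _ (fun l => Phi l * f l).
have -> : S * expR (T / S) = expR (T / S) * (S + T + - (T / S) * S).
  by rewrite mulNr divfK ?gt_eqF// addrK mulrC.
rewrite /S /T -pathsumZ -!pathsumD -pathsumZ; apply: pathsum_le => l _ _.
rewrite -/S -/T; set m := T / S.
have -> : expR (f l) = expR m * expR (f l - m) by rewrite -expRD addrC subrK.
rewrite mulrCA ler_pM2l ?expR_gt0//.
rewrite [leLHS](_ : _ = Phi l * (1 + (f l - m))); last by ring.
by rewrite ler_wpM2l// expR_ge1Dx.
Qed.

Definition weight v l : R := expR (- \sum_(s <- l) v s).

Lemma weight_nil v : weight v [::] = 1.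
Proof. by rewrite /weight big_nil oppr0 expR0. Qed.

Lemma weight_cons v x l : weight v (x :: l) = expR (- v x) * weight v l.
Proof. by rewrite /weight big_cons opprD expRD. Qed.

Lemma weight_ge0 v l : 0 <= weight v l.
Proof. exact: expR_ge0. Qed.

Local Hint Resolve weight_ge0 : core.

Definition esum_to N v x y := pathsum y N x (weight v).

Lemma esum_to_ge0 N v x y : 0 <= esum_to N v x y.
Proof. exact: pathsum_ge0. Qed.

Lemma esum_toS N v x y : x != y ->
  esum_to N.+1 v x y = expR (- v x) * nbmean (fun x' => esum_to N v x' y) x.
Proof.
move=> /negPf xy; rewrite /esum_to /= xy -nbmeanZ; apply: eq_nbmean => s.
by rewrite -pathsumZ; apply: eq_pathsum => l _ _; rewrite weight_cons.
Qed.

Lemma esum_to_refl N v y : esum_to N v y y = 1.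
Proof. by case: N => [|N]; rewrite /esum_to /= eqxx weight_nil. Qed.

Lemma esum_to_mono N M v x y : (N <= M)%N -> esum_to N v x y <= esum_to M v x y.
Proof. exact: pathsum_mono. Qed.

Lemma esum_to_anti N v w x y : (forall z, v z <= w z) ->
  esum_to N w x y <= esum_to N v x y.
Proof.
move=> vw; apply: pathsum_le => l _ _.
by rewrite ler_expR lerN2 ler_sum.
Qed.

Lemma esum_to_le1 N v x y : (0 < d)%N -> (forall z, 0 <= v z) ->
  esum_to N v x y <= 1.
Proof.
move=> d0 v0; elim: N x => [|N IH] x.
  by rewrite /esum_to/=; case: ifP => // _; rewrite weight_nil.
have [->|xy] := eqVneq x y; first by rewrite esum_to_refl.
rewrite esum_toS//; apply: mulr_ile1; rewrite ?expR_ge0//.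
- by apply: nbmean_ge0 => z; apply: esum_to_ge0.
- by rewrite -expR0 ler_expR oppr_le0.
- by rewrite -(nbmean_cst 1 x d0); apply: nbmean_le => s; apply: IH.
Qed.

(** Unnormalized local time at [z] and probability of a visit to [z], before
    the hitting time of [y], under the path measure with density [weight v]. *)
Definition occup N v x y z :=
  pathsum y N x (fun l => weight v l * (count_mem z l)%:R).
Definition visit N v x y z :=
  pathsum y N x (fun l => weight v l * (z \in l)%:R).

Lemma visit_ge0 N v x y z : 0 <= visit N v x y z.
Proof. by apply: pathsum_ge0 => l; rewrite mulr_ge0. Qed.

(** The function [g] dominates the probability of ever reaching [z] because it is
    superharmonic for the killed walk off [z] and equals one at [z]; after the
    visit the walk restarts from [z]. *)
Lemma visit_hit N v y z (g : site -> R) x :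
  (forall x, 0 <= g x) -> g z = 1 ->
  (forall x, x != z -> expR (- v x) * nbmean g x <= g x) ->
  visit N v x y z <= g x * esum_to N v z y.
Proof.
move=> g0 gz gsup; elim: N x => [|N IH] x.
  rewrite /visit/=; case: ifP => _; last by rewrite mulr_ge0// esum_to_ge0.
  by rewrite mulr0 mulr_ge0// esum_to_ge0.
have [->|xy] := eqVneq x y.
  by rewrite /visit/= eqxx mulr0 mulr_ge0// esum_to_ge0.
have [->|xz] := eqVneq x z.
  rewrite gz mul1r; apply: pathsum_le => l _ _.
  by rewrite -[leRHS]mulr1 ler_wpM2l// lern1 leq_b1.
have -> : visit N.+1 v x y z = expR (- v x) * nbmean (fun x' => visit N v x' y z) x.
  rewrite /visit /= (negPf xy) -nbmeanZ; apply: eq_nbmean => s.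
  rewrite -pathsumZ; apply: eq_pathsum => l _ _.
  by rewrite weight_cons inE eq_sym (negPf xz) mulrA.
apply: (@le_trans _ _ (expR (- v x) * nbmean g x * esum_to N v z y)).
  rewrite -mulrA ler_wpM2l ?expR_ge0// mulrC -nbmeanZ.
  by apply: nbmean_le => s; rewrite mulrC IH.
by apply: ler_pM; rewrite ?esum_to_ge0 ?gsup// ?esum_to_mono// mulr_ge0 ?expR_ge0// nbmean_ge0.
Qed.

(** Each return to [z] has conditional probability at most [p] by [visit_hit], so
    the local time at a visited site is dominated by a geometric sum. *)
Lemma occup_visit N v y z (g : site -> R) (p : R) x : p < 1 ->
  (forall x, 0 <= g x) -> g z = 1 ->
  (forall x, x != z -> expR (- v x) * nbmean g x <= g x) ->
  expR (- v z) * nbmean g z <= p ->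
  occup N v x y z <= (1 - p)^-1 * visit N v x y z.
Proof.
move=> p1 g0 gz gsup gp.
have C0 : 0 < (1 - p)^-1 by rewrite invr_gt0 subr_gt0.
elim: N x => [|N IH] x.
  by rewrite /occup /visit/=; case: ifP; rewrite !mulr0.
have [->|xy] := eqVneq x y; first by rewrite /occup /visit/= eqxx !mulr0.
have [xz|xz] := eqVneq x z; last first.
  rewrite /visit /occup /= (negPf xy) -nbmeanZ; apply: nbmean_le => s.
  have h Phi Psi : (forall l, Phi l = expR (- v x) * Psi l) ->
    pathsum y N (x + step s) Phi = expR (- v x) * pathsum y N (x + step s) Psi.
    by move=> PP; rewrite -pathsumZ; apply: eq_pathsum.
  rewrite (h (fun l => weight v (x :: l) * ((x == z) + count_mem z l)%:R)
    (fun l => weight v l * (count_mem z l)%:R)); last first.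
    by move=> l; rewrite weight_cons (negPf xz) mulrA.
  rewrite (h (fun l => weight v (x :: l) * (z \in x :: l)%:R)
    (fun l => weight v l * (z \in l)%:R)); last first.
    by move=> l; rewrite weight_cons inE eq_sym (negPf xz) mulrA.
  by rewrite [leRHS]mulrCA ler_wpM2l ?expR_ge0//; apply: IH.
have zy : z != y by rewrite -xz.
rewrite xz.
have -> : visit N.+1 v z y z = esum_to N.+1 v z y.
  rewrite /visit /esum_to /= (negPf zy); apply: eq_nbmean => s.
  by apply: eq_pathsum => l _ _; rewrite inE eqxx mulr1.
have -> : occup N.+1 v z y z = esum_to N.+1 v z y +
    expR (- v z) * nbmean (fun x' => occup N v x' y z) z.
  rewrite esum_toS// -mulrDr -nbmeanD /occup /= (negPf zy) -nbmeanZ.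
  apply: eq_nbmean => s; rewrite -pathsumD -pathsumZ.
  by apply: eq_pathsum => l _ _; rewrite weight_cons eqxx natrD /= !mulrDr mulr1 mulrA.
have H : expR (- v z) * nbmean (fun x' => occup N v x' y z) z <=
    (1 - p)^-1 * (p * esum_to N.+1 v z y).
  apply: (@le_trans _ _ ((1 - p)^-1 * (expR (- v z) * nbmean g z * esum_to N v z y))).
    rewrite -(mulrA (expR _)) [leRHS]mulrCA ler_wpM2l ?expR_ge0// (mulrC (nbmean _ _)).
    rewrite -!nbmeanZ; apply: nbmean_le => s; apply: (le_trans (IH _)).
    by rewrite ler_pM2l// mulrC; apply: visit_hit.
  rewrite ler_pM2l//; apply: ler_pM; rewrite ?esum_to_ge0 ?esum_to_mono//.
  by rewrite mulr_ge0 ?expR_ge0// nbmean_ge0.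
apply: (le_trans (lerD (lexx _) H)); rewrite [leLHS](_ : _ = (1 - p)^-1 * esum_to N.+1 v z y)//.
field; by lra.
Qed.

End walks.

(** * The cost as a function of the potential *)

Section deterministic.
Context (R : realType) (d : nat).
Local Notation site := 'rV[int]_d.
Implicit Types (x y z : site) (l : seq site) (v : site -> R)
  (Phi Psi : seq site -> R) (N : nat).
Local Hint Extern 0 (is_true (0 <= weight _ _)) => exact: weight_ge0 : core.

Definition upd v z (t : R) : site -> R := fun s => if s == z then t else v s.

Lemma sum_count (L l : seq site) (D : site -> R) :
  uniq L -> {subset l <= L} ->
  \sum_(s <- l) D s = \sum_(z <- L) D z * (count_mem z l)%:R.
Proof.
move=> uL; elim: l => [|x l IH] lL.
  by rewrite big_nil big1_seq// => z _; rewrite mulr0.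
rewrite big_cons IH; last by move=> z zl; apply: lL; rewrite inE zl orbT.
have xL : x \in L by apply: lL; rewrite inE eqxx.
rewrite (bigD1_seq x)//= [RHS](bigD1_seq x)//= eqxx natrD mulrDr mulr1 addrA.
by congr +%R; apply: eq_bigr => z zx; rewrite eq_sym (negPf zx).
Qed.

Lemma esum_to_lipschitz N v v' x y (L : seq site) : uniq L ->
  {subset ball N x <= L} ->
  expR (- (N%:R * \sum_(z <- L) `|v z - v' z|)) * esum_to N v' x y <=
  esum_to N v x y.
Proof.
move=> uL bL; rewrite -pathsumZ; apply: pathsum_le => l lb lN.
rewrite /weight -expRD ler_expR -opprD lerN2.
rewrite -lerBlDr -sumrB (@sum_count L)//; last by move=> z /lb/bL.
rewrite mulr_sumr ler_sum// => z _; rewrite mulrC.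
rewrite (le_trans (ler_norm _))// normrM ger0_norm// ler_wpM2r//.
by rewrite ler_nat (leq_trans (count_size _ _)).
Qed.

Definition cost N v x y := - ln (esum_to N v x y).

(** Convexity: the derivative of [- ln esum_to] in the direction [z] is the mean
    local time at [z] under the polymer measure of [v'], and the cost is concave
    in the potential, so the tangent at [v'] lies above it. *)
Lemma cost_sub_le N v v' x y (L : seq site) : uniq L ->
  {subset ball N x <= L} -> 0 < esum_to N v' x y ->
  cost N v x y - cost N v' x y <=
  \sum_(z <- L) (v z - v' z) * (occup N v' x y z / esum_to N v' x y).
Proof.
move=> uL bL e0.
have := @pathsum_jensen R d y N x (weight v') (fun l => - \sum_(s <- l) (v s - v' s))
  (weight_ge0 v') e0.
rewrite -/(esum_to N v' x y).
have -> : pathsum y N x (fun l => weight v' l * - \sum_(s <- l) (v s - v' s)) =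
    - \sum_(z <- L) (v z - v' z) * occup N v' x y z.
  have -> : - \sum_(z <- L) (v z - v' z) * occup N v' x y z =
    \sum_(z <- L) (- (v z - v' z)) * occup N v' x y z.
    by rewrite -sumrN; apply: eq_bigr => z _; rewrite mulNr.
  rewrite /occup; under [RHS]eq_bigr do rewrite -pathsumZ.
  rewrite -pathsum_sum; apply: eq_pathsum => l lb _.
  rewrite (@sum_count L)//; last by move=> z /lb/bL.
  rewrite mulrN mulr_sumr -sumrN; apply: eq_bigr => z _; ring.
have -> : pathsum y N x (fun l => weight v' l * expR (- \sum_(s <- l) (v s - v' s))) =
    esum_to N v x y.
  apply: eq_pathsum => l _ _; rewrite /weight -expRD; congr expR.
  by rewrite sumrB; ring.
set S := \sum_(z <- L) _; move=> H.
have ev0 : 0 < esum_to N v x y by apply: lt_le_trans H; rewrite mulr_gt0// expR_gt0.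
rewrite (_ : \sum_(z <- L) _ = S / esum_to N v' x y); last first.
  by rewrite mulr_suml; apply: eq_bigr => z _; rewrite mulrA.
have := H; rewrite -ler_ln ?posrE//; last by rewrite mulr_gt0// expR_gt0.
rewrite lnM ?posrE// ?expR_gt0// expRK mulNr /cost => ?; lra.
Qed.

Lemma esum_to_split N v x y z : esum_to N v x y =
  visit N v x y z + pathsum y N x (fun l => weight v l * (z \notin l)%:R).
Proof.
rewrite -pathsumD; apply: eq_pathsum => l _ _; rewrite -mulrDr.
by case: (z \in l); rewrite /= ?addr0 ?add0r mulr1.
Qed.

Lemma weight_upd v z t l :
  weight v l = weight (upd v z t) l * expR (- ((v z - t) * (count_mem z l)%:R)).
Proof.
rewrite /weight -expRD -opprD; congr (expR (- _)).
elim: l => [|s l IH]; first by rewrite !big_nil mulr0 addr0.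
rewrite !big_cons IH /= natrD /upd; case: eqVneq => [->|_] /=; ring.
Qed.

Lemma weight_upd_notin v z t l : z \notin l -> weight (upd v z t) l = weight v l.
Proof.
by move=> zl; rewrite (weight_upd v z t) (count_memPn zl) mulr0 oppr0 expR0 mulr1.
Qed.

Lemma weight_upd_le v z t l : t <= v z -> weight v l <= weight (upd v z t) l.
Proof.
move=> tv; rewrite (weight_upd v z t) ler_piMr ?weight_ge0//.
by rewrite -expR0 ler_expR oppr_le0 mulr_ge0// subr_ge0.
Qed.

(** Polymer probability of a visit to [z] once the potential at [z] has been
    lowered to [t]. It does not depend on [v z]; this makes it independent of
    the increment of the potential at [z] when the potential is i.i.d. *)
Definition qvisit N t v x y z :=
  visit N (upd v z t) x y z / esum_to N (upd v z t) x y.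

Lemma esum_to_upd_le N v x y z t : t <= v z ->
  esum_to N v x y <= esum_to N (upd v z t) x y.
Proof. by move=> tv; apply: pathsum_le => l _ _; apply: weight_upd_le. Qed.

(** Lowering the potential at [z] multiplies only the weights of the paths through
    [z], hence favours visits to [z]. *)
Lemma visit_le_qvisit N v x y z t : t <= v z -> 0 < esum_to N v x y ->
  visit N v x y z / esum_to N v x y <= qvisit N t v x y z.
Proof.
move=> tv e0; have e1 := lt_le_trans e0 (esum_to_upd_le N x y tv).
rewrite /qvisit ler_pdivrMr// mulrAC ler_pdivlMr//.
rewrite (esum_to_split N _ x y z) (esum_to_split N v x y z).
set B := pathsum _ _ _ (fun l => weight v l * _).
set B' := pathsum _ _ _ _.
have <- : B = B'.
  apply: eq_pathsum => l _ _; case zl: (z \in l) => /=; first by rewrite !mulr0.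
  by rewrite weight_upd_notin ?zl.
have B0 : 0 <= B by apply: pathsum_ge0 => l; rewrite mulr_ge0.
have A01 : visit N v x y z <= visit N (upd v z t) x y z.
  by apply: pathsum_le => l _ _; rewrite ler_wpM2r// weight_upd_le.
move: (visit N v x y z) (visit N (upd v z t) x y z) A01 B B0 => A0 A1 A01 B B0.
by rewrite !mulrDr (mulrC A1 A0) lerD2l ler_wpM2r.
Qed.

(** Conversely the weight lost by the paths through [z] is at most exponential in
    the mean local time at [z] given a visit, by the inequality of Jensen for the
    paths conditioned to visit [z]. *)
Lemma qvisit_le_visit N v x y z (t C : R) : 0 <= C -> t <= v z -> 0 < esum_to N v x y ->
  occup N (upd v z t) x y z <= C * visit N (upd v z t) x y z ->
  qvisit N t v x y z <=
    expR ((v z - t) * C) * (visit N v x y z / esum_to N v x y).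
Proof.
move=> C0 tv e0 oc; have e01 := esum_to_upd_le N x y tv.
have e1 := lt_le_trans e0 e01.
set A' := visit N (upd v z t) x y z in oc *.
suff H : A' <= expR ((v z - t) * C) * visit N v x y z.
  rewrite /qvisit -/A' mulrA; apply: (@le_trans _ _ (A' / esum_to N v x y)).
    by rewrite ler_wpM2l ?visit_ge0// lef_pV2 ?posrE.
  by rewrite ler_wpM2r// invr_ge0 ltW.
have [A0|A0] := leP A' 0.
  by apply: (le_trans A0); rewrite mulr_ge0 ?expR_ge0 ?visit_ge0.
rewrite mulrC -ler_pdivrMr ?expR_gt0// -expRN.
have := @pathsum_jensen R d y N x (fun l => weight (upd v z t) l * (z \in l)%:R)
  (fun l => - ((v z - t) * (count_mem z l)%:R)) _ A0.
rewrite -/(visit N (upd v z t) x y z) -/A'.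
have -> : pathsum y N x (fun l => weight (upd v z t) l * (z \in l)%:R *
    - ((v z - t) * (count_mem z l)%:R)) = - (v z - t) * occup N (upd v z t) x y z.
  rewrite -pathsumZ; apply: eq_pathsum => l _ _.
  have -> : (count_mem z l)%:R = (z \in l)%:R * (count_mem z l)%:R :> R.
    case zl: (z \in l); rewrite ?mul1r ?mul0r//.
    by rewrite (count_memPn _) ?zl.
  by case: (z \in l); rewrite /=; ring.
have -> : pathsum y N x (fun l => weight (upd v z t) l * (z \in l)%:R *
    expR (- ((v z - t) * (count_mem z l)%:R))) = visit N v x y z.
  by apply: eq_pathsum => l _ _; rewrite mulrAC -weight_upd.
move=> H; apply: (le_trans _ (H _)); last by move=> l; rewrite mulr_ge0.
rewrite ler_pM2l// ler_expR ler_pdivlMr//.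
by rewrite !mulNr lerN2 -mulrA ler_wpM2l// subr_ge0.
Qed.

(** Gibbs variational inequality for the polymer measure: [theta] times the mean
    range is at most the relative entropy with respect to the free walk, which
    the cost controls, plus the logarithm of an exponential moment. The bound
    [ln t <= t - 1] makes the last term linear in that moment, so that it can be
    averaged over the environment. *)
Lemma range_entropy N v x y (L : seq site) (theta : R) : uniq L ->
  {subset ball N x <= L} -> 0 < esum_to N v x y ->
  theta * \sum_(z <- L) visit N v x y z / esum_to N v x y <=
  cost N v x y +
  (pathsum y N x (fun l => weight v l * expR (theta * (size (undup l))%:R)) - 1).
Proof.
move=> uL bL e0.
have := @pathsum_jensen R d y N x (weight v)
  (fun l => theta * (size (undup l))%:R) (weight_ge0 v) e0.
rewrite -/(esum_to N v x y).
have -> : pathsum y N x (fun l => weight v l * (theta * (size (undup l))%:R)) =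
    theta * \sum_(z <- L) visit N v x y z.
  rewrite -pathsum_sum -pathsumZ; apply: eq_pathsum => l lb _.
  rewrite -mulr_sumr mulrCA; do 2 congr (_ * _).
  have -> : \sum_(z <- L) (z \in l)%:R = (count [in l] L)%:R :> R.
    by rewrite -sum1_count natr_sum [RHS]big_mkcond/=; apply: eq_bigr => z _; case: (z \in l).
  rewrite -size_filter; congr (_%:R); apply/perm_size/uniq_perm.
  - exact: undup_uniq.
  - exact: filter_uniq.
  - move=> z; rewrite mem_undup mem_filter; case zl: (z \in l) => //=.
    by apply/esym/bL/lb.
set P := pathsum _ _ _ _ => H.
have P0 : 0 < P by apply: lt_le_trans H; rewrite mulr_gt0// expR_gt0.
rewrite -mulr_suml mulrA.
have := H; rewrite -ler_ln ?posrE//; last by rewrite mulr_gt0// expR_gt0.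
rewrite lnM ?posrE// ?expR_gt0// expRK /cost => H'.
have : ln P <= P - 1.
  have := @le_ln1Dx R (P - 1); rewrite addrCA subrr addr0; apply; lra.
lra.
Qed.

Lemma esum_to_triangle N M v x y z : (0 < d)%N -> (forall s, 0 <= v s) ->
  esum_to N v x y * esum_to M v y z <= esum_to (N + M) v x z.
Proof.
move=> d0 v0; elim: N x => [|N IH] x.
  rewrite {1}/esum_to/=; case: eqVneq => [->|_]; first by rewrite weight_nil mul1r.
  by rewrite mul0r esum_to_ge0.
have [->|xz] := eqVneq x z.
  by rewrite esum_to_refl mulr_ile1 ?esum_to_ge0 ?esum_to_le1.
have [->|xy] := eqVneq x y.
  by rewrite esum_to_refl mul1r esum_to_mono// leq_addl.
rewrite addSn !esum_toS// -mulrA ler_wpM2l ?expR_ge0// mulrC -nbmeanZ.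
by apply: nbmean_le => s; rewrite mulrC.
Qed.

(** A path started in [S] can neither leave [S] nor hit [z] before it has visited
    [y], so the strong Markov property at the hitting time of [y] gives the
    reverse of the triangle inequality. *)
Lemma esum_to_separated N v x y z (S : site -> Prop) :
  S x -> (forall x', S x' -> x' != y ->
    x' != z /\ forall s, S (x' + step s)) ->
  esum_to N v x z <= esum_to N v x y * esum_to N v y z.
Proof.
move=> Sx HS; elim: N x Sx => [|N IH] x Sx.
  have [->|xy] := eqVneq x y; first by rewrite esum_to_refl mul1r.
  have [xz _] := HS _ Sx xy.
  by rewrite {1}/esum_to /= (negPf xz) mulr_ge0 ?esum_to_ge0.
have [->|xy] := eqVneq x y; first by rewrite esum_to_refl mul1r.
have [xz Ss] := HS _ Sx xy.
rewrite (esum_toS _ _ xz) (esum_toS _ _ xy) -mulrA ler_wpM2l ?expR_ge0// mulrC -nbmeanZ.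
apply: nbmean_le => s; rewrite mulrC (le_trans (IH _ (Ss s)))//.
by rewrite ler_wpM2l ?esum_to_ge0// esum_to_mono.
Qed.

(** The weights are at most one, so replacing them by one bounds the contribution
    of the paths that hit [y] after time [N] uniformly in the potential. *)
Lemma esum_to_tail N M v x y : (N <= M)%N -> (forall s, 0 <= v s) ->
  esum_to M v x y - esum_to N v x y <=
  esum_to M (fun=> 0) x y - esum_to N (fun=> 0) x y.
Proof.
move=> NM v0; elim: N M NM x => [|N IH] M NM x.
  have [->|xy] := eqVneq x y; first by rewrite !esum_to_refl.
  have E (u : site -> R) : esum_to 0 u x y = 0 by rewrite /esum_to/= (negPf xy).
  by rewrite !E !subr0; apply: esum_to_anti.
case: M NM => // M NM.
have [->|xy] := eqVneq x y; first by rewrite !esum_to_refl.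
rewrite !esum_toS// oppr0 expR0 !mul1r -mulrBr.
have nbB (f g : site -> R) : nbmean f x - nbmean g x = nbmean (fun z => f z - g z) x.
  by rewrite -mulN1r -nbmeanZ -nbmeanD; apply: eq_nbmean => s; rewrite mulN1r.
rewrite !nbB; apply: (@le_trans _ _ (nbmean (fun z => esum_to M v z y - esum_to N v z y) x)).
  rewrite -[leRHS]mul1r ler_wpM2r//; last by rewrite -expR0 ler_expR oppr_le0.
  by apply: nbmean_ge0 => z; rewrite subr_ge0 esum_to_mono.
by apply: nbmean_le => s; apply: IH.
Qed.

Fixpoint visited x (w : seq ('I_d * bool)) : seq site :=
  if w is s :: w' then x :: visited (x + step s) w' else [::].

Lemma esum_to_word N v x (w : seq ('I_d * bool)) : (0 < d)%N ->
  (forall s, 0 <= v s) -> (size w <= N)%N ->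
  (2 * d)%:R^-1 ^+ size w * weight v (visited x w) <=
  esum_to N v x (x + \sum_(s <- w) step s).
Proof.
move=> d0 v0; elim: w N x => [|s w IH] N x wN.
  by rewrite big_nil addr0 esum_to_refl weight_nil mulr1.
rewrite big_cons addrA; set y := _ + \sum_(_ <- _) _.
have d1 : (2 * d)%:R^-1 <= 1 :> R by rewrite invf_le1 ?ltr0n ?muln_gt0// ler1n muln_gt0.
have [->|xy] := eqVneq x y.
  rewrite esum_to_refl mulr_ile1 ?exprn_ge0 ?invr_ge0 ?exprn_ile1 ?invr_ge0//.
  by rewrite -expR0 ler_expR oppr_le0 sumr_ge0.
case: N wN => // N wN; rewrite esum_toS//= weight_cons exprS.
rewrite mulrCA -!mulrA ler_wpM2l ?expR_ge0// ler_wpM2l ?invr_ge0//.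
rewrite (bigD1 s)//=.
rewrite (le_trans (IH N (x + step s) _))// lerDl sumr_ge0// => i _.
exact: esum_to_ge0.
Qed.

(** The walk may follow one prescribed path; this bounds the cost by a sum of
    values of the potential, uniformly in [N]. *)
Lemma cost_word N v x (w : seq ('I_d * bool)) : (0 < d)%N ->
  (forall s, 0 <= v s) -> (size w <= N)%N ->
  0 < esum_to N v x (x + \sum_(s <- w) step s) /\
  cost N v x (x + \sum_(s <- w) step s) <=
  (size w)%:R * ln (2 * d)%:R + \sum_(s <- visited x w) v s.
Proof.
move=> d0 v0 wN; have := esum_to_word x d0 v0 wN; set y := _ + \sum_(_ <- _) _ => H.
have W0 : 0 < (2 * d)%:R^-1 ^+ size w * weight v (visited x w) :> R.
  by rewrite mulr_gt0 ?expR_gt0// exprn_gt0// invr_gt0 ltr0n muln_gt0.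
have e0 := lt_le_trans W0 H; split => //.
have d20 : (0 : R) < (2 * d)%:R by rewrite ltr0n muln_gt0.
have := H; rewrite -ler_ln ?posrE// lnM ?posrE ?expR_gt0 ?exprn_gt0 ?invr_gt0//.
rewrite expRK lnXn ?invr_gt0// lnV ?posrE// mulNrn -mulr_natl /cost; lra.
Qed.

Lemma size_visited x w : size (visited x w) = size w.
Proof. by elim: w x => //= s w IH x; rewrite IH. Qed.

Lemma word_exists x : exists w : seq ('I_d * bool), \sum_(s <- w) step s = x.
Proof.
have one (i : 'I_d) (k : int) : exists w : seq ('I_d * bool),
    \sum_(s <- w) step s = k *: delta_mx 0 i.
  have H b (n : nat) : \sum_(s <- nseq n (i, b)) step s = ((-1) ^+ b * n%:Z) *: delta_mx 0 i.
    elim: n => [|n IH] /=; first by rewrite big_nil mulr0 scale0r.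
    by rewrite big_cons IH /step /= -scalerDl intS mulrDr mulr1.
  case: (intP k) => [|n|n].
  - by exists [::]; rewrite big_nil scale0r.
  - by exists (nseq n.+1 (i, false)); rewrite H expr0 mul1r.
  - by exists (nseq n.+1 (i, true)); rewrite H expr1 mulN1r.
rewrite [x]row_sum_delta; elim: (index_enum _) => [|i r [w IH]].
  by exists [::]; rewrite !big_nil.
by have [u uE] := one i (x 0 i); exists (u ++ w); rewrite big_cat big_cons uE IH.
Qed.

End deterministic.

(** * Superharmonic functions and local times *)

Section transience.
Context (R : realType) (d : nat).
Local Notation site := 'rV[int]_d.

(** The third-order Taylor polynomial of [(1 + t)^(-1/2)] with an error [t ^+ 4].
    After squaring, the claim is the positivity of an explicit polynomial. *)
Lemma rsqrt_taylor (t : R) : `|t| <= 2^-1 ->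
  (Num.sqrt (1 + t))^-1 <= 1 - t / 2 + 3 / 8 * t ^+ 2 - 5 / 16 * t ^+ 3 + t ^+ 4.
Proof.
rewrite ler_norml => /andP[t1 t2]; set P := (X in _ <= X).
have P0 : 0 < P.
  have : 0 <= t ^+ 2 by exact: sqr_ge0.
  have : 0 <= (1 - 2 * t) * t ^+ 2 by rewrite mulr_ge0 ?sqr_ge0//; lra.
  have : 0 <= t ^+ 4 by rewrite (exprM t 2 2) sqr_ge0.
  by rewrite /P; nra.
have T0 : 0 < 1 + t by lra.
have H : 1 <= (1 + t) * P ^+ 2.
  have -> : (1 + t) * P ^+ 2 = 1 + (t ^+ 2) ^+ 2 *
    (93 / 64 + 39 / 32 * t - 99 / 256 * t ^+ 2 + 57 / 256 * t ^+ 3 + 3 / 8 * t ^+ 4 + t ^+ 5).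
    by rewrite /P; field.
  rewrite lerDl mulr_ge0 ?sqr_ge0//.
  have t4 : 0 <= t ^+ 4 by rewrite (exprM t 2 2) sqr_ge0.
  have t21 : t ^+ 2 <= 4^-1 by nra.
  have t20 : 0 <= t ^+ 2 by exact: sqr_ge0.
  have e3 : t ^+ 3 = t * t ^+ 2 by rewrite exprS.
  have e5 : t ^+ 5 = t * t ^+ 4 by rewrite exprS.
  have e4 : t ^+ 4 = (t ^+ 2) ^+ 2 by rewrite -exprM.
  have h3 : - 8^-1 <= t ^+ 3 by rewrite e3; nra.
  have h4 : t ^+ 4 <= 16^-1 by rewrite e4; nra.
  have h5 : - 32^-1 <= t ^+ 5 by rewrite e5; nra.
  lra.
rewrite -(ler_pM2l (_ : 0 < Num.sqrt (1 + t))) ?sqrtr_gt0//.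
rewrite divff ?gt_eqF ?sqrtr_gt0//.
have -> : Num.sqrt (1 + t) * P = Num.sqrt ((1 + t) * P ^+ 2).
  by rewrite sqrtrM ?ltW// sqrtr_sqr ger0_norm ?ltW.
by rewrite -[leLHS]sqrtr1 ler_wsqrtr.
Qed.

(** Only three coordinates enter, so that one function serves all dimensions at
    least three: projecting on three coordinates gives a lazy walk. The constant
    20 is large enough to absorb the fourth-order terms of the expansion. *)
Definition rad2 (x : site) : R := \sum_(i < d | (i < 3)%N) (x 0 i)%:~R ^+ 2 + 20.
(** A smoothed Newtonian potential in three dimensions, [(|x|^2 + 20)^(-1/2)]. *)
Definition newton (x : site) : R := (Num.sqrt (rad2 x))^-1.

Lemma rad2_ge20 x : 20 <= rad2 x.
Proof. by rewrite lerDr sumr_ge0// => i _; exact: sqr_ge0. Qed.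

Lemma step_coord (i j : 'I_d) b : (step (i, b) : site) 0 j = (-1) ^+ b * (j == i)%:Z.
Proof. by rewrite /step/= !mxE eqxx /=; case: (j == i). Qed.

Lemma rad2_step x (i : 'I_d) b : rad2 (x + step (i, b)) =
  if (i < 3)%N then rad2 x + 1 + 2 * (-1) ^+ b * (x 0 i)%:~R else rad2 x.
Proof.
have E j : ((x + step (i, b)) 0 j)%:~R = (x 0 j)%:~R + (-1) ^+ b * (j == i)%:R :> R.
  rewrite mxE step_coord intrD intrM; congr (_ + _ * _); by case: b.
rewrite /rad2; case: ifPn => i3.
  rewrite (bigD1 i)//= [in RHS](bigD1 i)//= E eqxx.
  under eq_bigr => j /andP[_ /negPf ji] do rewrite E ji mulr0 addr0.
  case: b E => _ /=; ring.
congr (_ + _); apply: eq_bigr => j j3; rewrite E.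
have /negPf -> : j != i by apply: contraTneq j3 => ->.
by rewrite mulr0 addr0.
Qed.

(** Second difference of the Newtonian potential along one axis, with
    [u = 1 / rad2 x] and [b] the square of the coordinate. The terms odd in
    the coordinate cancel between the two opposite steps; what remains of the
    cubic term of the expansion is negative and is dropped. *)
Lemma newton_pair x (i : 'I_d) : (i < 3)%N ->
  forall u b : R, u = (rad2 x)^-1 -> b = (x 0 i)%:~R ^+ 2 ->
  newton (x + step (i, true)) + newton (x + step (i, false)) - 2 * newton x <=
  newton x * (- u + 3 / 4 * u ^+ 2 + 3 * b * u ^+ 2 +
    2 * u ^+ 4 + 48 * b * u ^+ 4 + 32 * b ^+ 2 * u ^+ 4).
Proof.
move=> i3 u b; set r := rad2 x; set a := (x 0 i)%:~R : R => uE bE.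
have r20 : 20 <= r := rad2_ge20 x.
have br : b + 20 <= r.
  rewrite bE.
  rewrite lerD2r (bigD1 i)//= lerDl sumr_ge0// => j _; exact: sqr_ge0.
have r0 : 0 < r by lra.
have u0 : 0 < u by rewrite uE invr_gt0.
have ur : u * r = 1 by rewrite uE mulVf// gt_eqF.
have E (s : bool) : newton (x + step (i, s)) =
  newton x * (Num.sqrt (1 + (u + 2 * (-1) ^+ s * a * u)))^-1.
  rewrite /newton rad2_step i3 -/r -/a -invfM -sqrtrM ?ltW//; congr (Num.sqrt _)^-1.
  by rewrite !mulrDr !(mulrC r) -!mulrA ur mulr1 mul1r; ring.
have S (s : bool) : `|u + 2 * (-1) ^+ s * a * u| <= 2^-1.
  have : `|1 + 2 * (-1) ^+ s * a| <= r / 2.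
    have h1 := sqr_ge0 (a - 2); have h2 := sqr_ge0 (a + 2).
    rewrite bE in br.
    by rewrite ler_norml; apply/andP; split; case: s => /=; rewrite ?expr0 ?expr1; nra.
  move=> H; rewrite (_ : _ + _ = (1 + 2 * (-1) ^+ s * a) * u); last by ring.
  rewrite normrM (gtr0_norm u0).
  by apply: (le_trans (ler_wpM2r (ltW u0) H)); rewrite mulrAC (mulrC r) ur mul1r.
have p0 : 0 < newton x by rewrite invr_gt0 sqrtr_gt0.
rewrite !E.
set X := (Num.sqrt _)^-1; set Y := (Num.sqrt _)^-1.
have HX : X <= _ := rsqrt_taylor (S true).
have HY : Y <= _ := rsqrt_taylor (S false).
rewrite (_ : _ - _ = newton x * (X + Y - 2)); last by ring.
rewrite ler_pM2l//.
have b0 : 0 <= b by rewrite bE sqr_ge0.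
have : 0 <= u ^+ 3 + 12 * b * u ^+ 3.
  by rewrite addr_ge0// ?mulr_ge0// ?exprn_ge0// ltW.
rewrite /= expr0 expr1 in HX HY => H3.
have HXY := lerD HX HY.
apply: (@le_trans _ _ (- u + 3 / 4 * u ^+ 2 + 3 * b * u ^+ 2 - 5 / 8 * (u ^+ 3 + 12 * b * u ^+ 3) +
    2 * u ^+ 4 + 48 * b * u ^+ 4 + 32 * b ^+ 2 * u ^+ 4)); last by lra.
rewrite -subr_ge0; rewrite -subr_ge0 in HXY.
apply: (le_trans HXY); rewrite le_eqVlt; apply/orP; left; apply/eqP; rewrite bE; by field.
Qed.

Lemma card_lt3 : (3 <= d)%N -> \sum_(i < d | (i < 3)%N) 1 = 3 :> R.
Proof.
move=> d3; rewrite -(subnKC d3) big_split_ord/= [X in _ + X]big_pred0; last first.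
  by move=> i /=; apply/negbTE; rewrite -leqNgt leq_addr.
rewrite addr0 big_mkcond/= !big_ord_recr big_ord0 /=; lra.
Qed.

(** Summing [newton_pair] over the three axes, the terms of order [u] cancel as for
    the harmonic function [1 / |x|]; the constant 20 contributes a negative term
    of order [u ^+ 2] which dominates all the others. *)
Lemma newton_sup x : (3 <= d)%N -> nbmean newton x <= newton x.
Proof.
move=> d3; have d0 : (0 < d)%N by apply: leq_trans d3.
rewrite -[leRHS](nbmean_cst (newton x) x d0) ler_wpM2l//.
rewrite -subr_le0 -sumrB.
rewrite -(pair_big xpredT xpredT (fun i b => newton (x + step (i, b)) - newton x))/=.
set u := (rad2 x)^-1; pose b (i : 'I_d) := (x 0 i)%:~R ^+ 2 : R.
have r20 := rad2_ge20 x.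
have u0 : 0 < u by rewrite invr_gt0; lra.
have p0 : 0 < newton x by rewrite invr_gt0 sqrtr_gt0; lra.
apply: (@le_trans _ _ (\sum_(i < d | (i < 3)%N) newton x * ((- u + 3 / 4 * u ^+ 2 + 2 * u ^+ 4) +
   (3 * u ^+ 2 + 48 * u ^+ 4) * b i + (32 * u ^+ 4) * b i ^+ 2))).
  rewrite [leRHS]big_mkcond/= ler_sum// => i _; rewrite big_bool/=.
  case: ifPn => i3; last first.
    by rewrite /newton !rad2_step (negPf i3) !subrr addr0.
  have H := newton_pair i3 (erefl u) (erefl (b i)).
  move: (newton (x + step (i, true))) (newton (x + step (i, false))) H.
  by move: (newton x) (b i) u {u0 p0} => p' b' u' p1 p2 H; lra.
rewrite -mulr_sumr pmulr_rle0// big_split/= big_split/= -!mulr_sumr.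
have sumK (K : R) : \sum_(i < d | (i < 3)%N) K = 3 * K.
  by rewrite -[in RHS](card_lt3 d3) mulr_suml; apply: eq_bigr => i _; rewrite mul1r.
rewrite sumK.
set B := \sum_(i < d | _) b i.
have BB : \sum_(i < d | (i < 3)%N) b i ^+ 2 <= B ^+ 2.
  rewrite [leRHS]expr2 {1}/B mulr_suml ler_sum// => i i3; rewrite expr2 ler_wpM2l ?sqr_ge0//.
  by rewrite /B (bigD1 i)//= lerDl sumr_ge0// => j _; exact: sqr_ge0.
have rB : rad2 x = B + 20 by [].
have B0 : 0 <= B by rewrite sumr_ge0// => j _; exact: sqr_ge0.
(* The relation between the radius and the coordinates, which turns the sum over
   the axes into a polynomial in u alone. *)
have uB : B * u = 1 - 20 * u.
  by rewrite /u rB; field; lra.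
have u20 : 20 * u <= 1 by have := mulr_ge0 B0 (ltW u0); rewrite uB; lra.
have H2 := ler_wpM2l (_ : 0 <= 32 * u ^+ 4) BB.
apply: le_trans (lerD (lexx _) (H2 _)) _; first by rewrite mulr_ge0// exprn_ge0// ltW.
have -> : (3 * u ^+ 2 + 48 * u ^+ 4) * B = 3 * u * (B * u) + 48 * u ^+ 3 * (B * u) by ring.
have -> : 32 * u ^+ 4 * B ^+ 2 = 32 * u ^+ 2 * (B * u) ^+ 2 by ring.
rewrite uB.
have Q : 0 <= u ^+ 2 by exact: sqr_ge0.
have q : u ^+ 2 <= 400^-1 by nra.
have e4 : u ^+ 4 <= u ^+ 2 / 400 by rewrite (exprD u 2 2) ler_wpM2l.
have e3 : u ^+ 3 * (1 - 20 * u) <= u ^+ 2 / 20.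
  by rewrite (exprSr u 2) -mulrA ler_wpM2l//; nra.
have e2 : u ^+ 2 * (1 - 20 * u) ^+ 2 <= u ^+ 2.
  by rewrite ler_piMr// expr_le1//; lra.
lra.
Qed.

Lemma newton0_lt : (3 <= d)%N -> nbmean newton 0 < newton 0.
Proof.
move=> d3; have d0 : (0 < d)%N by apply: leq_trans d3.
rewrite -[ltRHS](nbmean_cst (newton 0) 0 d0) ltr_pM2l ?invr_gt0 ?ltr0n ?muln_gt0//.
rewrite -subr_gt0 -sumrB.
rewrite -(pair_big xpredT xpredT (fun i b => newton 0 - newton (0 + step (i, b))))/=.
have r20 := rad2_ge20 0.
have P s : 0 <= newton 0 - newton (0 + step s).
  case: s => i b; rewrite subr_ge0 /newton rad2_step; case: ifP => // _.
  rewrite mxE mulr0 addr0 lef_pV2 ?posrE ?sqrtr_gt0; [|lra|lra].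
  by rewrite ler_wsqrtr// lerDl.
rewrite (bigD1 (Ordinal d0))//= ltr_pwDl// ?sumr_ge0//; last first.
  by move=> i _; rewrite sumr_ge0.
rewrite big_bool/= ltr_pwDl//.
rewrite subr_gt0 /newton rad2_step /= mxE mulr0 addr0.
rewrite ltf_pV2 ?posrE ?sqrtr_gt0; [|lra|lra].
by rewrite ltr_sqrt; lra.
Qed.

(** Either the potential kills the walk at rate [lam] and the constant function is
    strictly superharmonic, or the walk is transient and the normalized
    Newtonian potential is superharmonic, strictly so at the origin. Without
    killing the walk is recurrent in dimensions one and two, and there is no such
    bound. *)
Lemma local_time_bound (lam : R) : (0 < d)%N -> 0 <= lam -> (0 < lam \/ (3 <= d)%N) ->
  exists2 C : R, 0 <= C & forall (v : site -> R) N x y z, (forall s, lam <= v s) ->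
    occup N v x y z <= C * visit N v x y z.
Proof.
move=> d0 lam0 [lamp|d3].
  have p1 : expR (- lam) < 1 by rewrite -expR0 ltr_expR oppr_lt0.
  exists (1 - expR (- lam))^-1; first by rewrite invr_ge0; lra.
  move=> v N x y z vl.
  apply: (@occup_visit _ _ _ _ _ _ (fun=> 1)) => // [x' _|]; rewrite nbmean_cst// mulr1.
    by rewrite -expR0 ler_expR oppr_le0 (le_trans lam0).
  by rewrite ler_expR lerN2.
have q0 : 0 < newton 0.
  by rewrite invr_gt0 sqrtr_gt0; have := rad2_ge20 0; lra.
set p := nbmean newton 0 / newton 0.
have p1 : p < 1 by rewrite ltr_pdivrMr// mul1r newton0_lt.
exists (1 - p)^-1; first by rewrite invr_ge0; lra.
move=> v N x y z vl.
pose g x := newton (x - z) / newton 0.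
have gE x' : nbmean g x' = nbmean newton (x' - z) / newton 0.
  rewrite mulrC -nbmeanZ /nbmean; congr (_ * _); apply: eq_bigr => s _.
  by rewrite /g mulrC addrAC.
have g0 x' : 0 <= g x'.
  by rewrite mulr_ge0// ?invr_ge0 ?sqrtr_ge0// ltW.
have gsup x' : nbmean g x' <= g x'.
  by rewrite gE ler_wpM2r ?invr_ge0 ?(ltW q0)// newton_sup.
have v1 s : expR (- v s) <= 1 by rewrite -expR0 ler_expR oppr_le0 (le_trans lam0).
apply: (@occup_visit _ _ _ _ _ _ g) => //.
- by rewrite /g subrr divff// gt_eqF.
- move=> x' _; rewrite (le_trans _ (gsup x'))// ler_piMl//.
  exact: nbmean_ge0.
- have -> : p = nbmean g z by rewrite gE subrr.
  by rewrite ler_piMl// nbmean_ge0.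
Qed.

End transience.

(** * The Lipschitz estimate in a finite environment *)

Section finite_environment.
Context (R : realType) (T I : finType) (pi : T -> R).
Hypotheses (pi_ge0 : forall t, 0 <= pi t) (pi_sum : \sum_t pi t = 1).
Implicit Types (c : {ffun I -> T}) (f g : {ffun I -> T} -> R).

(** Mean over an i.i.d. environment: [pi] is the law of one letter and [menv] the
    mean for its product over the finite index set [I]. *)
Definition wenv c : R := \prod_i pi (c i).
Definition menv f : R := \sum_c wenv c * f c.
Definition mean (f : T -> R) : R := \sum_t pi t * f t.
Definition resample c i t : {ffun I -> T} := [ffun j => if j == i then t else c j].

Lemma wenv_ge0 c : 0 <= wenv c.
Proof. exact: prodr_ge0. Qed.

Lemma menv_le f g : (forall c, f c <= g c) -> menv f <= menv g.
Proof. by move=> fg; apply: ler_sum => c _; rewrite ler_wpM2l ?wenv_ge0. Qed.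

Lemma eq_menv f g : f =1 g -> menv f = menv g.
Proof. by move=> fg; apply: eq_bigr => c _; rewrite fg. Qed.

Lemma menvD f g : menv (fun c => f c + g c) = menv f + menv g.
Proof. by rewrite -big_split; apply: eq_bigr => c _; rewrite mulrDr. Qed.

Lemma menvZ (a : R) f : menv (fun c => a * f c) = a * menv f.
Proof. by rewrite /menv mulr_sumr; apply: eq_bigr => c _; rewrite mulrCA. Qed.

Lemma menvB f g : menv (fun c => f c - g c) = menv f - menv g.
Proof.
rewrite menvD -[in RHS]mulN1r -menvZ; congr (_ + _).
by apply: eq_menv => c; rewrite mulN1r.
Qed.

Lemma menv_sum (J : Type) (r : seq J) (P : pred J) (F : J -> {ffun I -> T} -> R) :
  menv (fun c => \sum_(j <- r | P j) F j c) = \sum_(j <- r | P j) menv (F j).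
Proof. by rewrite /menv exchange_big/=; apply: eq_bigr => c _; rewrite mulr_sumr. Qed.

Lemma menv_prod (h : I -> T -> R) :
  menv (fun c => \prod_i h i (c i)) = \prod_i mean (h i).
Proof.
rewrite /mean bigA_distr_bigA/=; apply: eq_bigr => c _.
by rewrite -big_split.
Qed.

Lemma menv_cst (a : R) : menv (fun=> a) = a.
Proof.
transitivity (a * menv (fun c => \prod_(i : I) 1)).
  by rewrite -menvZ; apply: eq_menv => c; rewrite big1_eq mulr1.
rewrite (menv_prod (fun _ _ => 1)) big1 ?mulr1// => i _.
by rewrite /mean; under eq_bigr do rewrite mulr1.
Qed.

Lemma menv_ge0 f : (forall c, 0 <= f c) -> 0 <= menv f.
Proof. by move=> f0; rewrite -(menv_cst 0) menv_le. Qed.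

Lemma wenv_resample c i t : wenv (resample c i t) * pi (c i) = wenv c * pi t.
Proof.
rewrite /wenv (bigD1 i)//= [in RHS](bigD1 i)//= ffunE eqxx.
under eq_bigr => j /negPf ji do rewrite ffunE ji.
ring.
Qed.

(** Resampling one letter preserves the product law: the pairs made of an
    environment and a fresh letter are permuted by exchanging that letter with
    the old one. *)
Lemma menv_resample i f :
  menv (fun c => \sum_t pi t * f (resample c i t)) = menv f.
Proof.
have RR c t : resample (resample c i t) i (c i) = c.
  by apply/ffunP => j; rewrite !ffunE; case: eqP => [->|].
pose h (p : {ffun I -> T} * T) := (resample p.1 i p.2, p.1 i).
have hK : involutive h.
  by move=> [c t]; rewrite /h /= RR ffunE eqxx.
transitivity (\sum_(p : {ffun I -> T} * T) wenv p.1 * pi p.2 * f (resample p.1 i p.2)).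
  rewrite -(pair_big xpredT xpredT (fun c t => wenv c * pi t * f (resample c i t)))/=.
  by apply: eq_bigr => c _; rewrite mulr_sumr; apply: eq_bigr => t _; rewrite mulrA.
rewrite (reindex_inj (inv_inj hK))/=.
rewrite -(pair_big xpredT xpredT (fun c t => wenv (resample c i t) * pi (c i) *
  f (resample (resample c i t) i (c i))))/=.
apply: eq_bigr => c _; under eq_bigr do rewrite RR wenv_resample.
by rewrite -mulr_suml -mulr_sumr pi_sum mulr1.
Qed.

Lemma menv_indep i (f : T -> R) g : (forall c t, g (resample c i t) = g c) ->
  menv (fun c => f (c i) * g c) = mean f * menv g.
Proof.
move=> gi; rewrite -(menv_resample i) -menvZ; apply: eq_menv => c.
rewrite /mean mulr_suml; apply: eq_bigr => t _.
by rewrite gi ffunE eqxx mulrA.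
Qed.

End finite_environment.

Lemma big_seq_sub (R : Type) (idx : R) (op : Monoid.com_law idx) (K : choiceType)
    (L : seq K) (F : K -> R) : uniq L ->
  \big[op/idx]_(z <- L) F z = \big[op/idx]_(i : seq_sub L) F (val i).
Proof.
move=> uL.
rewrite -[LHS](perm_big _ (_ : perm_eq (map val (enum {: seq_sub L})) L)) /=.
  by rewrite big_map big_enum.
apply: uniq_perm => //; first by rewrite map_inj_uniq ?enum_uniq//; exact: val_inj.
move=> z; apply/mapP/idP => [[i _ ->]|zL]; first exact: (valP i).
by exists (SeqSub zL) => //; rewrite mem_enum.
Qed.

Section finite_comparison.
Context (R : realType) (d : nat) (T : finType) (pi : T -> R).
Local Notation site := 'rV[int]_d.
Hypotheses (pi_ge0 : forall t, 0 <= pi t) (pi_sum : \sum_t pi t = 1).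
Variable L : seq site.
Hypothesis uL : uniq L.
Implicit Types (c : {ffun seq_sub L -> T}).

(** Outside the finitely many sites that matter the potential takes the default
    value [lam]; it must not be below the lower bound assumed of the potential,
    because [occC] asks for that bound at every site. *)
Definition field (X : T -> R) (lam : R) c : site -> R :=
  fun s => if insub s is Some i then X (c i) else lam.

Lemma field_val X lam c i : field X lam c (val i) = X (c i).
Proof. by rewrite /field valK. Qed.

Let sum_seq_sub (F : site -> R) :
  \sum_(z <- L) F z = \sum_(i : seq_sub L) F (val i).
Proof. exact: big_seq_sub. Qed.

Variables (N : nat) (x : site) (w : seq ('I_d * bool)).
Hypotheses (d0 : (0 < d)%N) (wN : (size w <= N)%N) (bL : {subset ball N x <= L}).
Variables (X Y : T -> R) (lam C K rho m1 : R).
Hypotheses (lam0 : 0 <= lam) (lamY : forall t, lam <= Y t) (YX : forall t, Y t <= X t).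
Hypothesis C0 : 0 <= C.
Hypothesis occC : forall (v : site -> R) y z, (forall s, lam <= v s) ->
  occup N v x y z <= C * visit N v x y z.
Hypothesis PK : 2^-1 <= \sum_(t | Y t <= K) pi t.
Hypotheses (rho0 : 0 < rho) (rho1 : rho < 1).
Hypothesis Erho : mean pi (fun t => expR (- Y t)) <= rho.
Hypothesis EY : mean pi Y <= m1.

Let y := x + \sum_(s <- w) step s.
Let vX c := field X lam c.
Let vY c := field Y lam c.

Let lamvY c s : lam <= vY c s.
Proof. by rewrite /vY /field; case: insub. Qed.
Let vYX c s : vY c s <= vX c s.
Proof. by rewrite /vY /vX /field; case: insub. Qed.
Let vY0 c s : 0 <= vY c s.
Proof. exact: le_trans (lamvY c s). Qed.
Let eY0 c : 0 < esum_to N (vY c) x y.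
Proof. by case: (cost_word x d0 (vY0 c) wN). Qed.

Lemma menv_cost_le : menv pi (fun c => cost N (vY c) x y) <=
  (size w)%:R * (ln (2 * d)%:R + m1).
Proof.
apply: (@le_trans _ _ (menv pi (fun c => (size w)%:R * ln (2 * d)%:R +
    \sum_(s <- visited x w) vY c s))).
  by apply: menv_le => // c; case: (cost_word x d0 (vY0 c) wN).
rewrite menvD menv_cst// menv_sum mulrDr lerD2l.
have -> : (size w)%:R * m1 = \sum_(s <- visited x w) m1.
  by rewrite big_const_seq count_predT size_visited iter_addr_0 mulr_natl.
apply: ler_sum => s _; apply: le_trans EY; rewrite /vY /field.
case: insub => [i|]; last first.
  rewrite menv_cst// -(mulr1 lam) -pi_sum mulr_sumr.
  by apply: ler_sum => t _; rewrite mulrC ler_wpM2l.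
have := @menv_indep R T _ pi pi_sum i Y (fun=> 1) (fun _ _ => erefl).
rewrite menv_cst// mulr1 => <-.
by rewrite le_eqVlt; apply/orP; left; apply/eqP/eq_menv => c; rewrite mulr1.
Qed.

(** The weight factorizes over the sites. A visited site contributes a factor at
    most [rho] to the mean of the weight, so each new site of the range can be
    rewarded by [1 / rho] without the annealed partition function exceeding
    one. *)
Lemma menv_range_weight (theta : R) : expR theta * rho <= 1 -> 0 <= theta ->
  menv pi (fun c => pathsum y N x
    (fun l => weight (vY c) l * expR (theta * (size (undup l))%:R))) <= 1.
Proof.
move=> th th0; rewrite /menv.
under eq_bigr do rewrite -pathsumZ.
rewrite -pathsum_sum; apply: (@le_trans _ _ (esum_to N (fun=> 0) x y)); last first.
  exact: esum_to_le1.
apply: pathsum_le => l lb _.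
have -> : weight (fun=> 0 : R) l = 1 by rewrite /weight big1 ?oppr0 ?expR0.
pose h (i : seq_sub L) t := expR (- (Y t * (count_mem (val i) l)%:R) +
   theta * (val i \in l)%:R).
have E c : weight (vY c) l * expR (theta * (size (undup l))%:R) = \prod_i h i (c i).
  rewrite -expR_sum big_split/= expRD; congr (_ * _).
    rewrite /weight (@sum_count R d L)//; last by move=> z /lb/bL.
    rewrite sum_seq_sub sumrN; congr (expR (- _)).
    by apply: eq_bigr => i _; rewrite /vY field_val.
  rewrite -mulr_sumr; congr (expR (_ * _)).
  rewrite -(sum_seq_sub (fun z => (z \in l)%:R)) -natr_sum; congr (_%:R).
  transitivity (count [in l] L).
    rewrite -size_filter; apply/perm_size/uniq_perm; rewrite ?undup_uniq ?filter_uniq//.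
    move=> z; rewrite mem_undup mem_filter; case zl: (z \in l) => //=.
    by apply/esym/bL/lb.
  by rewrite -sum1_count big_mkcond/=; apply: eq_bigr => z _; case: (z \in l).
under eq_bigr do rewrite E.
rewrite [leLHS](menv_prod pi h).
apply: prodr_ile1 => i _; rewrite sumr_ge0 => [|t _]/=; last by rewrite mulr_ge0 ?expR_ge0.
have [il|il] := boolP (val i \in l); last first.
  rewrite /mean -pi_sum; apply: ler_sum => t _.
  by rewrite /h (negPf il) (count_memPn il) !mulr0 oppr0 addr0 expR0 mulr1.
apply: le_trans th; apply: (@le_trans _ _ (expR theta * mean pi (fun t => expR (- Y t)))).
  rewrite /mean mulr_sumr; apply: ler_sum => t _.
  rewrite mulrCA ler_wpM2l// -expRD ler_expR il mulr1 addrC lerD2l lerN2.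
  by rewrite ler_peMr ?(le_trans lam0)// ler1n -has_count has_pred1.
by rewrite ler_pM2l ?expR_gt0.
Qed.

(** The mean number of distinct sites visited under the polymer measure is linear
    in the length of a path joining the endpoints: the entropy of
    [range_entropy] is paid by the cost, which is at most the cost of that
    path. *)
Lemma menv_visits_le :
  \sum_(z <- L) menv pi (fun c => visit N (vY c) x y z / esum_to N (vY c) x y) <=
  (size w)%:R * (ln (2 * d)%:R + m1) / - ln rho.
Proof.
have th0 : 0 < - ln rho by rewrite oppr_gt0 ln_lt0// rho0.
rewrite ler_pdivlMr// mulrC -menv_sum -menvZ.
apply: le_trans menv_cost_le.
apply: (@le_trans _ _ (menv pi (fun c => cost N (vY c) x y + (pathsum y N x
    (fun l => weight (vY c) l * expR (- ln rho * (size (undup l))%:R)) - 1)))).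
  by apply: menv_le => // c; apply: range_entropy.
rewrite menvD gerDl menvB menv_cst// subr_le0.
apply: menv_range_weight; last exact: ltW.
by rewrite expRN lnK ?posrE// mulVf// gt_eqF.
Qed.

(** The heart of the matter. By [cost_sub_le] and the local time bound the increase
    of the cost is at most the sum over [z] of [X - Y] at [z] times a visit
    probability, which is replaced by [qvisit]; being independent of the
    increment, it splits off in the mean. With probability at least one half
    the value at [z] is at most [K], and [qvisit] is then comparable to the true
    visit probability, whose sum over [z] is linear by [menv_visits_le]. The
    constant does not depend on [N]. *)
Lemma menv_cost_lipschitz :
  menv pi (fun c => cost N (vX c) x y) - menv pi (fun c => cost N (vY c) x y) <=
  (mean pi X - mean pi Y) *
    (2 * C * expR ((K - lam) * C) * ((ln (2 * d)%:R + m1) / - ln rho)) * (size w)%:R.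
Proof.
pose q z c := qvisit N lam (vY c) x y z.
have q0 z c : 0 <= q z c.
  by rewrite mulr_ge0 ?visit_ge0// invr_ge0 esum_to_ge0.
have D0 : 0 <= mean pi X - mean pi Y.
  rewrite -sumrB; apply: sumr_ge0 => t _; rewrite -mulrBr mulr_ge0// subr_ge0//.
apply: (@le_trans _ _ (menv pi (fun c => \sum_(z <- L) C * ((vX c z - vY c z) * q z c)))).
  rewrite -menvB; apply: menv_le => // c.
  rewrite /=; apply: (le_trans (cost_sub_le (vX c) uL bL (eY0 c))); apply: ler_sum => z _.
  rewrite [leRHS]mulrCA ler_wpM2l ?subr_ge0//.
  apply: (@le_trans _ _ (C * (visit N (vY c) x y z / esum_to N (vY c) x y))).
    by rewrite mulrA ler_wpM2r ?invr_ge0 ?(ltW (eY0 c))// occC.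
  by rewrite ler_wpM2l// visit_le_qvisit.
rewrite menv_sum sum_seq_sub.
have qi (i : seq_sub L) c t : q (val i) (resample c i t) = q (val i) c.
  rewrite /q /qvisit; suff -> : upd (vY (resample c i t)) (val i) lam = upd (vY c) (val i) lam by [].
  apply/funext => s; rewrite /upd /vY /field; case: eqVneq => // si.
  case: insubP => // j _ js; rewrite ffunE; case: eqP => // ji.
  by rewrite -js ji eqxx in si.
have Eq (i : seq_sub L) : menv pi (q (val i)) <= 2 * expR ((K - lam) * C) *
    menv pi (fun c => visit N (vY c) x y (val i) / esum_to N (vY c) x y).
  apply: (@le_trans _ _ (2 * (menv pi (fun c => (Y (c i) <= K)%R%:R * q (val i) c)))).
    rewrite (@menv_indep R T _ pi pi_sum i (fun t => (Y t <= K)%R%:R)); last exact: qi.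
    rewrite mulrA ler_peMl ?menv_ge0//.
    rewrite -ler_pdivrMl// mulr1 (le_trans PK)// big_mkcond/= ler_sum// => t _.
    by case: ifP => _; rewrite ?mulr1 ?mulr0.
  rewrite -mulrA ler_pM2l// -menvZ; apply: menv_le => // c.
  have V0 : 0 <= visit N (vY c) x y (val i) / esum_to N (vY c) x y.
    by rewrite mulr_ge0 ?visit_ge0// invr_ge0 esum_to_ge0.
  have [YK|_] := boolP (Y (c i) <= K); last by rewrite mul0r mulr_ge0 ?expR_ge0.
  rewrite mul1r; apply: le_trans (qvisit_le_visit C0 (lamvY c (val i)) (eY0 c) _) _.
    by apply: occC => s; rewrite /upd; case: ifP.
  by rewrite ler_wpM2r// ler_expR ler_wpM2r// lerD2r /vY field_val.
apply: (@le_trans _ _ (\sum_(i : seq_sub L) (mean pi X - mean pi Y) * (C *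
    (2 * expR ((K - lam) * C) *
    menv pi (fun c => visit N (vY c) x y (val i) / esum_to N (vY c) x y))))).
  apply: ler_sum => i _; rewrite menvZ mulrCA ler_wpM2l//.
  apply: (@le_trans _ _ ((mean pi X - mean pi Y) * menv pi (q (val i)))); last first.
    by rewrite ler_wpM2l.
  have -> : mean pi X - mean pi Y = mean pi (fun t => X t - Y t).
    by rewrite -sumrB; apply: eq_bigr => t _; rewrite mulrBr.
  rewrite -(menv_indep pi_sum (fun t => X t - Y t) (qi i)).
  by apply: menv_le => // c; rewrite /vX /vY !field_val.
have := menv_visits_le; rewrite sum_seq_sub => S.
rewrite (_ : \sum_i _ = (mean pi X - mean pi Y) * (2 * C * expR ((K - lam) * C)) *
   \sum_(i : seq_sub L) menv pi (fun c => visit N (vY c) x y (val i) / esum_to N (vY c) x y)); last first.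
  by rewrite mulr_sumr; apply: eq_bigr => i _; ring.
apply: (le_trans (ler_wpM2l _ S)); first by rewrite !mulr_ge0// ?expR_ge0.
rewrite le_eqVlt; apply/orP; left; apply/eqP.
by move: ((- ln rho)^-1) => r; ring.
Qed.

End finite_comparison.

(** * Quantile coupling of two laws on a finite chain *)

(** A law and its image under a map of alphabets give the same means; below the
    maps are the two projections of a coupling. *)
Section push_forward.
Context (R : realType) (T T' I : finType) (pi : T -> R) (phi : T -> T').

Lemma menv_push (pi' : T' -> R) (g : {ffun I -> T'} -> R) :
  (forall t', pi' t' = \sum_(t | phi t == t') pi t) ->
  menv pi (fun c : {ffun I -> T} => g [ffun i => phi (c i)]) = menv pi' g.
Proof.
move=> piE; rewrite /menv (partition_big (fun c : {ffun I -> T} => [ffun i => phi (c i)]) xpredT)//=.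
apply: eq_bigr => c' _; rewrite /wenv.
under [in RHS]eq_bigr do rewrite piE.
rewrite (bigA_distr_big_dep (fun i t => phi t == c' i) (fun _ t => pi t))/= mulr_suml.
apply: eq_big => [c|c /eqP <-//].
apply/eqP/familyP => [<- i|H]; first by rewrite unfold_in /= ffunE.
by apply/ffunP => i; rewrite ffunE; apply/eqP/H.
Qed.

Lemma mean_push (pi' : T' -> R) (f : T' -> R) :
  (forall t', pi' t' = \sum_(t | phi t == t') pi t) ->
  mean pi (f \o phi) = mean pi' f.
Proof.
move=> piE; rewrite /mean (partition_big phi xpredT)//=; apply: eq_bigr => t' _.
by rewrite piE mulr_suml; apply: eq_bigr => t /eqP <-.
Qed.

End push_forward.

Section monotone_coupling.
Context (R : realType) (n : nat).
Implicit Types (U W : nat -> R).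

Definition clip (a b t : R) : R := Num.max a (Num.min b t).

Lemma clip_sub (a b c e : R) : a <= b -> c <= e ->
  clip a b e - clip a b c = Num.max 0 (Num.min b e - Num.max a c).
Proof.
move=> ab ce; rewrite /clip.
case: (lerP b e) => be; case: (lerP b c) => bc; case: (lerP a e) => ae;
  case: (lerP a c) => ac; rewrite ?(max_r ab);
  (rewrite max_r; last lra) || (rewrite max_l; last lra); lra.
Qed.

Lemma clip_sym (a b c e : R) : a <= b -> c <= e ->
  clip a b e - clip a b c = clip c e b - clip c e a.
Proof. by move=> ab ce; rewrite !clip_sub// (minC e) (maxC c). Qed.

Lemma clip_lo (a b t : R) : t <= a -> clip a b t = a.
Proof. by move=> ta; rewrite /clip max_l// ge_min ta orbT. Qed.
Lemma clip_hi (a b t : R) : a <= b -> b <= t -> clip a b t = b.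
Proof. by move=> ab bt; rewrite /clip min_l// max_r. Qed.
Lemma clip_le (a b s t : R) : s <= t -> clip a b s <= clip a b t.
Proof.
by move=> st; rewrite /clip ge_max !le_max lexx/= le_min !ge_min lexx st !orbT.
Qed.

Lemma telescope_ord (f : nat -> R) h : (h <= n)%N ->
  \sum_(j < n | (j < h)%N) (f j.+1 - f j) = f h - f 0%N.
Proof.
move=> hn; rewrite -(big_ord_widen _ (fun j => f j.+1 - f j) hn).
by rewrite -(big_mkord xpredT (fun j => f j.+1 - f j)) telescope_sumr.
Qed.

(** The value at [h] is the mass of the letters strictly below [h]. *)
Definition cdf_on U := [/\ {homo U : i j / (i <= j)%N >-> i <= j}, U 0%N = 0 & U n = 1].

(** The quantile coupling: letter [i] owns the interval from [U i] to [U i.+1] of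
    the unit interval for the first law, likewise [j] for the second, and the
    pair receives the length of the overlap, written here as an increment so
    that sums telescope. *)
Definition coupling U W (p : 'I_n * 'I_n) : R :=
  clip (U p.1) (U p.1.+1) (W p.2.+1) - clip (U p.1) (U p.1.+1) (W p.2).

Definition increments U (i : 'I_n) : R := U i.+1 - U i.

Lemma coupling_ge0 U W p : cdf_on U -> cdf_on W -> 0 <= coupling U W p.
Proof. by move=> _ [Wh _ _]; rewrite subr_ge0 clip_le// Wh. Qed.

Lemma coupling_sym U W i j : cdf_on U -> cdf_on W ->
  coupling U W (i, j) = coupling W U (j, i).
Proof. by move=> [Uh _ _] [Wh _ _]; rewrite /coupling clip_sym/= ?Uh ?Wh. Qed.

Lemma coupling_row U W h i : cdf_on U -> cdf_on W -> (h <= n)%N ->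
  \sum_(j < n | (j < h)%N) coupling U W (i, j) =
  clip (U i) (U i.+1) (W h) - U i.
Proof.
move=> [Uh U0 Un] [Wh W0 Wn] hn.
rewrite (telescope_ord (fun j => clip (U i) (U i.+1) (W j)) hn) W0.
by rewrite (@clip_lo _ _ 0)// -U0 Uh.
Qed.

Lemma coupling_fst U W i : cdf_on U -> cdf_on W ->
  \sum_(p : 'I_n * 'I_n | p.1 == i) coupling U W p = increments U i.
Proof.
move=> HU HW; have [Uh U0 Un] := HU; have [Wh W0 Wn] := HW.
transitivity (\sum_(j < n | (j < n)%N) coupling U W (i, j)); last first.
  rewrite coupling_row// Wn clip_hi ?Uh// -Un Uh//.
rewrite (reindex_onto (fun j => (i, j)) snd)/=; last by move=> [a b] /= /eqP ->.
by apply: eq_bigl => j; rewrite !eqxx ltn_ord.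
Qed.

Lemma coupling_snd U W j : cdf_on U -> cdf_on W ->
  \sum_(p : 'I_n * 'I_n | p.2 == j) coupling U W p = increments W j.
Proof.
move=> HU HW; rewrite -(@coupling_fst W U j HW HU).
rewrite (reindex_inj (_ : injective (fun p : 'I_n * 'I_n => (p.2, p.1))))/=; last first.
  by move=> [a b] [c e] [-> ->].
by apply: eq_bigr => -[a b] _ /=; rewrite coupling_sym.
Qed.

Lemma coupling_sum U W : cdf_on U -> cdf_on W -> \sum_p coupling U W p = 1.
Proof.
move=> HU HW; have [Uh U0 Un] := HU.
rewrite (partition_big fst xpredT)//=.
under eq_bigr do rewrite coupling_fst//.
rewrite /increments -(big_mkord xpredT (fun i => U i.+1 - U i)) telescope_sumr//.
by rewrite Un U0 subr0.
Qed.

(** The quantile coupling is comonotone: the event that both letters are below [h]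
    has the largest possible probability. This makes it optimal for the
    distance of transport. *)
Lemma coupling_lt U W h : cdf_on U -> cdf_on W -> (h <= n)%N ->
  \sum_(p : 'I_n * 'I_n | (p.1 < h)%N && (p.2 < h)%N) coupling U W p = Num.min (U h) (W h).
Proof.
move=> HU HW hn; have [Uh U0 Un] := HU; have [Wh W0 Wn] := HW.
rewrite -(pair_big (fun i : 'I_n => (i < h)%N) (fun j : 'I_n => (j < h)%N)
  (fun i j => coupling U W (i, j)))/=.
under eq_bigr do rewrite coupling_row//.
have W1 : 0 <= W h by rewrite -W0 Wh.
transitivity (\sum_(i < n | (i < h)%N) (clip 0 (W h) (U i.+1) - clip 0 (W h) (U i))).
  apply: eq_bigr => i _; rewrite -clip_sym ?Uh//.
  by rewrite (@clip_lo _ _ 0)// -U0 Uh.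
rewrite (telescope_ord (fun i => clip 0 (W h) (U i)) hn) U0 (@clip_lo 0 _ 0)// subr0 /clip max_r; first by rewrite minC.
by rewrite le_min W1 -U0 Uh.
Qed.

Lemma increments_lt U h : cdf_on U -> (h <= n)%N ->
  \sum_(i < n | (i < h)%N) increments U i = U h.
Proof.
by move=> [_ U0 _] hn; rewrite (telescope_ord U hn) U0 subr0.
Qed.

Lemma coupling_fst_lt U W h : cdf_on U -> cdf_on W -> (h <= n)%N ->
  \sum_(p : 'I_n * 'I_n | (p.1 < h)%N) coupling U W p = U h.
Proof.
move=> HU HW hn; rewrite -(increments_lt HU hn).
rewrite (partition_big fst (fun i : 'I_n => (i < h)%N))//=; apply: eq_bigr => i ih.
rewrite -(coupling_fst i HU HW); apply: eq_bigl => p.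
by case: eqP => [->|]; rewrite ?ih ?andbF.
Qed.

Lemma coupling_snd_lt U W h : cdf_on U -> cdf_on W -> (h <= n)%N ->
  \sum_(p : 'I_n * 'I_n | (p.2 < h)%N) coupling U W p = W h.
Proof.
move=> HU HW hn; rewrite -(increments_lt HW hn).
rewrite (partition_big snd (fun i : 'I_n => (i < h)%N))//=; apply: eq_bigr => i ih.
rewrite -(coupling_snd i HU HW); apply: eq_bigl => p.
by case: eqP => [->|]; rewrite ?ih ?andbF.
Qed.

Lemma levels_between (i j : nat) : (i <= n)%N ->
  \sum_(h < n) ((j <= h) && (h < i))%N%:R = (i - j)%N%:R :> R.
Proof.
move=> in_; rewrite -natr_sum; congr (_%:R).
rewrite -(big_mkord xpredT (fun h => nat_of_bool ((j <= h) && (h < i))%N)).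
transitivity (count (fun h => (j <= h) && (h < i))%N (iota 0 n)).
  rewrite -sum1_count [RHS]big_mkcond/= /index_iota subn0.
  by apply: eq_bigr => h _; case: ifP.
rewrite -size_filter.
have -> : [seq h <- iota 0 n | (j <= h)%N && (h < i)%N] = iota j (i - j).
  apply: (irr_sorted_eq ltn_trans ltnn).
  - by rewrite sorted_filter ?iota_ltn_sorted//; exact: ltn_trans.
  - exact: iota_ltn_sorted.
  - move=> h; rewrite mem_filter !mem_iota add0n /=.
    by apply/idP/idP; lia.
by rewrite size_iota.
Qed.

(** The excess of the first letter over the second counts the levels between them,
    and a level separates them in this order with probability the positive part
    of the difference of the distribution functions, by [coupling_lt]. *)
Lemma coupling_excess U W : cdf_on U -> cdf_on W ->
  mean (coupling U W) (fun p => (p.1 - p.2)%N%:R) <=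
  \sum_(h < n) `|U h.+1 - W h.+1|.
Proof.
move=> HU HW; rewrite /mean.
under eq_bigr => p _ do rewrite -(levels_between p.2 (ltnW (ltn_ord p.1))) mulr_sumr.
rewrite exchange_big/=; apply: ler_sum => h _.
have hn : (h < n)%N by [].
have H : \sum_(p : 'I_n * 'I_n | (p.2 < h.+1)%N) coupling U W p =
    \sum_(p : 'I_n * 'I_n | (p.1 < h.+1)%N && (p.2 < h.+1)%N) coupling U W p +
    \sum_(p : 'I_n * 'I_n) coupling U W p * ((p.2 <= h) && (h < p.1))%N%:R.
  rewrite big_mkcond [X in _ = X + _]big_mkcond -big_split/=.
  apply: eq_bigr => p _; rewrite !ltnS (ltnNge h).
  by case: (p.2 <= h)%N; case: (p.1 <= h)%N; rewrite /= ?mulr1 ?mulr0 ?addr0 ?add0r.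
rewrite coupling_snd_lt// coupling_lt// in H.
have -> : \sum_(p : 'I_n * 'I_n) coupling U W p * ((p.2 <= h) && (h < p.1))%N%:R =
  W h.+1 - Num.min (U h.+1) (W h.+1).
  by apply/esym/eqP; rewrite subr_eq addrC; apply/eqP.
rewrite /Num.min; case: ifPn => ?; last by rewrite subrr.
by rewrite -normrN opprB ler_norm.
Qed.

End monotone_coupling.

(** * Potentials with a law on a grid *)

Section grid_laws.
Context (R : realType).
Implicit Types (F : R -> R) (m M h : nat).

Definition is_df F := {homo F : s t / s <= t} /\ forall t, 0 <= F t <= 1.

(** Distribution function, in the sense of [cdf_on], of the potential rounded up
    to a multiple of [1 / m] and capped at [M / m]. *)
Definition levels F m M (i : nat) : R :=
  if i is i'.+1 then (if (i' < M)%N then F (i'%:R / m%:R) else 1) else 0.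

Lemma levels_cdf F m M : is_df F -> cdf_on M.+1 (levels F m M).
Proof.
move=> [Fh F01]; split => //; last by rewrite /= ltnn.
move=> [|i] [|j] //= ij.
  by case: ifP => // _; case/andP: (F01 (j%:R / m%:R)).
case: (ltnP j M) => jM; last by case: ifP => // _; case/andP: (F01 (i%:R / m%:R)).
rewrite (leq_ltn_trans _ jM)//; apply: Fh.
by rewrite ler_wpM2r// ler_nat.
Qed.

Definition glaw F m M : 'I_M.+1 -> R := increments (levels F m M).
Definition grid m M (i : 'I_M.+1) : R := i%:R / m%:R.
(** Riemann sum for the distance of transport, the integral of [`|F - F'|]. *)
Definition wass F F' m M : R :=
  (\sum_(h < M) `|F (h%:R / m%:R) - F' (h%:R / m%:R)|) / m%:R.
Definition gmean F m M : R := (\sum_(h < M) (1 - F (h%:R / m%:R))) / m%:R.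

Lemma glaw_sum F m M : is_df F -> \sum_i @glaw F m M i = 1.
Proof.
move=> dF; have HU := levels_cdf m M dF; have [_ _ <-] := HU.
by rewrite -(increments_lt HU (leqnn _)); apply: eq_bigl => i; rewrite ltn_ord.
Qed.

Lemma glaw_mean F m M : is_df F -> mean (@glaw F m M) (@grid m M) = gmean F m M.
Proof.
move=> dF; have HU := levels_cdf m M dF.
rewrite /mean /grid; under eq_bigr do rewrite mulrA.
rewrite -mulr_suml; congr (_ / _).
transitivity (\sum_(i < M.+1) \sum_(h < M.+1) glaw F m i * (h < i)%N%:R).
  apply: eq_bigr => i _; rewrite -mulr_sumr; congr (_ * _).
  rewrite -[in LHS](subn0 i) -(@levels_between R M.+1 i 0 (ltnW (ltn_ord i))).
  by apply: eq_bigr => h _; rewrite leq0n.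
rewrite exchange_big/= big_ord_recr/= [X in _ + X]big1 ?addr0; last first.
  by move=> i _; rewrite ltnNge -ltnS ltn_ord mulr0.
apply: eq_bigr => h _.
have hM : (h.+1 <= M.+1)%N by rewrite ltnS ltnW.
have := increments_lt HU hM; rewrite /= ltn_ord => <-.
rewrite -[X in _ = X - _](@glaw_sum F m M)// [X in _ - X]big_mkcond -sumrB.
apply: eq_bigr => i _; rewrite ltnS (ltnNge h).
by case: ifP => _; rewrite /= ?mulr1 ?mulr0 /glaw ?subrr ?subr0.
Qed.

Lemma wass_excess F F' m M : is_df F -> is_df F' ->
  mean (coupling (n := M.+1) (levels F m M) (levels F' m M))
    (fun p => (p.1 - p.2)%N%:R / m%:R) <= wass F F' m M.
Proof.
move=> dF dF'; rewrite /mean; under eq_bigr do rewrite mulrA.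
rewrite -mulr_suml ler_wpM2r//.
apply: (le_trans (coupling_excess (levels_cdf m M dF) (levels_cdf m M dF'))).
rewrite big_ord_recr/= ltnn subrr normr0 addr0 le_eqVlt; apply/orP; left.
by apply/eqP; apply: eq_bigr => h _; rewrite ltn_ord.
Qed.

Lemma wassC F F' m M : wass F F' m M = wass F' F m M.
Proof. by rewrite /wass; under eq_bigr do rewrite distrC. Qed.

End grid_laws.

Lemma field_push (R : realType) (d : nat) (T T' : finType) (L : seq 'rV[int]_d)
    (phi : T -> T') (X : T' -> R) (lam : R) (c : {ffun seq_sub L -> T}) :
  field X lam [ffun i => phi (c i)] = field (fun t => X (phi t)) lam c.
Proof.
by apply/funext => s; rewrite /field; case: insub => // i; rewrite ffunE.
Qed.

Section grid_expectation.
Context (R : realType) (d : nat) (L : seq 'rV[int]_d).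
Local Notation site := 'rV[int]_d.
Implicit Types (F : R -> R) (m M : nat) (Psi : (site -> R) -> R).

Definition gexp F m M Psi : R :=
  menv (@glaw R F m M)
    (fun c : {ffun seq_sub L -> 'I_M.+1} => Psi (field (@grid R m M) 0 c)).

Lemma gexp_fst F F' m M Psi : is_df F -> is_df F' ->
  gexp F m M Psi = menv (coupling (n := M.+1) (levels F m M) (levels F' m M))
    (fun c : {ffun seq_sub L -> _} => Psi (field (@grid R m M \o fst) 0 c)).
Proof.
move=> dF dF'; rewrite /gexp.
rewrite -(@menv_push R _ _ _ (coupling (n := M.+1) (levels F m M) (levels F' m M)) fst
  (glaw F m (M:=M)) (fun c => Psi (field (grid R m (M:=M)) 0 c))).
  by apply: eq_menv => c; rewrite field_push.
by move=> i; rewrite coupling_fst//; exact: levels_cdf.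
Qed.

Lemma gexp_snd F F' m M Psi : is_df F -> is_df F' ->
  gexp F' m M Psi = menv (coupling (n := M.+1) (levels F m M) (levels F' m M))
    (fun c : {ffun seq_sub L -> _} => Psi (field (@grid R m M \o snd) 0 c)).
Proof.
move=> dF dF'; rewrite /gexp.
rewrite -(@menv_push R _ _ _ (coupling (n := M.+1) (levels F m M) (levels F' m M)) snd
  (glaw F' m (M:=M)) (fun c => Psi (field (grid R m (M:=M)) 0 c))).
  by apply: eq_menv => c; rewrite field_push.
by move=> i; rewrite coupling_snd//; exact: levels_cdf.
Qed.

(** The soft estimate: its constant grows with the number of sites, so it serves
    only at fixed endpoints and fixed [N]. *)
Lemma gexp_wass F F' m M Psi (B : R) : is_df F -> is_df F' -> 0 <= B ->
  (forall v v' : site -> R, Psi v - Psi v' <= B * \sum_(z <- L) `|v z - v' z|) ->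
  gexp F m M Psi - gexp F' m M Psi <= B * (size L)%:R * (2 * wass F F' m M).
Proof.
move=> dF dF' B0 HPsi; rewrite (gexp_fst m M Psi dF dF') (gexp_snd m M Psi dF dF').
have HU := levels_cdf m M dF; have HW := levels_cdf m M dF'.
set pi := coupling _ _; have pi0 p : 0 <= pi p by exact: coupling_ge0.
have pi1 : \sum_p pi p = 1 by exact: coupling_sum.
rewrite -menvB; apply: (@le_trans _ _ (menv pi (fun c : {ffun seq_sub L -> _} => \sum_(z <- L)
   B * `|field (@grid R m M \o fst) 0 c z - field (@grid R m M \o snd) 0 c z|))).
  by apply: menv_le => // c; rewrite -mulr_sumr.
rewrite menv_sum; under eq_bigr do rewrite menvZ.
rewrite -mulr_sumr -mulrA ler_wpM2l// mulr_natl -iter_addr_0 -(count_predT L) -big_const_seq.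
apply: ler_sum => z _.
pose D (p : 'I_M.+1 * 'I_M.+1) : R := (p.1 - p.2)%N%:R / m%:R + (p.2 - p.1)%N%:R / m%:R.
have DE p : `|grid R m p.1 - grid R m p.2| = D p.
  rewrite /D /grid -mulrBl normrM -mulrDl (@ger0_norm R m%:R^-1)//; congr (_ * _).
  have [pp|/ltnW pp] := leqP p.1 p.2.
    by rewrite (eqP pp) add0r distrC ger0_norm ?subr_ge0 ?ler_nat// natrB.
  by rewrite (eqP pp) addr0 ger0_norm ?subr_ge0 ?ler_nat// natrB.
have D0 p : 0 <= D p by rewrite -DE.
have mD : mean pi D <= 2 * wass F F' m M.
  rewrite /mean /D; under eq_bigr do rewrite mulrDr.
  rewrite big_split/= mulr2n mulrDl mul1r lerD//; first exact: wass_excess.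
  rewrite wassC; apply: le_trans (wass_excess m M dF' dF).
  rewrite [leRHS](reindex_inj (_ : injective (fun p : 'I_M.+1 * 'I_M.+1 => (p.2, p.1))))/=; last first.
    by move=> [a b] [c e] [-> ->].
  by rewrite le_eqVlt; apply/orP; left; apply/eqP; apply: eq_bigr => -[i j] _; rewrite /pi coupling_sym.
rewrite /field; case: (insub z) => [i|]; last first.
  rewrite subrr normr0 menv_cst//; apply: le_trans mD.
  by apply: sumr_ge0 => p _; rewrite mulr_ge0.
apply: le_trans mD; have := @menv_indep R _ _ pi pi1 i D (fun=> 1) (fun _ _ => erefl).
rewrite menv_cst// mulr1 => <-.
by apply: menv_le => // c; rewrite /= DE mulr1.
Qed.

Lemma esum_to_ext N (v v' : site -> R) x y : {in ball N x, v =1 v'} ->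
  esum_to N v x y = esum_to N v' x y.
Proof.
move=> vv; apply: eq_pathsum => l lb _; rewrite /weight; congr (expR (- _)).
by apply: eq_big_seq => s /lb/vv.
Qed.

Hypothesis uL : uniq L.
Variables (N : nat) (x : site) (w : seq ('I_d * bool)).
Hypotheses (d0 : (0 < d)%N) (wN : (size w <= N)%N) (bL : {subset ball N x <= L}).
Variables (lam C : R).
Hypotheses (lam0 : 0 <= lam) (C0 : 0 <= C).
Hypothesis occC : forall (v : site -> R) N x y z, (forall s, lam <= v s) ->
  occup N v x y z <= C * visit N v x y z.
Let y := x + \sum_(s <- w) step s.

(** The constant of [menv_cost_lipschitz] when half of the mass is below [k0], the
    mean is at most [lam + m1], and mass at least [delta] lies above [eta] for
    each of the two laws, whence for their minimum. *)
Definition lip_const (k0 : nat) (eta delta m1 : R) : R :=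
  2 * C * expR ((k0%:R - lam) * C) *
    ((ln (2 * d)%:R + (lam + m1)) / - ln (1 - delta * (1 - expR (- eta)))).

(** As the cap is at least [lam], the grid law charges no point below [lam], and
    taking the maximum with [lam] changes nothing almost surely; but it gives
    the lower bound at every letter and every site that [menv_cost_lipschitz]
    asks for. *)
Lemma gexp_above F m M (X : 'I_M.+1 -> R) : (0 < m)%N -> is_df F ->
  (forall t, 0 <= t -> t < lam -> F t = 0) -> lam <= M%:R / m%:R ->
  (forall i, X i = Num.max lam (grid R m i)) ->
  menv (glaw F m (M:=M)) (fun c : {ffun seq_sub L -> _} => cost N (field X lam c) x y) =
  gexp F m M (fun v => cost N v x y).
Proof.
move=> m0 dF Flam lamM XE; apply: eq_bigr => c _.
have [[i ci]|H] := pselect (exists i, glaw F m (c i) = 0).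
  by rewrite /wenv (bigD1 i)//= ci !mul0r.
congr (_ * _); rewrite /cost; congr (- ln _); apply: esum_to_ext => s /bL sL.
rewrite /field insubT XE max_r// leNgt; apply/negP => ilam; apply: H.
set i := Sub s sL in ilam; exists i; move: ilam; rewrite /grid /glaw /increments.
case: (c i) => -[|k] /= kM kl.
  case: ifP => [M0|M0]; first by rewrite mul0r Flam ?subrr//; move: kl; rewrite mul0r.
  by move: kl; rewrite ltNge (le_trans lamM)// ler_wpM2r// ler_nat leqNgt M0.
have kM' : (k < M)%N by [].
rewrite kM'; case: ifP => k1M.
  rewrite !Flam ?subrr// ?divr_ge0//; apply: lt_trans kl.
  by rewrite ltr_pM2r ?invr_gt0 ?ltr0n// ltr_nat.
have kE : k.+1 = M by apply/eqP; rewrite eqn_leq kM' leqNgt k1M.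
by move: kl; rewrite kE ltNge lamM.
Qed.

(** [menv_cost_lipschitz] for the quantile coupling of the two grid laws, with [X]
    the first potential and [Y] the minimum of both: the cost for the second
    potential is at least the cost for [Y], and the mean of [X - Y] is at most
    [wass]. *)
Lemma gexp_lipschitz F F' m M (k0 : nat) (eta delta m1 : R) :
  (0 < m)%N -> is_df F -> is_df F' ->
  (forall t, 0 <= t -> t < lam -> F t = 0) ->
  (forall t, 0 <= t -> t < lam -> F' t = 0) ->
  lam <= M%:R / m%:R -> eta <= M%:R / m%:R -> (k0 * m < M)%N ->
  lam <= k0%:R -> 2^-1 <= F k0%:R ->
  0 < eta -> 0 < delta -> delta <= 1 -> F eta <= 1 - delta -> F' eta <= 1 - delta ->
  gmean F m M <= m1 ->
  gexp F m M (fun v => cost N v x y) - gexp F' m M (fun v => cost N v x y) <=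
  wass F F' m M * lip_const k0 eta delta m1 * (size w)%:R.
Proof.
move=> m0 dF dF' Fl F'l lamM etaM k0M lamk0 Fk0 eta0 delta0 delta1 Feta F'eta Fm1.
have HU := levels_cdf m M dF; have HW := levels_cdf m M dF'.
set pi := coupling (n := M.+1) (levels F m M) (levels F' m M).
have pi0 p : 0 <= pi p by exact: coupling_ge0.
have pi1 : \sum_p pi p = 1 by exact: coupling_sum.
have m0R : 0 < m%:R :> R by rewrite ltr0n.
pose X (p : 'I_M.+1 * 'I_M.+1) : R := Num.max lam (grid R m p.1).
pose X' (p : 'I_M.+1 * 'I_M.+1) : R := Num.max lam (grid R m p.2).
pose Y p := Num.min (X p) (X' p).
have push1 : forall i, glaw F m i = \sum_(p | p.1 == i) pi p.
  by move=> i; rewrite coupling_fst.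
have push2 : forall i, glaw F' m i = \sum_(p | p.2 == i) pi p.
  by move=> i; rewrite coupling_snd.
have -> : gexp F m M (fun v => cost N v x y) =
    menv pi (fun c : {ffun seq_sub L -> _} => cost N (field X lam c) x y).
  rewrite -(gexp_above (X := fun i => Num.max lam (grid R m i)))// -(menv_push _ push1).
  by apply: eq_menv => c; rewrite field_push.
have -> : gexp F' m M (fun v => cost N v x y) =
    menv pi (fun c : {ffun seq_sub L -> _} => cost N (field X' lam c) x y).
  rewrite -(gexp_above (X := fun i => Num.max lam (grid R m i)))// -(menv_push _ push2).
  by apply: eq_menv => c; rewrite field_push.
have lamY p : lam <= Y p by rewrite /Y /X /X' le_min !le_max !lexx.
have YX p : Y p <= X p by rewrite ge_min lexx.
have YX' p : Y p <= X' p by rewrite ge_min lexx orbT.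
have v0 (V : 'I_M.+1 * 'I_M.+1 -> R) (c : {ffun seq_sub L -> _}) s :
    (forall p, lam <= V p) -> 0 <= field V lam c s.
  by move=> lV; rewrite /field; case: insub => [i|//]; apply: le_trans (lV _).
apply: (@le_trans _ _ (menv pi (fun c : {ffun seq_sub L -> _} => cost N (field X lam c) x y) -
    menv pi (fun c : {ffun seq_sub L -> _} => cost N (field Y lam c) x y))).
  rewrite lerD2l lerN2; apply: menv_le => // c.
  have [eX' _] := cost_word x d0 (fun s => v0 X' c s (fun p => le_trans (lamY p) (YX' p))) wN.
  have [eY _] := cost_word x d0 (fun s => v0 Y c s lamY) wN.
  rewrite lerN2 ler_ln ?posrE//; apply: esum_to_anti => s.
  by rewrite /field; case: insub.
have e1 : 0 < 1 - expR (- eta) by rewrite subr_gt0 -expR0 ltr_expR oppr_lt0.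
have e2 := expR_gt0 (- eta).
(* Mass delta above eta bounds the Laplace transform at one by rho. *)
set rho := 1 - delta * (1 - expR (- eta)).
have rho0 : 0 < rho by rewrite /rho; nra.
have rho1 : rho < 1 by rewrite /rho; nra.
have mX : mean pi X <= lam + m1.
  pose Z (p : 'I_M.+1 * 'I_M.+1) : R := lam + grid R m p.1.
  apply: (@le_trans _ _ (mean pi Z)).
    apply: ler_sum => p _; rewrite ler_wpM2l// /X ge_max /= lerDl lerDr lam0 andbT.
    by rewrite divr_ge0.
  rewrite /mean /Z; under eq_bigr do rewrite mulrDr.
  rewrite big_split/= -mulr_suml pi1 mul1r lerD2l; apply: le_trans Fm1.
  by rewrite -glaw_mean// -(mean_push _ push1).
have mY : mean pi Y <= lam + m1.
  by apply: le_trans mX; apply: ler_sum => p _; rewrite ler_wpM2l.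
have lip := @menv_cost_lipschitz R d _ pi pi0 pi1 L uL N x w d0 wN bL X Y lam C k0%:R rho (lam + m1)
  lam0 lamY YX C0 (fun v y z => @occC v N x y z) _ rho0 rho1 _ mY.
apply: (le_trans (lip _ _)) => {lip}.
- have := coupling_fst_lt HU HW (_ : ((k0 * m).+1 <= M.+1)%N).
  rewrite /= k0M natrM mulfK ?gt_eqF// => H.
  apply: (le_trans Fk0); rewrite -H; last by rewrite ltnS ltnW.
  rewrite big_mkcond [leRHS]big_mkcond; apply: ler_sum => p _ /=.
  case: ifPn => [pk|_]; last by case: ifP.
  rewrite ge_min ge_max lamk0 /= /grid ler_pdivrMr// -natrM ler_nat.
  by rewrite -ltnS pk.
- have exh : exists h, eta <= h%:R / m%:R by exists M.
  case: (ex_minnP exh) => h etah minh.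
  have hM : (h <= M)%N by exact: minh.
  (* The first grid point at or above eta separates the letters that contribute
     to the gap of the Laplace transform. *)
  have Ulev G : G eta <= 1 - delta -> is_df G -> levels G m M h <= 1 - delta.
    case: h minh etah hM => [|h] minh _ hM Ge [Gh _] /=; first by lra.
    rewrite hM; apply: le_trans Ge; apply: Gh; rewrite leNgt; apply/negP => /ltW /minh.
    by rewrite ltnn.
  pose A (p : 'I_M.+1 * 'I_M.+1) := ((h <= p.1) && (h <= p.2))%N.
  (* The quantile coupling is comonotone, so the event that both letters lie
     above has the smaller of the two probabilities. *)
  have PA : delta <= \sum_(p | A p) pi p.
    have : \sum_(p | A p) pi p + \sum_(p : 'I_M.+1 * 'I_M.+1 | (p.1 < h)%N) pi p +
        \sum_(p : 'I_M.+1 * 'I_M.+1 | (p.2 < h)%N) pi p =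
        \sum_p pi p + \sum_(p : 'I_M.+1 * 'I_M.+1 | (p.1 < h)%N && (p.2 < h)%N) pi p.
      rewrite big_mkcond [X in _ + X + _]big_mkcond [X in _ + _ + X = _]big_mkcond.
      rewrite [X in _ = _ + X]big_mkcond -!big_split; apply: eq_bigr => p _ /=.
      rewrite /A !(leqNgt h).
      by case: (p.1 < h)%N; case: (p.2 < h)%N => /=; ring.
    rewrite pi1 /pi coupling_fst_lt ?leqW// coupling_snd_lt ?leqW// coupling_lt ?leqW//.
    have := Ulev _ Feta dF; have := Ulev _ F'eta dF'.
    by rewrite /Num.min; case: ifP => _ ? ? ?; lra.
  apply: (@le_trans _ _ (mean pi (fun p => 1 - (1 - expR (- eta)) * (A p)%:R))).
    apply: ler_sum => p _; rewrite ler_wpM2l//.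
    have [/andP[h1 h2]|_] := boolP (A p).
      rewrite mulr1 opprB addrC subrK ler_expR lerN2 (le_trans etah)//.
      by rewrite /Y /X /X' le_min !le_max /grid !ler_pM2r ?invr_gt0// !ler_nat h1 h2 !orbT.
    by rewrite mulr0 subr0 -expR0 ler_expR oppr_le0 (le_trans lam0).
  rewrite /mean; under eq_bigr do rewrite mulrBr mulr1 mulrCA.
  rewrite sumrB pi1 -mulr_sumr /rho lerD2l lerN2 mulrC ler_wpM2l ?(ltW e1)//.
  apply: (le_trans PA); rewrite big_mkcond; apply: ler_sum => p _.
  by case: (A p); rewrite /= ?mulr1 ?mulr0.
rewrite -/rho /lip_const -/rho ler_wpM2r// ler_wpM2r//; last first.
  apply: le_trans (wass_excess m M dF dF').
  rewrite -/pi -sumrB; apply: ler_sum => p _; rewrite -mulrBr ler_wpM2l//.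
  have pp : 0 <= (p.1 - p.2)%N%:R / m%:R :> R by rewrite divr_ge0.
  have H : grid R m p.1 - grid R m p.2 <= (p.1 - p.2)%N%:R / m%:R.
    rewrite /grid -mulrBl ler_wpM2r ?invr_ge0// lerBlDr -natrD ler_nat.
    by rewrite addnC -leq_subLR.
  rewrite /Y /X /X'; case: (lerP lam (grid R m p.1)) => ?; case: (lerP lam (grid R m p.2)) => ?;
    by rewrite /Num.min; case: ifP => _; lra.
rewrite !mulr_ge0 ?expR_ge0// ?addr_ge0//.
- by rewrite ln_ge0// ler1n muln_gt0.
- apply: le_trans Fm1; rewrite divr_ge0// sumr_ge0// => i _; rewrite subr_ge0.
  by case: dF => _ F01; case/andP: (F01 (i%:R / m%:R)).
- by rewrite invr_ge0 oppr_ge0 ltW// ln_lt0// rho0.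
Qed.

End grid_expectation.

(** * Weak convergence under domination *)

Section continuity_points.
Context (R : realType) (F : R -> R).
Hypothesis Fh : {homo F : s t / s <= t}.

(* Among the two inner intervals one carries at most half of the oscillation;
   taking fifths keeps it away from the endpoints. *)
Let fifth (p : R * R) (k : nat) : R := p.1 + k%:R * ((p.2 - p.1) / 5).

Let shrink (p : R * R) : R * R :=
  if F (fifth p 2) - F (fifth p 1) <= F (fifth p 4) - F (fifth p 3)
  then (fifth p 1, fifth p 2) else (fifth p 3, fifth p 4).

Let shrinkP p : p.1 < p.2 ->
  [/\ p.1 < (shrink p).1, (shrink p).1 < (shrink p).2, (shrink p).2 < p.2 &
      F (shrink p).2 - F (shrink p).1 <= (F p.2 - F p.1) / 2].
Proof.
move=> pp; have h1 : F p.1 <= F (fifth p 1) by apply: Fh; rewrite /fifth; lra.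
have h2 : F (fifth p 2) <= F (fifth p 3) by apply: Fh; rewrite /fifth; lra.
have h3 : F (fifth p 4) <= F p.2 by apply: Fh; rewrite /fifth; lra.
rewrite /shrink; case: ifPn; rewrite -?ltNge /= => h; split; try (rewrite /fifth; lra); lra.
Qed.

(** Nested intervals along which the oscillation is halved at each stage shrink
    to a point of continuity. *)
Lemma continuity_point (a b : R) : a < b ->
  exists t, [/\ a < t, t < b & {for t, continuous F}].
Proof.
move=> ab; pose p n := iter n shrink (a, b).
have pn n : (p n).1 < (p n).2.
  by elim: n => //= n /shrinkP[].
have inc m n : (m <= n)%N -> (p m).1 <= (p n).1.
  move=> /subnK <-; elim: (n - m)%N => // k IH; apply: (le_trans IH).
  by rewrite addSn /=; have [/ltW] := shrinkP (pn (k + m)%N).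
have dec m n : (m <= n)%N -> (p n).2 <= (p m).2.
  move=> /subnK <-; elim: (n - m)%N => // k IH; apply: (le_trans _ IH).
  by rewrite addSn /=; have [_ _ /ltW] := shrinkP (pn (k + m)%N).
have cross m n : (p m).1 <= (p n).2.
  apply: (le_trans (inc _ _ (leq_maxl m n))); apply: (le_trans (ltW (pn _))).
  exact: dec (leq_maxr m n).
have osc n : F (p n).2 - F (p n).1 <= (F b - F a) / 2 ^+ n.
  elim: n => [|n IH]; first by rewrite expr0 divr1.
  have [_ _ _ h] := shrinkP (pn n); apply: (le_trans h).
  by rewrite exprSr invfM mulrA ler_pM2r ?invr_gt0.
pose A := range (fun n => (p n).1); pose t := sup A.
have hs : has_sup A.
  split; first by exists a; exists 0%N.
  by exists b => _ [n _ <-]; exact: (cross n 0%N).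
have lo n : (p n).1 < t.
  have [h _ _ _] := shrinkP (pn n); apply: (lt_le_trans h).
  by apply: sup_upper_bound => //; exists n.+1.
have hi n : t < (p n).2.
  have [_ _ h _] := shrinkP (pn n); apply: (le_lt_trans _ h).
  apply: ge_sup; first by case: hs.
  by move=> _ [k _ <-]; exact: (cross k n.+1).
exists t; split; [exact: (lo 0%N)|exact: (hi 0%N)|].
apply/cvgrPdist_lt => e e0.
have [n ne] : exists n, (F b - F a) / 2 ^+ n < e.
  have : (F b - F a) / 2 ^+ n @[n --> \oo] --> (F b - F a) * 0.
    apply: cvgM; first exact: cvg_cst.
    under eq_fun do rewrite -exprVn.
    by apply: cvg_expr; rewrite ger0_norm ?invr_ge0// invf_lt1// ltr1n.
  rewrite mulr0 => /cvgrPdist_lt/(_ e e0) [n _ /(_ n (leqnn n))] /=.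
  by rewrite sub0r normrN => /ltr_normlW ?; exists n.
have := osc n => on.
near=> s.
have s1 : (p n).1 < s by near: s; apply: lt_nbhsr.
have s2 : s < (p n).2 by near: s; apply: lt_nbhsl.
have h1 := Fh (ltW s1); have h2 := Fh (ltW s2).
have h3 := Fh (ltW (lo n)); have h4 := Fh (ltW (hi n)).
by rewrite ltr_norml; apply/andP; split; lra.
Unshelve. all: by end_near. Qed.

End continuity_points.

Section distribution_functions.
Context (R : realType).
Implicit Types F G : distribution_function R.

Lemma ls_ray F r : lebesgue_stieltjes_measure F `]-oo, r] = (F r)%:E.
Proof.
have := cdf_lebesgue_stieltjes_id F r.
by rewrite /cdf /distribution /pushforward preimage_id.
Qed.

Lemma ls_ccray F r : lebesgue_stieltjes_measure F `]r, +oo[ = (1 - F r)%:E.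
Proof.
have -> : `]r, +oo[%classic = ~` `]-oo, r]%classic by rewrite setCitvl.
rewrite probability_setC// EFinB; congr (_ - _)%E; exact: ls_ray.
Qed.

Lemma df_is_df F : is_df F.
Proof.
split=> [s t st|t]; first exact: cumulative_is_nondecreasing.
rewrite -!lee_fin -ls_ray measure_ge0/=; exact: probability_le1.
Qed.

Lemma count_cells (t : R) (T m M : nat) : (0 < m)%N ->
  \sum_(h < M | (T * m <= h)%N) (h%:R / m%:R < t)%R%:R / m%:R <=
  Num.max 0 (t - T%:R) + m%:R^-1 :> R.
Proof.
move=> m0; have m0R : 0 < m%:R :> R by rewrite ltr0n.
have H : \sum_(h < M | (T * m <= h)%N) (h%:R / m%:R < t)%R%:R <=
   Num.max 0 (Num.min M%:R (m%:R * t + 1) - (T * m)%:R) :> R.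
  elim: M => [|M IH]; first by rewrite big_ord0 le_max lexx.
  rewrite big_mkcond big_ord_recr/= -big_mkcond/=.
  have mono : Num.max 0 (Num.min M%:R (m%:R * t + 1) - (T * m)%:R) <=
      Num.max 0 (Num.min M.+1%:R (m%:R * t + 1) - (T * m)%:R) :> R.
    rewrite ge_max le_max lexx/= le_max lerD2r le_min ge_min ler_nat leqnSn/=.
    by rewrite ge_min lexx orbT orbT.
  case: ifPn => TM; last by rewrite addr0 (le_trans IH).
  case: ltP => [Mt|_]; last by rewrite addr0 (le_trans IH).
  rewrite ltr_pdivrMr// mulrC in Mt.
  have TM' : (T * m)%:R <= M%:R :> R by rewrite ler_nat.
  have e1 : Num.min M%:R (m%:R * t + 1) = M%:R :> R by apply/min_l; lra.
  have e2 : Num.min M.+1%:R (m%:R * t + 1) = M.+1%:R :> R by apply/min_l; rewrite -natr1; lra.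
  rewrite e1 max_r in IH; last by rewrite subr_ge0.
  rewrite e2 max_r -natr1 /=; last by lra.
  by apply: (le_trans (lerD IH (lexx _))) => /=; lra.
rewrite -mulr_suml; apply: (le_trans (ler_wpM2r _ H)); first by rewrite invr_ge0.
rewrite maxr_pMl ?invr_ge0// mul0r ge_max.
have m1 : 0 <= m%:R^-1 :> R by rewrite invr_ge0.
have x0 : 0 <= Num.max 0 (t - T%:R) by rewrite le_max lexx.
have x1 : t - T%:R <= Num.max 0 (t - T%:R) by rewrite le_max lexx orbT.
rewrite addr_ge0//= ler_pdivrMr// mulrDl mulVf ?gt_eqF// natrM.
have : Num.min M%:R (m%:R * t + 1) <= m%:R * t + 1 by rewrite ge_min lexx orbT.
by nra.
Qed.

(** The Riemann sum of the tail of [1 - G] is at most the mean of the positive part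
    of [t - T], up to one cell, and the latter vanishes as [T] grows because the
    mean of [G] is finite. *)
Lemma df_tail G : class_D1 G -> forall e : R, 0 < e ->
  exists T : nat, forall m M, (0 < m)%N ->
    (\sum_(h < M | (T * m <= h)%N) (1 - G (h%:R / m%:R))) / m%:R <= e + m%:R^-1.
Proof.
move=> [_ Gfin] e e0; set mu := lebesgue_stieltjes_measure G.
pose f (n : nat) (t : R) : \bar R := (Num.max 0 (t - n%:R))%:E.
have mf n : measurable_fun [set: measurableTypeR R] (f n : measurableTypeR R -> \bar R).
  apply/measurable_EFinP; apply: measurable_maxr => //.
  exact: measurable_funB.
have : (\int[mu]_t f n t @[n --> \oo] --> \int[mu]_t (cst 0 t))%E.
  apply: (@dominated_cvg _ _ _ mu setT measurableT f (cst 0%E) (fun t => `|t|%:E)) => //.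
  - move=> t _; apply/cvg_EFin; first by apply: nearW.
    apply: cvg_near_cst; near=> n; rewrite /= max_l// subr_le0.
    by near: n; exact: nbhs_infty_ger.
  - apply/integrableP; split; first by apply/measurable_EFinP; exact: normr_measurable.
    by under eq_integral do rewrite abse_EFin normr_id.
  - move=> n t _; rewrite /f abse_EFin lee_fin ger0_norm ?le_max ?lexx//.
    rewrite ge_max normr_ge0/=; have := ler_norm t; have : 0 <= n%:R :> R by [].
    lra.
rewrite integral0 => /fine_cvgP[ffin /cvgrPdist_lt/(_ e e0)].
move=> H; have [T HT] : exists T, (\int[mu]_t f T t)%E \is a fin_num /\ fine (\int[mu]_t f T t)%E < e.
  near \oo => T; exists T; split; first by near: T.
  have : `|fine 0 - fine (\int[mu]_t f T t)%E| < e by near: T.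
  by rewrite sub0r normrN => /ltr_normlW.
exists T => m M m0; have m1 : 0 <= m%:R^-1 :> R by rewrite invr_ge0.
rewrite -lee_fin EFinD.
apply: (@le_trans _ _ (\int[mu]_t (f T t + (m%:R^-1)%:E)))%E; last first.
  rewrite ge0_integralD//; last by move=> t _; rewrite lee_fin le_max lexx.
  have muT : mu setT = 1%E by exact: (@probability_setT _ _ _ (lebesgue_stieltjes_measure G)).
  rewrite integral_cst// [X in (_ * X)%E]muT mule1 leeD2r//.
  by rewrite -[leLHS]fineK ?HT.1// lee_fin ltW// HT.2.
have mray h : measurable (`]h%:R / m%:R, +oo[%classic : set (measurableTypeR R)).
  exact: measurable_itv.
rewrite mulr_suml -sumEFin.
have E h : ((1 - G (h%:R / m%:R)) / m%:R)%:E =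
    (\int[mu]_t ((\1_(`]h%:R / m%:R, +oo[%classic) t : R) / m%:R)%:E)%E.
  under eq_integral do rewrite EFinM muleC.
  rewrite ge0_integralZl//; last by apply/measurable_EFinP; exact: measurable_indic.
  rewrite mulrC EFinM; congr (_ * _)%E; rewrite integral_indic// setIT.
  exact/esym/ls_ccray.
under eq_bigr do rewrite E.
have mind h : measurable_fun [set: measurableTypeR R]
    (fun t : measurableTypeR R => ((\1_(`]h%:R / m%:R, +oo[%classic) t : R) / m%:R)%:E).
  apply/measurable_EFinP; exact: measurable_funM.
rewrite -big_filter -ge0_integral_sum//.
apply: ge0_le_integral => //.
- by move=> t _; apply: sume_ge0 => h _; rewrite lee_fin mulr_ge0.
- exact: emeasurable_sum.
- exact: emeasurable_funD.
move=> t _; rewrite big_filter sumEFin -EFinD lee_fin.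
apply: le_trans (count_cells t T M m0).
rewrite le_eqVlt; apply/orP; left; apply/eqP; apply: eq_bigr => h _.
rewrite indicE; congr ((nat_of_bool _)%:R / _).
by apply/idP/idP; rewrite inE /= in_itv /= andbT.
Unshelve. all: by end_near. Qed.

Lemma gmean_bounded G : class_D1 G -> exists B : R, forall F m M, (0 < m)%N ->
  (forall t, G t <= F t) -> gmean F m M <= B.
Proof.
move=> G1; have [T HT] := df_tail G1 ltr01.
exists (T%:R + 2) => F m M m0 GF; have m0R : 0 < m%:R :> R by rewrite ltr0n.
have G01 := (df_is_df G).2.
have H := HT m M m0; rewrite /gmean.
apply: (@le_trans _ _ ((\sum_(h < M) (1 - G (h%:R / m%:R))) / m%:R)).
  by rewrite ler_wpM2r ?invr_ge0// ler_sum// => h _; rewrite lerD2l lerN2.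
rewrite (bigID (fun h : 'I_M => (T * m <= h)%N))/= mulrDl.
have : (\sum_(i < M | ~~ (T * m <= i)%N) (1 - G (i%:R / m%:R))) / m%:R <= T%:R.
  rewrite ler_pdivrMr// -natrM.
  apply: (@le_trans _ _ (\sum_(i < M | (i < T * m)%N) 1)).
    under eq_bigl do rewrite -ltnNge.
    by apply: ler_sum => i _; rewrite gerBl; case/andP: (G01 (i%:R / m%:R)).
  apply: (@le_trans _ _ (\sum_(i < M + T * m | (i < T * m)%N) 1)).
    by rewrite big_split_ord/= lerDl sumr_ge0.
  by rewrite -(big_ord_widen _ (fun=> 1)) ?leq_addl// sumr_const card_ord.
have : m%:R^-1 <= 1 :> R by rewrite invf_le1// ler1n.
lra.
Qed.

Lemma sum_blocks (f : nat -> R) (n r : nat) : (0 < r)%N ->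
  \sum_(0 <= h < n * r) f (h %/ r)%N = r%:R * \sum_(0 <= j < n) f j.
Proof.
move=> r0; elim: n => [|n IH]; first by rewrite mul0n !big_nil mulr0.
rewrite mulSn addnC (big_cat_nat _ (leq_addr r (n * r))) //= IH big_nat_recr//= mulrDr.
congr (_ + _); rewrite (eq_big_nat _ _ (F2 := fun=> f n)); last first.
  move=> i /andP[i1 i2]; congr f; apply/eqP; rewrite eqn_leq leq_divRL// i1 andbT.
  by rewrite -ltnS ltn_divLR// mulSn addnC.
by rewrite sumr_const_nat addKn mulr_natl.
Qed.

Lemma sum_third_differences (f : nat -> R) n : (forall k, 0 <= f k <= 1) ->
  \sum_(0 <= j < n) (f (j + 3)%N - f j) <= 3.
Proof.
move=> f01.
have -> : \sum_(0 <= j < n) (f (j + 3)%N - f j) =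
    f n + f n.+1 + f n.+2 - (f 0%N + f 1%N + f 2%N).
  elim: n => [|n IH]; first by rewrite big_nil subrr.
  by rewrite big_nat_recr//= IH !addnS addn0; ring.
move: (f01 n) (f01 n.+1) (f01 n.+2) (f01 0%N) (f01 1%N) (f01 2%N).
by do 6 (move=> /andP[? ?]); lra.
Qed.

Lemma sum_split_at (a b : nat -> R) (M K : nat) : (forall h, 0 <= a h) ->
  \sum_(h < M) (if (K <= h)%N then b h else a h) <=
  \sum_(0 <= h < K) a h + \sum_(h < M | (K <= h)%N) b h.
Proof.
move=> a0; rewrite (bigID (fun h : 'I_M => (K <= h)%N))/= addrC lerD//; last first.
  by rewrite le_eqVlt; apply/orP; left; apply/eqP; apply: eq_bigr => h ->.
apply: (@le_trans _ _ (\sum_(h < M + K | (h < K)%N) a h)).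
  rewrite big_split_ord/= -[leLHS]addr0 lerD ?sumr_ge0//.
  rewrite le_eqVlt; apply/orP; left; apply/eqP; apply: eq_big => h; first by rewrite -ltnNge.
  by move=> /negPf ->.
by rewrite -(big_ord_widen _ a) ?leq_addl// big_mkord.
Qed.

(** Weak convergence gives closeness at finitely many continuity points, one
    before each multiple of [1 / q]; between them monotonicity bounds the
    difference by an increment of [F] over three cells, and these increments
    telescope. The tail beyond [T] is controlled by [G]. The grids considered
    refine the one of mesh [1 / q], which lets [n] be chosen before the mesh is
    sent to zero. *)
Lemma wass_small (Fn : nat -> distribution_function R) F G : class_D1 G ->
  (forall n t, G t <= Fn n t) -> (forall t, G t <= F t) -> weak_cvg Fn F ->
  forall e : R, 0 < e -> exists2 q : nat, (0 < q)%N & \forall n \near \oo,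
    forall r M, (0 < r)%N -> wass F (Fn n) (q * r) M <= e.
Proof.
move=> G1 GFn GF FnF e e0.
have [Fh F01] := df_is_df F; have dFn n := df_is_df (Fn n).
have e4 : 0 < e / 4 by lra.
have [T HT] := df_tail G1 e4.
pose q := (Num.truncn (16 / e)).+1.
have q0 : 0 < q%:R :> R by rewrite ltr0n.
have qe : q%:R^-1 < e / 16.
  rewrite -(invrK (e / 16)) ltf_pV2 ?posrE ?invr_gt0//; last by lra.
  by rewrite invf_div /q; apply: truncnS_gt.
exists q => //.
(* There are T * q coarse cells of length 1 / q before T, so an error kappa in
   each adds up to T * kappa. *)
pose kappa : R := e / (4 * (T.+1)%:R).
have T0 : 0 < T.+1%:R :> R by rewrite ltr0n.
have k0 : 0 < kappa by rewrite divr_gt0// mulr_gt0.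
have Tk : T%:R * kappa <= e / 4.
  by rewrite /kappa mulrA ler_pdivrMr ?mulr_gt0// -(natr1 T); lra.
have /choice[t tP] (j : nat) : exists t, [/\ (j%:R - 1) / q%:R < t, t < j%:R / q%:R &
    {for t, continuous F}].
  by apply: continuity_point; rewrite ?ltr_pM2r ?invr_gt0//; lra.
have Hn : \forall n \near \oo, forall j : 'I_(T * q + 2), `|F (t j) - Fn n (t j)| < kappa.
  apply: filter_forall => j.
  have [_ _ /FnF/cvgrPdist_lt/(_ _ k0)] := tP j; exact.
near=> n => r M r0.
have Hn' : forall j : 'I_(T * q + 2), `|F (t j) - Fn n (t j)| < kappa by near: n; exact: Hn.
have r0R : 0 < r%:R :> R by rewrite ltr0n.
have [Fnh Fn01] := dFn n.
pose f j := F ((j%:R - 1) / q%:R).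
have cell (s : R) (j : nat) : (j < T * q)%N -> j%:R / q%:R <= s -> s < j.+1%:R / q%:R ->
    `|F s - Fn n s| <= f (j + 3)%N - f j + kappa.
  move=> jT js sj.
  have j0 : (j < T * q + 2)%N by rewrite (leq_trans jT)// leq_addr.
  have j2 : (j.+2 < T * q + 2)%N by rewrite addn2 !ltnS.
  have := Hn' (Ordinal j0); have := Hn' (Ordinal j2); rewrite /= !ltr_norml.
  move=> /andP[h1 h2] /andP[h3 h4].
  have [t1 t2 _] := tP j; have [t3 t4 _] := tP j.+2.
  have st : s <= t j.+2 by rewrite (le_trans (ltW sj))// (le_trans _ (ltW t3))// ler_pM2r ?invr_gt0// -!natr1; lra.
  have ts : t j <= s by rewrite (le_trans (ltW t2)).
  have a1 := Fnh _ _ st; have a2 := Fnh _ _ ts.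
  have a3 : F (t j.+2) <= f (j + 3)%N.
    by apply: Fh; rewrite (le_trans (ltW t4))// ler_pM2r ?invr_gt0// addn3 -[in leRHS]natr1; lra.
  have a4 : f j <= F (t j) by apply: Fh; exact: ltW.
  have a5 := Fh _ _ st; have a6 := Fh _ _ ts.
  by rewrite ler_norml; apply/andP; split; lra.
have m0 : (0 < q * r)%N by rewrite muln_gt0 r0.
have mR : 0 < (q * r)%:R :> R by rewrite ltr0n.
pose A h : R := f ((h %/ r) + 3)%N - f (h %/ r)%N + kappa.
have A0 h : 0 <= A h.
  rewrite /A addr_ge0//; last exact: ltW.
  rewrite subr_ge0; apply: Fh; rewrite ler_pM2r ?invr_gt0// lerD2r ler_nat.
  exact: leq_addr.
pose D h : R := `|F (h%:R / (q * r)%:R) - Fn n (h%:R / (q * r)%:R)|.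
apply: (@le_trans _ _ ((\sum_(h < M) (if (T * (q * r) <= h)%N
    then 1 - G (h%:R / (q * r)%:R) else A h)) / (q * r)%:R)).
  rewrite /wass ler_wpM2r ?invr_ge0//; apply: ler_sum => h _; case: leqP => hT.
    set s := h%:R / _; move: (F01 s) (Fn01 s) (GF s) (GFn n s) => /andP[_ ?] /andP[_ ?] ? ?.
    by rewrite ler_norml; apply/andP; split; lra.
  apply: cell.
  - by rewrite ltn_divLR// -mulnA.
  - rewrite ler_pdivrMr// mulrAC ler_pdivlMr// -!natrM ler_nat mulnCA [leqRHS]mulnC.
    by rewrite leq_pmul2l// leq_trunc_div.
  - rewrite ltr_pdivrMr// mulrAC ltr_pdivlMr// -!natrM ltr_nat mulnCA [ltnLHS]mulnC.
    by rewrite ltn_pmul2l// ltn_ceil.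
apply: (le_trans (ler_wpM2r _ (@sum_split_at A (fun h => 1 - G (h%:R / (q * r)%:R)) M _ A0))); first by rewrite invr_ge0.
rewrite mulrDl.
have HTT := HT (q * r)%N M m0.
have : (\sum_(0 <= h < T * (q * r)) A h) / (q * r)%:R <= 3 / q%:R + T%:R * kappa.
  rewrite mulnA (sum_blocks (fun j => f (j + 3)%N - f j + kappa))// natrM.
  rewrite (mulrC q%:R) invfM mulrA mulrAC mulrAC (mulrC r%:R) mulfK ?gt_eqF//.
  rewrite big_split/= sumr_const_nat subn0 mulrDl lerD//.
    rewrite ler_pM2r ?invr_gt0//; apply: sum_third_differences => k; exact: F01.
  by rewrite -[kappa *+ _]mulr_natl natrM mulrAC mulfK ?gt_eqF.
have : (q * r)%:R^-1 <= q%:R^-1 :> R by rewrite lef_pV2 ?posrE// ler_nat leq_pmulr.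
lra.
Unshelve. all: by end_near. Qed.

End distribution_functions.

(** * Discretization of the potential *)

Section discretization.
Context (R : realType).
Implicit Types (v t : R) (m M h : nat).

(** Rounding up to the grid; [find] returns [M] when no grid point reaches [v],
    which is the cap. *)
Definition gidx m M v : 'I_M.+1 := inord (find (fun i => v <= i%:R / m%:R) (iota 0 M)).

Lemma gidxE m M v : gidx m M v = find (fun i => v <= i%:R / m%:R) (iota 0 M) :> nat.
Proof. by rewrite inordK// ltnS (leq_trans (find_size _ _))// size_iota. Qed.

Lemma gidx_leq m M v h : (0 < m)%N -> (h < M)%N ->
  (gidx m M v <= h)%N = (v <= h%:R / m%:R).
Proof.
move=> m0 hM; rewrite gidxE; set p := fun i : nat => _; apply/idP/idP => [fh|vh].
  have fM : (find p (iota 0 M) < M)%N by exact: leq_ltn_trans hM.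
  have hp : has p (iota 0 M) by rewrite has_find size_iota.
  have := nth_find 0%N hp; rewrite nth_iota// add0n /p => /le_trans; apply.
  by rewrite ler_wpM2r ?invr_ge0// ler_nat.
rewrite leqNgt; apply/negP => hf; have := before_find 0%N hf.
by rewrite nth_iota// add0n /p vh.
Qed.

Lemma gidx_lt_set m M h : (0 < m)%N -> (h <= M.+1)%N ->
  [set v | (gidx m M v < h)%N] =
  if h is h'.+1 then (if (h' < M)%N then `]-oo, h'%:R / m%:R]%classic else setT) else set0.
Proof.
move=> m0; case: h => [_|h hM]; first by apply/seteqP; split => v.
apply/seteqP; split => v /=; case: ifPn => h1 //=.
- by rewrite ltnS gidx_leq// in_itv.
- by rewrite in_itv/= => ?; rewrite ltnS gidx_leq.
- move=> _; rewrite (leq_trans (ltn_ord _))//.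
  by rewrite ltnS leqNgt.
Qed.

Lemma measurable_gidx_lt m M h : (0 < m)%N -> (h <= M.+1)%N ->
  measurable [set v | (gidx m M v < h)%N].
Proof.
by move=> m0 hM; rewrite gidx_lt_set//; case: h hM => // h _; case: ifP.
Qed.

Lemma gidx_eq_set m M (i : 'I_M.+1) :
  [set v | gidx m M v = i] =
  [set v | (gidx m M v < i.+1)%N] `\` [set v | (gidx m M v < i)%N].
Proof.
apply/seteqP; split => v /= => [->|[]]; first by rewrite ltnn ltnS leqnn.
by rewrite ltnS => h1 /negP; rewrite -leqNgt => h2; apply/val_inj/eqP; rewrite eqn_leq h1.
Qed.

Lemma measurable_gidx_eq m M (i : 'I_M.+1) : (0 < m)%N ->
  measurable [set v | gidx m M v = i].
Proof.
move=> m0; rewrite gidx_eq_set; apply: measurableD; apply: measurable_gidx_lt => //.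
exact: ltnW.
Qed.

Lemma grid_gidx m M v : (0 < m)%N -> (0 < M)%N -> 0 <= v ->
  `|grid R m (gidx m M v) - v| <= m%:R^-1 + Num.max 0 (v - M%:R / m%:R).
Proof.
move=> m0 M0 v0; set i := gidx m M v; have m0R : 0 < m%:R :> R by rewrite ltr0n.
have mx : 0 <= Num.max 0 (v - M%:R / m%:R) by rewrite le_max lexx.
have mx' : v - M%:R / m%:R <= Num.max 0 (v - M%:R / m%:R) by rewrite le_max lexx orbT.
have m1 : 0 < m%:R^-1 :> R by rewrite invr_gt0.
have lo : i%:R / m%:R - m%:R^-1 <= v.
  rewrite -{2}[m%:R^-1]mul1r -mulrBl; case iE : (i : nat) => [|k].
    by apply: le_trans v0; rewrite sub0r mulN1r oppr_le0 ltW.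
  rewrite -natr1 addrK leNgt; apply/negP => /ltW vk.
  have kM : (k < M)%N by rewrite -ltnS -iE ltn_ord.
  by have := @gidx_leq m M v k m0 kM; rewrite vk -/i iE ltnn.
have [iM|iM] := ltnP i M.
  have := @gidx_leq m M v i m0 iM; rewrite leqnn => /esym hi.
  by rewrite /grid ler_norml; apply/andP; split; lra.
have iE : (i : nat) = M by apply/eqP; rewrite eqn_leq iM -ltnS ltn_ord.
by move: lo; rewrite /grid iE => lo; rewrite ler_norml; apply/andP; split; lra.
Qed.

End discretization.

Section finite_range.
Context (R : realType) (dO : measure_display) (Omega : measurableType dO)
  (P : probability Omega R).

Lemma finite_range_integral (T : finType) (Z : Omega -> T) (g : T -> R) :
  (forall t, measurable (Z @^-1` [set t])) -> (forall w, 0 <= g (Z w)) ->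
  (\int[P]_w (g (Z w))%:E = \sum_t (g t)%:E * P (Z @^-1` [set t]))%E.
Proof.
move=> mZ g0; pose g' t := Num.max 0 (g t).
have g'0 t : 0 <= g' t by rewrite le_max lexx.
transitivity (\int[P]_w (\sum_(t : T) (g' t)%:E * (\1_(Z @^-1` [set t]) w)%:E))%E.
  apply: eq_integral => w _; rewrite (bigD1 (Z w))//= big1 ?adde0 => [|t tZ].
    by rewrite indicE mem_set// mule1 /g' max_r.
  by rewrite indicE memNset ?mule0// => /esym/eqP; rewrite (negPf tZ).
have mind t : measurable_fun setT (fun w => (g' t)%:E * (\1_(Z @^-1` [set t]) w)%:E)%E.
  apply/measurable_EFinP; exact: measurable_funM.
rewrite ge0_integral_sum//; last first.
  by move=> t w _; rewrite -EFinM lee_fin mulr_ge0.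
apply: eq_bigr => t _.
rewrite ge0_integralZl ?lee_fin//; last first.
  by apply/measurable_EFinP.
rewrite integral_indic// setIT.
have [[w Zw]|H] := pselect (exists w, Z w = t).
  by rewrite /g' max_r// -Zw.
rewrite (_ : Z @^-1` [set t] = set0) ?measure0 ?mule0//.
by apply/seteqP; split => // w Zw; apply: H; exists w.
Qed.

End finite_range.

Section transfer.
Context (R : realType) (d : nat).
Local Notation site := 'rV[int]_d.
Context (dO : measure_display) (Omega : measurableType dO) (P : probability Omega R).
Variables (V : site -> {RV P >-> R}) (F : distribution_function R).
Hypothesis hV : iid_potential V F.

Lemma prob_gidx_lt x m M h : (0 < m)%N -> (h <= M.+1)%N ->
  P (V x @^-1` [set v | (gidx m M v < h)%N]) = (levels F m M h)%:E.
Proof.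
move=> m0 hM; have [_ Vcdf _] := hV; rewrite gidx_lt_set//.
case: h hM => [|h] hM /=; first by rewrite preimage_set0 measure0.
by case: ifP => _; [exact: Vcdf|rewrite preimage_setT probability_setT].
Qed.

Lemma prob_gidx x m M (i : 'I_M.+1) : (0 < m)%N ->
  P (V x @^-1` [set v | gidx m M v = i]) = (glaw F m i)%:E.
Proof.
move=> m0; rewrite gidx_eq_set.
transitivity (P (V x @^-1` [set v | (gidx m M v < i.+1)%N] `\`
  V x @^-1` [set v | (gidx m M v < i)%N])); first by [].
have mlt h : (h <= M.+1)%N -> measurable (V x @^-1` [set v | (gidx m M v < h)%N]).
  move=> hM; rewrite -[X in measurable X]setTI.
  by apply: measurable_funP => //; exact: measurable_gidx_lt.
rewrite measureD; [|exact: mlt|by apply: mlt; exact: ltnW|]; last first.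
  exact: (le_lt_trans (probability_le1 _ (mlt _ (ltn_ord i))) (ltry _)).
rewrite setIidr; last by move=> w /= wi; exact: ltnW.
transitivity ((levels F m M i.+1)%:E - (levels F m M i)%:E)%E; last by [].
by congr (_ - _)%E; apply: prob_gidx_lt => //; exact: ltnW.
Qed.

Lemma mgidx x m M (i : 'I_M.+1) : (0 < m)%N ->
  measurable (V x @^-1` [set v | gidx m M v = i]).
Proof.
move=> m0; rewrite -[X in measurable X]setTI.
by apply: measurable_funP => //; exact: measurable_gidx_eq.
Qed.

Variable L : seq site.
Hypothesis uL : uniq L.

Definition genv m M w : {ffun seq_sub L -> 'I_M.+1} := [ffun i => gidx m M (V (val i) w)].

Lemma genv_fiber m M (c : {ffun seq_sub L -> 'I_M.+1}) :
  genv m M @^-1` [set c] =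
  \bigcap_(z in [set` [fset z in L]%fset]) (V z @^-1`
    (fun s => if insub s is Some i then [set v | gidx m M v = c i] else setT) z).
Proof.
apply/seteqP; split => w /=.
  move=> <- z /=; case: insubP => [i _ <-|] //; by rewrite /= ffunE.
move=> H; apply/ffunP => i; rewrite ffunE.
have /H : [set` [fset z in L]%fset] (val i) by rewrite /= inE (valP i).
by rewrite /= valK.
Qed.

Lemma prob_genv m M (c : {ffun seq_sub L -> 'I_M.+1}) : (0 < m)%N ->
  P (genv m M @^-1` [set c]) = (wenv (glaw F m (M:=M)) c)%:E.
Proof.
move=> m0; have [_ _ ind] := hV; rewrite genv_fiber ind; last first.
  by move=> z; case: insub => [i|//]; exact: measurable_gidx_eq.
have -> : forall f : site -> \bar R,
    (\prod_(i <- [fset z in L]%fset) f i = \prod_(i : seq_sub L) f (val i))%E.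
  move=> f; rewrite -big_seq_sub//; apply: perm_big.
  by apply: uniq_perm => // z; rewrite inE.
rewrite /wenv; elim/big_ind2 : _ => //; first by move=> a b a' b' -> ->; rewrite EFinM.
by move=> i _; rewrite valK prob_gidx.
Qed.

Lemma genv_measurable m M c : (0 < m)%N -> measurable (genv m M @^-1` [set c]).
Proof.
move=> m0; rewrite genv_fiber; apply: fin_bigcap_measurable; first exact: finite_fset.
move=> z _; case: insubP => [i _ _|_]; first exact: mgidx.
by rewrite preimage_setT.
Qed.

Lemma grid_ge0 m M (i : 'I_M.+1) : 0 <= grid R m i.
Proof. by rewrite divr_ge0. Qed.

Lemma field_grid_ge0 m M (c : {ffun seq_sub L -> 'I_M.+1}) z :
  0 <= field (grid R m (M:=M)) 0 c z.
Proof. by rewrite /field; case: insub => // i; exact: grid_ge0. Qed.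

Lemma gexp_integral m M (Psi : (site -> R) -> R) : (0 < m)%N ->
  (forall v, (forall z, 0 <= v z) -> 0 <= Psi v) ->
  (\int[P]_w (Psi (field (grid R m (M:=M)) 0 (genv m M w)))%:E =
    (gexp L F m M Psi)%:E)%E.
Proof.
move=> m0 Psi0; rewrite (@finite_range_integral _ _ _ P _ (genv m M)
  (fun c => Psi (field (grid R m (M:=M)) 0 c))).
- rewrite /gexp /menv -sumEFin; apply: eq_bigr => c _.
  by rewrite prob_genv// -EFinM mulrC.
- by move=> c; exact: genv_measurable.
- by move=> w; apply: Psi0 => z; exact: field_grid_ge0.
Qed.

Variable G : distribution_function R.
Hypotheses (G1 : class_D1 G) (GF : forall t, G t <= F t).

(** Truncations of the potential are dominated by their roundings up to integers,
    whose means are the bounded Riemann sums of [gmean_bounded]. *)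
Lemma potential_integrable z : P.-integrable setT (fun w => (V z w)%:E).
Proof.
have [V0 _ _] := hV; have [B HB] := gmean_bounded G1.
have mV : measurable_fun setT (V z) by [].
suff VB : (\int[P]_w (V z w)%:E <= B%:E)%E.
  apply/integrableP; split; first exact/measurable_EFinP.
  under eq_integral do rewrite abse_EFin ger0_norm//.
  exact: (le_lt_trans VB (ltry _)).
pose g n w := (Num.min (V z w) n%:R)%:E : \bar R.
have mg n : measurable_fun setT (g n).
  by apply/measurable_EFinP; apply: measurable_minr.
have -> : (\int[P]_w (V z w)%:E = \int[P]_w (limn (g ^~ w)))%E.
  apply: eq_integral => w _; apply/esym/cvg_lim => //.
  apply: cvg_near_cst; near=> n; rewrite /g min_l//.
  near: n; exact: nbhs_infty_ger.
rewrite monotone_convergence//; last 2 first.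
- by move=> n w _; rewrite lee_fin le_min V0/=.
- move=> w _ a b ab; rewrite lee_fin le_min ge_min lexx/= ge_min.
  by rewrite [X in _ || X]ler_nat ab orbT.
apply: lime_le.
  apply: ereal_nondecreasing_is_cvgn => a b ab; apply: ge0_le_integral => //.
  - by move=> w _; rewrite lee_fin le_min V0/=.
  - move=> w _; rewrite lee_fin le_min ge_min lexx/= ge_min.
    by rewrite [X in _ || X]ler_nat ab orbT.
apply: nearW => n.
have HB' := HB F 1%N n isT GF.
have dF := df_is_df F.
apply: (@le_trans _ _ (\int[P]_w (grid R 1 (gidx 1 n (V z w)))%:E)%E); last first.
  rewrite (@finite_range_integral _ _ _ P _ (fun w => gidx 1 n (V z w)) (grid R 1 (M:=n))).
  - rewrite -(glaw_mean 1 n dF) in HB'; rewrite /mean in HB'.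
    apply: le_trans (_ : (_ <= (\sum_i glaw F 1 i * grid R 1 i)%:E)%E) _; last by rewrite lee_fin; exact: HB'.
    rewrite -sumEFin; apply: lee_sum => i _; rewrite EFinM muleC.
    by rewrite (prob_gidx z i).
  - by move=> i; exact: mgidx.
  - by move=> w; exact: grid_ge0.
apply: ge0_le_integral => //.
- by move=> w _; rewrite lee_fin le_min V0/=.
- apply/measurable_EFinP.
  have -> : (fun w => grid R 1 (gidx 1 n (V z w))) =
      (fun w => \sum_(i < n.+1) grid R 1 i * \1_(V z @^-1` [set v | gidx 1 n v = i]) w).
    apply/funext => w; rewrite (bigD1 (gidx 1 n (V z w)))//= big1 ?addr0.
      by rewrite indicE mem_set// mulr1.
    by move=> i iw; rewrite indicE memNset ?mulr0//= => /esym/eqP; rewrite (negPf iw).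
  apply: measurable_sum => i; apply: measurable_funM => //.
  by apply: measurable_indic; exact: mgidx.
move=> w _; rewrite lee_fin.
set i := gidx _ _ _; have [iM|iM] := ltnP i n.
  have := @gidx_leq R 1 n (V z w) i isT iM; rewrite leqnn => /esym hi.
  by rewrite ge_min hi.
have iE : (i : nat) = n by apply/eqP; rewrite eqn_leq iM -ltnS ltn_ord.
by rewrite /grid iE divr1 ge_min lexx orbT.
Unshelve. all: by end_near. Qed.

(** Rounding moves each of the finitely many relevant sites by at most [1 / m] plus
    the overshoot above [m], which is dominated by the integrable potential.
    The cap [m] needs [m * m] grid points. *)
Lemma transfer (Psi : (site -> R) -> R) (B : R) : 0 <= B ->
  (forall v, (forall z, 0 <= v z) -> 0 <= Psi v) ->
  (forall v v' : site -> R, Psi v - Psi v' <= B * \sum_(z <- L) `|v z - v' z|) ->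
  measurable_fun setT (fun w => Psi (fun z => V z w)) ->
  forall e : R, 0 < e -> \forall m \near \oo,
    (\int[P]_w (Psi (fun z => V z w))%:E <= (gexp L F m (m * m) Psi + e)%:E)%E /\
    ((gexp L F m (m * m) Psi)%:E <= \int[P]_w (Psi (fun z => V z w))%:E + e%:E)%E.
Proof.
move=> B0 Psi0 lip mPsi e e0; have [V0 _ _] := hV.
pose h m w : R := B * \sum_(z <- L) (m%:R^-1 + Num.max 0 (V z w - m%:R)).
have h0 m w : 0 <= h m w.
  by rewrite mulr_ge0// sumr_ge0// => z _; rewrite addr_ge0// le_max lexx.
have mh m : measurable_fun setT (h m).
  apply: measurable_funM => //; apply: measurable_sum => z.
  apply: measurable_funD => //; apply: measurable_maxr => //.
  exact: measurable_funB.
have mPm m : (0 < m)%N -> measurable_fun setT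
    (fun w => Psi (field (grid R m (M:=m * m)) 0 (genv m (m * m) w))).
  move=> m0.
  have -> : (fun w => Psi (field (grid R m (M:=m * m)) 0 (genv m (m * m) w))) =
      (fun w => \sum_(c : {ffun seq_sub L -> 'I_(m * m).+1})
         Psi (field (grid R m (M:=m * m)) 0 c) * \1_(genv m (m * m) @^-1` [set c]) w).
    apply/funext => w; rewrite (bigD1 (genv m (m * m) w))//= big1 ?addr0.
      by rewrite indicE mem_set// mulr1.
    by move=> c cw; rewrite indicE memNset ?mulr0//= => /esym/eqP; rewrite (negPf cw).
  apply: measurable_sum => c; apply: measurable_funM => //.
  by apply: measurable_indic; exact: genv_measurable.
have close m w : (0 < m)%N ->
    \sum_(z <- L) `|field (grid R m (M:=m * m)) 0 (genv m (m * m) w) z - V z w| <=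
    \sum_(z <- L) (m%:R^-1 + Num.max 0 (V z w - m%:R)).
  move=> m0; rewrite big_seq [leRHS]big_seq; apply: ler_sum => z zL.
  rewrite /field insubT ffunE /=.
  have := @grid_gidx R m (m * m) (V z w) m0 _ (V0 z w).
  rewrite natrM mulfK ?pnatr_eq0 -?lt0n// => H; apply: H.
  by rewrite muln_gt0 m0.
have hcvg : (\int[P]_w (h m w)%:E @[m --> \oo] --> \int[P]_w (cst 0 w))%E.
  apply: (@dominated_cvg _ _ _ P setT measurableT (fun m w => (h m w)%:E) (cst 0%E)
    (fun w => \sum_(z <- L) B%:E * (1 + (V z w)%:E))%E) => //.
  - by move=> m; apply/measurable_EFinP.
  - move=> w _; apply/cvg_EFin; first by apply: nearW.
    rewrite /comp /= -[X in _ --> X](mulr0 B); apply: cvgM; first exact: cvg_cst.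
    rewrite -[X in _ --> X](_ : \sum_(z <- L) (0 : R) = 0); last by rewrite big1.
    apply: cvg_big => [|z _]; first exact: add_continuous.
    rewrite -[X in _ --> X]addr0; apply: cvgD.
      apply/gtr0_cvgV0; first by near=> m; rewrite ltr0n; near: m; exact: nbhs_infty_gt.
      exact: cvgr_idn.
    apply: cvg_near_cst; near=> m; rewrite max_l// subr_le0.
    by near: m; exact: nbhs_infty_ger.
  - by move=> w _; under eq_bigr do rewrite -EFinD -EFinM; rewrite sumEFin.
  - apply: (integrable_sum measurableT) => z _; apply: integrableZl => //; apply: integrableD => //.
      exact: finite_measure_integrable_cst.
    exact: potential_integrable.
  - move=> m w _; rewrite abse_EFin ger0_norm// /h mulr_sumr -sumEFin.
    apply: lee_sum => z _; rewrite -EFinD -EFinM lee_fin ler_wpM2l// lerD//.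
      case: m => [|m]; first by rewrite invr0.
      by rewrite invf_le1// ler1n.
    rewrite ge_max V0/= lerBlDr lerDl//.
move: hcvg; rewrite integral0 => /fine_cvgP[hfin /cvgrPdist_lt/(_ e e0) hlt].
near=> m.
have m0 : (0 < m)%N by near: m; exact: nbhs_infty_gt.
have he : (\int[P]_w (h m w)%:E <= e%:E)%E.
  have hf : (\int[P]_w (h m w)%:E)%E \is a fin_num by near: m.
  rewrite -(fineK hf) lee_fin ltW//.
  have : `|0 - fine (\int[P]_w (h m w)%:E)%E| < e by near: m.
  by rewrite sub0r normrN => /ltr_normlW.
have Pm0 w : 0 <= Psi (field (grid R m (M:=m * m)) 0 (genv m (m * m) w)).
  by apply: Psi0 => z; exact: field_grid_ge0.
have PV0 w : 0 <= Psi (fun z => V z w) by exact: Psi0.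
have mE1 : measurable_fun setT
    (fun w => (Psi (field (grid R m (M:=m * m)) 0 (genv m (m * m) w)))%:E).
  by apply/measurable_EFinP; exact: mPm.
have mE2 : measurable_fun setT (fun w => (Psi (fun z => V z w))%:E).
  exact/measurable_EFinP.
have E10 w : [set: Omega] w ->
    (0 <= (Psi (field (grid R m (M:=m * m)) 0 (genv m (m * m) w)))%:E)%E by rewrite lee_fin.
have E20 w : [set: Omega] w -> (0 <= (Psi (fun z => V z w))%:E)%E by rewrite lee_fin.
have E30 w : [set: Omega] w -> (0 <= (h m w)%:E)%E by rewrite lee_fin.
have mE3 : measurable_fun setT (fun w => (h m w)%:E) by exact/measurable_EFinP.
split.
- apply: (@le_trans _ _ (\int[P]_w ((Psi (field (grid R m (M:=m * m)) 0 (genv m (m * m) w)))%:E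
     + (h m w)%:E))%E); last first.
    rewrite ge0_integralD//.
    by rewrite gexp_integral// EFinD leeD2l.
  apply: ge0_le_integral => //; first exact: emeasurable_funD.
  move=> w _; rewrite -EFinD lee_fin -lerBlDl (le_trans (lip _ _))// ler_wpM2l//.
  by under eq_bigr do rewrite distrC; exact: close.
- rewrite -gexp_integral//; apply: (@le_trans _ _ (\int[P]_w ((Psi (fun z => V z w))%:E
     + (h m w)%:E))%E); last first.
    rewrite ge0_integralD//.
    by rewrite leeD2l.
  apply: ge0_le_integral => //; first exact: emeasurable_funD.
  move=> w _; rewrite -EFinD lee_fin -lerBlDl (le_trans (lip _ _))// ler_wpM2l//.
  exact: close.
Unshelve. all: by end_near. Qed.

End transfer.

(** * Path sums as expectations over the walk *)

Section walk_law.
Context (R : realType) (d : nat).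
Local Notation site := 'rV[int]_d.
Implicit Types (v : site -> R) (s : nat -> site).

(** The weight of a trajectory on the event that [y] is hit within [N] steps; as
    opposed to [path_weight] it depends on finitely many positions. *)
Fixpoint cut_weight N v (y : site) s : R :=
  if N is N'.+1 then
    if s 0%N == y then 1 else expR (- v (s 0%N)) * cut_weight N' v y (fun n => s n.+1)
  else (s 0%N == y)%:R.

Lemma cut_weight_hit N v y s h : (forall i, (i < h)%N -> s i != y) -> s h = y ->
  cut_weight N v y s =
  if (h <= N)%N then expR (- \sum_(0 <= m < h) v (s m)) else 0.
Proof.
elim: N h s => [|N IH] [|h] s sh hy /=.
- by rewrite hy eqxx big_nil oppr0 expR0.
- by rewrite (negPf (sh 0%N isT)).
- by rewrite hy eqxx big_nil oppr0 expR0.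
rewrite (negPf (sh 0%N isT)) (IH h)//; last by move=> i ih; exact: sh.
rewrite ltnS; case: ifP => _; last by rewrite mulr0.
by rewrite -expRD -opprD big_nat_recl.
Qed.

Lemma cut_weight_nohit N v y s : (forall i, s i != y) -> cut_weight N v y s = 0.
Proof.
elim: N s => [|N IH] s sy /=; first by rewrite (negPf (sy 0%N)).
by rewrite (negPf (sy 0%N)) IH ?mulr0// => i; exact: sy.
Qed.

Lemma cut_weightE N v y s : cut_weight N v y s =
  if hitting_time s y is Some h then if (h <= N)%N then path_weight v s y else 0 else 0.
Proof.
rewrite /path_weight /hitting_time; case: pselect => [hx|hx].
  case: ex_minnP => h /eqP hy hmin; apply: cut_weight_hit => // i ih.
  by apply: contraTneq ih => /eqP/hmin; rewrite leqNgt.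
by apply: cut_weight_nohit => i; apply/eqP => /eqP iy; apply: hx; exists i.
Qed.

Lemma path_weight_ge0 v s y : 0 <= path_weight v s y.
Proof. by rewrite /path_weight; case: hitting_time => // h; exact: expR_ge0. Qed.

Lemma cut_weight_ge0 N v y s : 0 <= cut_weight N v y s.
Proof.
by rewrite cut_weightE; case: hitting_time => // h; case: ifP => _ //; exact: path_weight_ge0.
Qed.

Lemma cut_weight_le1 N v y s : (forall z, 0 <= v z) -> cut_weight N v y s <= 1.
Proof.
move=> v0; elim: N s => [|N IH] s /=; first by rewrite lern1 leq_b1.
case: ifP => // _; rewrite mulr_ile1 ?expR_ge0 ?cut_weight_ge0//.
by rewrite -expR0 ler_expR oppr_le0.
Qed.

Lemma cut_weight_mono N M v y s : (N <= M)%N -> cut_weight N v y s <= cut_weight M v y s.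
Proof.
move=> NM; rewrite !cut_weightE; case: hitting_time => // h.
case: ifP => [hN|_]; first by rewrite (leq_trans hN NM).
by case: ifP => _ //; exact: path_weight_ge0.
Qed.

Lemma cut_weight_ext N v y s s' : (forall i, (i <= N)%N -> s i = s' i) ->
  cut_weight N v y s = cut_weight N v y s'.
Proof.
elim: N s s' => [|N IH] s s' ss' /=; first by rewrite ss'.
by rewrite ss'// (IH _ (fun n => s' n.+1))// => i iN; exact: ss'.
Qed.

(** The trajectories of the walk are spelled by words in the steps, all words of
    a given length being equally likely. *)
Definition pos (x : site) (w : seq ('I_d * bool)) (i : nat) : site :=
  x + \sum_(e <- take i w) step e.

Fixpoint words N : seq (seq ('I_d * bool)) :=
  if N is N'.+1 then [seq e :: w | e <- enum {: 'I_d * bool}, w <- words N'] else [:: [::]].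

Lemma pos0 x w : pos x w 0 = x.
Proof. by rewrite /pos take0 big_nil addr0. Qed.

Lemma pos_cons x e w i : pos x (e :: w) i.+1 = pos (x + step e) w i.
Proof. by rewrite /pos /= big_cons addrA. Qed.

Lemma words_uniq N : uniq (words N).
Proof.
elim: N => //= N IH; apply: allpairs_uniq => //; first exact: enum_uniq.
by move=> [s u] [s' u'] _ _ /= [-> ->].
Qed.

Lemma step_inj : injective (@step d).
Proof.
move=> [i b] [j c] H.
have := congr1 (fun u : site => u 0 i) H; rewrite !step_coord eqxx mulr1.
case: (eqVneq i j) => [<- /=|_ /=]; last by rewrite mulr0; case: b {H}.
by rewrite mulr1; case: b {H}; case: c.
Qed.

Lemma pos_inj N x w w' : w \in words N -> w' \in words N ->
  (forall i, (i <= N)%N -> pos x w i = pos x w' i) -> w = w'.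
Proof.
elim: N x w w' => [|N IH] x w w' /=; first by rewrite !inE => /eqP -> /eqP ->.
move=> /allpairsP[[s u] [_ /= uN ->]] /allpairsP[[s' u'] [_ /= u'N ->]] H.
have ss : s = s'.
  have := H 1%N isT; rewrite !pos_cons !pos0 => /addrI; exact: step_inj.
rewrite ss; congr (_ :: _); apply: (IH (x + step s)) => // i iN.
by have := H i.+1 iN; rewrite !pos_cons ss.
Qed.

Definition wordmean N (f : seq ('I_d * bool) -> R) : R :=
  \sum_(w <- words N) (2 * d)%:R^-1 ^+ N * f w.

Lemma wordmeanS N f : wordmean N.+1 f =
  (2 * d)%:R^-1 * \sum_(e : 'I_d * bool) wordmean N (fun w => f (e :: w)).
Proof.
rewrite /wordmean /= big_allpairs_dep/= big_enum/= mulr_sumr.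
apply: eq_bigr => e _; rewrite mulr_sumr; apply: eq_bigr => w _.
by rewrite exprS mulrA.
Qed.

Lemma wordmean_cst N (c : R) : (0 < d)%N -> wordmean N (fun=> c) = c.
Proof.
move=> d0; elim: N => [|N IH]; first by rewrite /wordmean /= big_seq1 mul1r.
by rewrite wordmeanS; under eq_bigr do rewrite IH; exact: (nbmean_cst c 0 d0).
Qed.

Lemma wordmean_cut_weight N v x y : (0 < d)%N ->
  wordmean N (fun w => cut_weight N v y (pos x w)) = esum_to N v x y.
Proof.
move=> d0; elim: N x => [|N IH] x.
  rewrite /wordmean /= big_seq1 mul1r pos0 /esum_to /=.
  by case: ifP => _ //; rewrite weight_nil.
have [->|xy] := eqVneq x y.
  rewrite esum_to_refl -[RHS](wordmean_cst N.+1 1 d0); apply: eq_bigr => w _ /=.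
  by rewrite pos0 eqxx.
rewrite wordmeanS esum_toS// -nbmeanZ /nbmean; congr (_ * _).
apply: eq_bigr => e _; rewrite -IH /wordmean mulr_sumr; apply: eq_bigr => w _ /=.
rewrite pos0 (negPf xy) mulrCA; congr (_ * (_ * _)).
by apply: cut_weight_ext => i _; rewrite pos_cons.
Qed.

Lemma srw_kernel_step (x : site) e : srw_kernel R x (x + step e) = (2 * d)%:R^-1.
Proof.
case: e => i b; rewrite /srw_kernel ifT//.
rewrite (bigD1 i)//= big1 ?addn0 => [|j ji].
  by rewrite mxE step_coord eqxx mulr1 addrAC subrr add0r; case: b.
by rewrite mxE step_coord (negPf ji) mulr0 addr0 subrr.
Qed.

Lemma prod_srw_kernel N (x : site) w : w \in words N ->
  \prod_(i < N) srw_kernel R (pos x w i) (pos x w i.+1) = (2 * d)%:R^-1 ^+ N.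
Proof.
elim: N x w => [|N IH] x w /=; first by rewrite big_ord0.
move=> /allpairsP[[e u] [_ /= uN ->]]; rewrite big_ord_recl exprS; congr (_ * _).
  by rewrite pos_cons !pos0 srw_kernel_step.
by rewrite -(IH (x + step e) u uN); apply: eq_bigr => i _; rewrite !pos_cons.
Qed.

End walk_law.

Section walk_expectation.
Context (R : realType) (d : nat) (dW : measure_display) (W : measurableType dW).
Local Notation site := 'rV[int]_d.
Variables (Pw : site -> probability W R) (S : nat -> W -> site).
Hypotheses (d0 : (0 < d)%N) (hS : simple_random_walk Pw S).
Implicit Types (v : site -> R).

Lemma measurable_site_fun (T : nat -> W -> site) n (f : site -> R) :
  (forall n z, measurable (T n @^-1` [set z])) ->
  measurable_fun setT (fun w => f (T n w)).
Proof.
move=> mT _ B mB; rewrite setTI.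
have -> : (fun w => f (T n w)) @^-1` B = \bigcup_(k in setT)
    (if (choice.unpickle k : option site) is Some z then (if f z \in B then T n @^-1` [set z] else set0) else set0).
  apply/seteqP; split => w /=.
    move=> fB; exists (choice.pickle (T n w)) => //=; rewrite choice.pickleK.
    by rewrite mem_set.
  by move=> [k _]; case: (choice.unpickle _) => [z|//]; case: ifPn => // /set_mem fz /= ->.
apply: bigcup_measurable => k _; case: (choice.unpickle _) => [z|//].
by case: ifP.
Qed.

Lemma measurable_cut_weight (T : nat -> W -> site) N v y :
  (forall n z, measurable (T n @^-1` [set z])) ->
  measurable_fun setT (fun w => cut_weight N v y (fun n => T n w)).
Proof.
elim: N T => [|N IH] T mT /=.
  by apply: (@measurable_site_fun T 0 (fun z => (z == y)%:R)).
have -> : (fun w => if T 0%N w == y then 1 else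
     expR (- v (T 0%N w)) * cut_weight N v y (fun n => T n.+1 w)) =
   (fun w => (T 0%N w == y)%:R + ((T 0%N w != y)%:R * expR (- v (T 0%N w))) *
     cut_weight N v y (fun n => T n.+1 w)).
  by apply/funext => w; case: eqP => _; rewrite /= ?mul0r ?addr0 ?add0r ?mul1r.
apply: measurable_funD; first exact: (@measurable_site_fun T 0 (fun z => (z == y)%:R)).
apply: measurable_funM.
  exact: (@measurable_site_fun T 0 (fun z => (z != y)%:R * expR (- v z))).
by apply: (IH (fun n => T n.+1)).
Qed.

Let spelled N x (w : seq ('I_d * bool)) : set W :=
  \bigcap_(i in `I_N.+1) (S i @^-1` [set pos x w i]).

Lemma spelled_measurable N x w : measurable (spelled N x w).
Proof.
by apply: fin_bigcap_measurable; [exact: finite_II|move=> i _; apply: hS.1].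
Qed.

Lemma prob_spelled N x w : w \in words d N -> Pw x (spelled N x w) = ((2 * d)%:R^-1 ^+ N)%:E.
Proof.
move=> wN; rewrite /spelled hS.2 pos0 eqxx mul1r; congr EFin.
exact: prod_srw_kernel.
Qed.

(** The trajectories spelled by words are disjoint events, so their contributions
    add up to a lower bound. That they exhaust the sample space up to a null set
    is a consequence: [walk_cut_weight] applies the bound also to the
    complement. *)
Lemma walk_lower N x (f : (nat -> site) -> R) :
  (forall s, 0 <= f s) ->
  (forall s s', (forall i, (i <= N)%N -> s i = s' i) -> f s = f s') ->
  measurable_fun setT (fun w => f (fun n => S n w)) ->
  ((wordmean N (fun u => f (pos x u)))%:E <= \int[Pw x]_w (f (fun n => S n w))%:E)%E.
Proof.
move=> f0 fN mf.
have mind u : measurable_fun setT (fun w => (f (pos x u) * \1_(spelled N x u) w)%:E).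
  apply/measurable_EFinP; apply: measurable_funM => //.
  by apply: measurable_indic; exact: spelled_measurable.
have i0 u w : [set: W] w -> (0 <= (f (pos x u) * \1_(spelled N x u) w)%:E)%E.
  by move=> _; rewrite lee_fin mulr_ge0.
have -> : (wordmean N (fun u => f (pos x u)))%:E =
    (\int[Pw x]_w (\sum_(u <- words d N) (f (pos x u) * \1_(spelled N x u) w)%:E))%E.
  rewrite ge0_integral_sum// /wordmean -sumEFin big_seq [RHS]big_seq.
  apply: eq_bigr => u uN; under eq_integral do rewrite EFinM.
  rewrite ge0_integralZl ?lee_fin//; last first.
    by apply/measurable_EFinP; apply: measurable_indic; exact: spelled_measurable.
  rewrite integral_indic ?setIT; [|by []|exact: spelled_measurable].
  by rewrite EFinM muleC; congr (_ * _)%E; rewrite -(prob_spelled x uN).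
apply: ge0_le_integral => //.
- by move=> w _; apply: sume_ge0 => u _; exact: i0.
- exact: emeasurable_sum.
- exact/measurable_EFinP.
move=> w _; rewrite sumEFin lee_fin.
have [[u [uN uw]]|H] := pselect (exists u, u \in words d N /\ spelled N x u w); last first.
  rewrite big_seq big1 ?f0// => u uN; rewrite indicE memNset ?mulr0// => uw.
  by apply: H; exists u.
rewrite (bigD1_seq u)//=; last exact: words_uniq.
rewrite big_seq_cond big1 ?addr0 => [|u' /andP[u'N u'u]].
  rewrite indicE mem_set// mulr1 (fN _ (fun n => S n w))// => i iN.
  by apply/esym/uw => /=; rewrite ltnS.
rewrite indicE memNset ?mulr0// => u'w; move/eqP: u'u; apply.
apply: (@pos_inj d N x) => // i iN.
by rewrite -(u'w i) -?(uw i) //= ltnS.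
Qed.

Lemma walk_cut_weight N v x y : (forall z, 0 <= v z) ->
  (\int[Pw x]_w (cut_weight N v y (fun n => S n w))%:E = (esum_to N v x y)%:E)%E.
Proof.
move=> v0; have mS := measurable_cut_weight N v y hS.1.
have H1 : ((esum_to N v x y)%:E <= \int[Pw x]_w (cut_weight N v y (fun n => S n w))%:E)%E.
  rewrite -wordmean_cut_weight//; apply: walk_lower => //.
    by move=> s; exact: cut_weight_ge0.
  by move=> s s' ss'; exact: cut_weight_ext.
have H2 : ((1 - esum_to N v x y)%:E <=
    \int[Pw x]_w (1 - cut_weight N v y (fun n => S n w))%:E)%E.
  have -> : 1 - esum_to N v x y = wordmean N (fun u => 1 - cut_weight N v y (pos x u)).
    rewrite -wordmean_cut_weight// -{1}(wordmean_cst N 1 d0) /wordmean -sumrB.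
    by apply: eq_bigr => u _; rewrite mulrBr.
  apply: (@walk_lower N x (fun s => 1 - cut_weight N v y s)).
  - by move=> s; rewrite subr_ge0 cut_weight_le1.
  - by move=> s s' ss'; congr (_ - _); exact: cut_weight_ext.
  - exact: measurable_funB.
have H3 : (\int[Pw x]_w (cut_weight N v y (fun n => S n w))%:E +
    \int[Pw x]_w (1 - cut_weight N v y (fun n => S n w))%:E = 1)%E.
  rewrite -ge0_integralD//.
  - under eq_integral do rewrite -EFinD addrC subrK.
    by rewrite integral_cst//= probability_setT mule1.
  - by move=> w _; rewrite lee_fin cut_weight_ge0.
  - exact/measurable_EFinP.
  - by move=> w _; rewrite lee_fin subr_ge0 cut_weight_le1.
  - by apply/measurable_EFinP; exact: measurable_funB.
move: H1 H2 H3; set I := (\int[_]_w _)%E; set J := (\int[_]_w _)%E.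
have : (0 <= I)%E by apply: integral_ge0 => w _; rewrite lee_fin cut_weight_ge0.
have : (0 <= J)%E by apply: integral_ge0 => w _; rewrite lee_fin subr_ge0 cut_weight_le1.
case: I => [i| |] //; case: J => [j| |] // _ _; rewrite !lee_fin => h1 h2 [h3].
by congr EFin; apply/eqP; rewrite eq_le h1 andbT; lra.
Qed.

(** Monotone convergence along the events that [y] is hit within [N] steps. *)
Lemma cvg_esum_to v x y : (forall z, 0 <= v z) ->
  esum_to N v x y @[N --> \oo] --> travel_e Pw S v x y.
Proof.
move=> v0.
have mS N := measurable_cut_weight N v y hS.1.
have H : ((esum_to N v x y)%:E @[N --> \oo] -->
    \int[Pw x]_w (path_weight v (S ^~ w) y)%:E)%E.
  under eq_fun do rewrite -walk_cut_weight//.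
  have -> : (\int[Pw x]_w (path_weight v (S ^~ w) y)%:E =
      \int[Pw x]_w limn (fun N => (cut_weight N v y (fun n => S n w))%:E))%E.
    apply: eq_integral => w _; apply/esym/cvg_lim => //.
    apply: cvg_near_cst; have := fun N => cut_weightE N v y (S ^~ w).
    case hE : (hitting_time _ _) => [h|] E; near=> N.
      by rewrite E ifT//; near: N; exact: nbhs_infty_ge.
    by rewrite E /path_weight hE.
  have mE N : measurable_fun setT (fun w => (cut_weight N v y (fun n => S n w))%:E).
    by apply/measurable_EFinP; exact: mS.
  apply: (@cvg_monotone_convergence _ _ _ (Pw x) setT measurableT
    (fun N w => (cut_weight N v y (fun n => S n w))%:E)) => //.
    by move=> N w _; rewrite lee_fin cut_weight_ge0.
  by move=> w _ N M NM; rewrite lee_fin cut_weight_mono.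
rewrite /travel_e unlock.
have le1 : (\int[Pw x]_w (path_weight v (S ^~ w) y)%:E <= 1)%E.
  rewrite -(cvg_lim _ H)//; apply: lime_le; first exact: cvgP H.
  by apply: nearW => N; rewrite lee_fin esum_to_le1.
have fin : (\int[Pw x]_w (path_weight v (S ^~ w) y)%:E)%E \is a fin_num.
  rewrite ge0_fin_numE; first exact: le_lt_trans le1 (ltry _).
  by apply: integral_ge0 => w _; rewrite lee_fin path_weight_ge0.
by rewrite -(fineK fin) in H; exact: (fine_cvg H).
Unshelve. all: by end_near. Qed.

End walk_expectation.

(** * Limits of finite-range costs *)

Section fekete.
Context (R : realType).

(** The limit is the infimum of [a n / n]. *)
Lemma fekete (a : nat -> R) : (forall n, 0 <= a n) ->
  (forall m n, a (m + n)%N <= a m + a n) -> exists l : R, n%:R^-1 * a n @[n --> \oo] --> l.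
Proof.
move=> a0 sub; pose A := range (fun n => a n.+1 / n.+1%:R).
have hA : has_inf A.
  split; first by exists (a 1%N / 1); exists 0%N.
  by exists 0 => _ [n _ <-]; rewrite divr_ge0.
exists (inf A); apply/cvgrPdist_le => e e0.
have [_ [m _ <-] am] : exists2 t, A t & t < inf A + e / 2.
  by apply: inf_adherent => //; rewrite divr_gt0.
have mul q r : a (q * m.+1 + r)%N <= q%:R * a m.+1 + a r.
  elim: q => [|q IH]; first by rewrite mul0n add0n mul0r add0r.
  rewrite mulSn -addnA; apply: (le_trans (sub _ _)).
  by rewrite -natr1; lra.
pose C := \sum_(r < m.+1) a r.
have aC r : (r < m.+1)%N -> a r <= C.
  by move=> rm; rewrite /C (bigD1 (Ordinal rm))//= lerDl sumr_ge0.
have C0 : 0 <= C by rewrite sumr_ge0.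
near=> n.
have n0 : (0 < n)%N by near: n; exact: nbhs_infty_gt.
have nR : 0 < n%:R :> R by rewrite ltr0n.
have lo : inf A <= n%:R^-1 * a n.
  rewrite mulrC; apply: ge_inf; first by case: hA.
  by exists n.-1 => //; rewrite prednK.
have nC : C <= e / 2 * n%:R.
  rewrite mulrC -ler_pdivrMr ?divr_gt0//.
  by near: n; exact: nbhs_infty_ger.
have mR : 0 < m.+1%:R :> R by [].
have qn : (n %/ m.+1)%:R * m.+1%:R <= n%:R :> R by rewrite -natrM ler_nat leq_trunc_div.
have hi : a n <= (n %/ m.+1)%:R * a m.+1 + C.
  rewrite {1}(divn_eq n m.+1) (le_trans (mul _ _))// lerD2l aC// ltn_mod//.
have am' : a m.+1 < (inf A + e / 2) * m.+1%:R by rewrite -ltr_pdivrMr.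
have infA0 : 0 <= inf A + e / 2.
  by apply: le_trans (ltW am); rewrite divr_ge0.
rewrite distrC ger0_norm ?subr_ge0// lerBlDr ler_pdivrMl// (le_trans hi)//.
have : (n %/ m.+1)%:R * a m.+1 <= (inf A + e / 2) * n%:R.
  apply: (@le_trans _ _ ((n %/ m.+1)%:R * ((inf A + e / 2) * m.+1%:R))).
    by rewrite ler_wpM2l// ltW.
  by rewrite mulrCA ler_wpM2l.
lra.
Unshelve. all: by end_near. Qed.

End fekete.

Lemma cvg_le_bound (R : realType) (u : nat -> R) (l c : R) : u n @[n --> \oo] --> l ->
  (\forall n \near \oo, u n <= c) -> l <= c.
Proof. by move=> ul uc; rewrite -(cvg_lim _ ul)//; apply: limr_le => //; exact: cvgP ul. Qed.

Section travel.
Context (R : realType) (d : nat) (dW : measure_display) (W : measurableType dW).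
Local Notation site := 'rV[int]_d.
Variables (Pw : site -> probability W R) (S : nat -> W -> site).
Hypotheses (d0 : (0 < d)%N) (hS : simple_random_walk Pw S).
Implicit Types (v : site -> R) (x y z : site).

Lemma esum_to_le_travel N v x y : (forall z, 0 <= v z) ->
  esum_to N v x y <= travel_e Pw S v x y.
Proof.
move=> v0; have H := @cvg_esum_to _ _ _ _ _ _ d0 hS v x y v0; rewrite -(cvg_lim _ H)//.
apply: nondecreasing_cvgn_le; last exact: cvgP H.
by move=> n m nm; exact: esum_to_mono.
Qed.

Lemma travel_e_le1 v x y : (forall z, 0 <= v z) -> travel_e Pw S v x y <= 1.
Proof.
move=> v0; have H := @cvg_esum_to _ _ _ _ _ _ d0 hS v x y v0; rewrite -(cvg_lim _ H)//.
apply: limr_le; first exact: cvgP H.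
by apply: nearW => N; exact: esum_to_le1.
Qed.

Lemma word_between x y : exists w : seq ('I_d * bool), y = x + \sum_(s <- w) step s.
Proof. by have [w wE] := word_exists (y - x); exists w; rewrite wE addrC subrK. Qed.

Lemma travel_e_gt0 v x y : (forall z, 0 <= v z) -> 0 < travel_e Pw S v x y.
Proof.
move=> v0; have [w ->] := word_between x y.
have [e0 _] := cost_word x d0 v0 (leqnn (size w)).
exact: lt_le_trans e0 (esum_to_le_travel _ _ _ v0).
Qed.

Lemma travel_a_ge0 v x y : (forall z, 0 <= v z) -> 0 <= travel_a Pw S v x y.
Proof. by move=> v0; rewrite oppr_ge0 ln_le0// travel_e_le1. Qed.

Lemma travel_a_le_cost N v x y : (forall z, 0 <= v z) -> 0 < esum_to N v x y ->
  travel_a Pw S v x y <= cost N v x y.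
Proof.
by move=> v0 e0; rewrite lerN2 ler_ln ?posrE ?travel_e_gt0// esum_to_le_travel.
Qed.

Lemma cvg_cost v x y : (forall z, 0 <= v z) ->
  cost N v x y @[N --> \oo] --> travel_a Pw S v x y.
Proof.
move=> v0; apply: cvgN; apply: continuous_cvg; last exact: cvg_esum_to.
exact/continuous_ln/travel_e_gt0.
Qed.

Lemma travel_a_triangle v x y z : (forall s, 0 <= v s) ->
  travel_a Pw S v x z <= travel_a Pw S v x y + travel_a Pw S v y z.
Proof.
move=> v0; rewrite /travel_a -opprD lerN2 -lnM ?posrE ?travel_e_gt0//.
rewrite ler_ln ?posrE ?mulr_gt0 ?travel_e_gt0//.
apply: (cvg_le_bound (cvgM (@cvg_esum_to _ _ _ _ _ _ d0 hS v x y v0) (@cvg_esum_to _ _ _ _ _ _ d0 hS v y z v0))).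
apply: nearW => N; apply: le_trans (esum_to_le_travel (N + N) x z v0).
exact: esum_to_triangle.
Qed.

Lemma travel_a_separated v x y z (T : site -> Prop) : (forall s, 0 <= v s) ->
  T x -> (forall x', T x' -> x' != y -> x' != z /\ forall s, T (x' + step s)) ->
  travel_a Pw S v x y + travel_a Pw S v y z <= travel_a Pw S v x z.
Proof.
move=> v0 Tx HT; rewrite /travel_a -opprD lerN2 -lnM ?posrE ?travel_e_gt0//.
rewrite ler_ln ?posrE ?mulr_gt0 ?travel_e_gt0//.
apply: (cvg_le_bound (@cvg_esum_to _ _ _ _ _ _ d0 hS v x z v0)).
apply: nearW => N; apply: le_trans (esum_to_separated N v Tx HT) _.
by rewrite ler_pM ?esum_to_ge0 ?esum_to_le_travel.
Qed.

Lemma esum_to_shift N v x y b :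
  esum_to N (fun z => v (z + b)) x y = esum_to N v (x + b) (y + b).
Proof.
elim: N x => [|N IH] x.
  by rewrite /esum_to/= (inj_eq (addIr b)) !weight_nil.
have [->|xy] := eqVneq x y; first by rewrite !esum_to_refl.
rewrite !esum_toS ?(inj_eq (addIr b))//; congr (_ * (_ * _)).
by apply: eq_bigr => s _; rewrite IH addrAC.
Qed.

(** Probability that the free walk hits [y], but only after time [N]. *)
Definition tail N x y : R :=
  travel_e Pw S (fun=> 0) x y - esum_to N (fun=> 0) x y.

Lemma tail_ge0 N x y : 0 <= tail N x y.
Proof. by rewrite subr_ge0 esum_to_le_travel. Qed.

Lemma cvg_tail x y : tail N x y @[N --> \oo] --> 0.
Proof.
rewrite -[X in _ --> X](subrr (travel_e Pw S (fun=> 0) x y)).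
by apply: cvgB; [exact: cvg_cst|exact: cvg_esum_to].
Qed.

Lemma travel_e_le_tail N v x y : (forall z, 0 <= v z) ->
  travel_e Pw S v x y <= esum_to N v x y + tail N x y.
Proof.
move=> v0; apply: (cvg_le_bound (@cvg_esum_to _ _ _ _ _ _ d0 hS v x y v0)).
near=> M; have NM : (N <= M)%N by near: M; exact: nbhs_infty_ge.
rewrite -lerBlDl (le_trans (esum_to_tail _ _ NM v0))// lerD2r.
exact: esum_to_le_travel.
Unshelve. all: by end_near. Qed.

(** For [r = 0] this is an upper bound on the travel cost, and for [r] the tail
    probability a lower bound. Both depend on finitely many sites, and both
    converge to the travel cost. *)
Definition rcost (r : R) N v x y : R := - ln (esum_to N v x y + r).

Lemma rcost0 N v x y : rcost 0 N v x y = cost N v x y.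
Proof. by rewrite /rcost addr0. Qed.

Lemma rcost_lipschitz r N v v' x y (L : seq site) : 0 <= r -> uniq L ->
  {subset ball N x <= L} ->
  rcost r N v x y - rcost r N v' x y <= N%:R * \sum_(z <- L) `|v z - v' z|.
Proof.
move=> r0 uL bL; set K := N%:R * _.
have K0 : 0 <= K by rewrite mulr_ge0// sumr_ge0.
have eK : expR (- K) <= 1 by rewrite -expR0 ler_expR oppr_le0.
have h1 : expR (- K) * (esum_to N v' x y + r) <= esum_to N v x y + r.
  by rewrite mulrDr lerD ?ler_piMl// esum_to_lipschitz.
have h2 : expR (- K) * (esum_to N v x y + r) <= esum_to N v' x y + r.
  rewrite mulrDr lerD ?ler_piMl// /K; under eq_bigr do rewrite distrC.
  exact: esum_to_lipschitz.
have p (u : site -> R) : 0 <= esum_to N u x y + r by rewrite addr_ge0 ?esum_to_ge0.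
rewrite /rcost; have [e0|e0] := ltP 0 (esum_to N v' x y + r).
  have e1 : 0 < esum_to N v x y + r.
    by apply: lt_le_trans h1; rewrite mulr_gt0 ?expR_gt0.
  move: h1; rewrite -ler_ln ?posrE ?mulr_gt0 ?expR_gt0// lnM ?posrE ?expR_gt0// expRK.
  lra.
have e0' : esum_to N v' x y + r = 0 by apply/eqP; rewrite eq_le e0 p.
suff -> : esum_to N v x y + r = 0 by rewrite e0' subrr.
move: h2; rewrite e0' pmulr_rle0 ?expR_gt0// => h2.
by apply/eqP; rewrite eq_le h2 p.
Qed.

Lemma rcost_tail_ge0 N v x y : (forall z, 0 <= v z) -> 0 <= rcost (tail N x y) N v x y.
Proof.
move=> v0; rewrite oppr_ge0 ln_le0//.
apply: le_trans (travel_e_le1 x y (fun z => lexx (0 : R))).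
by rewrite /tail addrCA gerDl subr_le0 esum_to_anti.
Qed.

Lemma cost_ge0 N v x y : (forall z, 0 <= v z) -> 0 <= cost N v x y.
Proof. by move=> v0; rewrite oppr_ge0 ln_le0// esum_to_le1. Qed.

Lemma rcost_tail_le N v x y : (forall z, 0 <= v z) ->
  rcost (tail N x y) N v x y <= travel_a Pw S v x y.
Proof.
move=> v0; have h := travel_e_le_tail N x y v0; have h0 := travel_e_gt0 x y v0.
by rewrite lerN2 ler_ln ?posrE//; exact: lt_le_trans h.
Qed.

Lemma cvg_rcost_tail v x y : (forall z, 0 <= v z) ->
  rcost (tail N x y) N v x y @[N --> \oo] --> travel_a Pw S v x y.
Proof.
move=> v0; apply: cvgN; apply: continuous_cvg.
  exact/continuous_ln/travel_e_gt0.
rewrite -[X in _ --> X]addr0; apply: cvgD; first exact: cvg_esum_to.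
exact: cvg_tail.
Qed.

Section expected.
Context (dO : measure_display) (Omega : measurableType dO) (P : probability Omega R).
Variables (V : site -> {RV P >-> R}) (F G : distribution_function R).
Hypotheses (hV : iid_potential V F) (G1 : class_D1 G) (GF : forall t, G t <= F t).

Definition eint (Psi : (site -> R) -> R) : \bar R := (\int[P]_w (Psi (fun z => V z w))%:E)%E.

Let V0 w z : 0 <= V z w. Proof. by have [h _ _] := hV. Qed.

Lemma measurable_pathsum y N x (Phi : Omega -> seq site -> R) :
  (forall l, measurable_fun setT (Phi ^~ l)) ->
  measurable_fun setT (fun w => pathsum y N x (Phi w)).
Proof.
elim: N x Phi => [|N IH] x Phi mPhi /=; case: (x == y) => //.
apply: measurable_funM => //; apply: measurable_sum => s.
by apply: (IH _ (fun w l => Phi w (x :: l))) => l.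
Qed.

Lemma measurable_esum_to N x y :
  measurable_fun setT (fun w => esum_to N (fun z => V z w) x y).
Proof.
apply: (measurable_pathsum _ _ _ (Phi := fun w => weight (fun z => V z w))) => l.
rewrite /weight; apply: measurableT_comp => //; apply: measurableT_comp => //.
by apply: measurable_sum => s.
Qed.

Lemma measurable_rcost r N x y :
  measurable_fun setT (fun w => rcost r N (fun z => V z w) x y).
Proof.
apply: measurableT_comp => //; apply: measurableT_comp; first exact: measurable_ln.
by apply: measurable_funD => //; exact: measurable_esum_to.
Qed.

Lemma measurable_travel_a x y :
  measurable_fun setT (fun w => travel_a Pw S (fun z => V z w) x y).
Proof.
apply: (@measurable_fun_cvg _ _ _ _ (fun N w => rcost 0 N (fun z => V z w) x y)).
  by move=> N; exact: measurable_rcost.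
by move=> w _; under eq_fun do rewrite rcost0; exact: cvg_cost.
Qed.

Let major x (u : seq ('I_d * bool)) w : R :=
  (size u)%:R * ln (2 * d)%:R + \sum_(s <- visited x u) V s w.

Lemma major_integrable x u : P.-integrable setT (fun w => (major x u w)%:E).
Proof.
under eq_fun do rewrite EFinD -sumEFin.
apply: integrableD => //; first exact: finite_measure_integrable_cst.
by apply: (integrable_sum measurableT) => s _; exact: (potential_integrable hV G1 GF).
Qed.

(** Dominated convergence, the majorant being the cost of following a fixed path. *)
Lemma cvg_eint (Psi : nat -> (site -> R) -> R) x (u : seq ('I_d * bool)) y :
  y = x + \sum_(s <- u) step s ->
  (forall N, measurable_fun setT (fun w => Psi N (fun z => V z w))) ->
  (forall v, (forall z, 0 <= v z) -> Psi N v @[N --> \oo] --> travel_a Pw S v x y) ->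
  (forall N v, (forall z, 0 <= v z) -> 0 <= Psi N v) ->
  (forall N v, (forall z, 0 <= v z) -> Psi N v <=
    (size u)%:R * ln (2 * d)%:R + \sum_(s <- visited x u) v s) ->
  eint (fun v => travel_a Pw S v x y) \is a fin_num /\
  (eint (Psi N) @[N --> \oo] --> eint (fun v => travel_a Pw S v x y)).
Proof.
move=> yE mPsi Pcvg P0 Pu.
have mE N : measurable_fun setT (fun w => (Psi N (fun z => V z w))%:E).
  by apply/measurable_EFinP; exact: mPsi.
have mA : measurable_fun setT (fun w => (travel_a Pw S (fun z => V z w) x y)%:E).
  by apply/measurable_EFinP; exact: measurable_travel_a.
have maj v : (forall z, 0 <= v z) ->
    travel_a Pw S v x y <= (size u)%:R * ln (2 * d)%:R + \sum_(s <- visited x u) v s.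
  by move=> v0; apply: (cvg_le_bound (Pcvg v v0)); apply: nearW => N; exact: Pu.
split.
  apply: integrable_fin_num => //; apply: le_integrable (major_integrable x u) => // w _.
  have a0 := travel_a_ge0 x y (V0 w); have am := maj _ (V0 w).
  by rewrite /= lee_fin !ger0_norm// (le_trans a0).
apply: (@dominated_cvg _ _ _ P setT measurableT (fun N w => (Psi N (fun z => V z w))%:E)
  (fun w => (travel_a Pw S (fun z => V z w) x y)%:E) (fun w => (major x u w)%:E)) => //.
- move=> w _; apply/cvg_EFin; first by apply: nearW.
  exact: Pcvg.
- exact: major_integrable.
- by move=> N w _; rewrite abse_EFin lee_fin ger0_norm ?P0// Pu.
Qed.

Lemma cvg_eint_cost x u y : y = x + \sum_(s <- u) step s ->
  eint (fun v => travel_a Pw S v x y) \is a fin_num /\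
  (eint (fun v => cost (N + size u) v x y) @[N --> \oo] -->
     eint (fun v => travel_a Pw S v x y)).
Proof.
move=> yE; apply: (cvg_eint (u := u)) => //.
- move=> N; under eq_fun do rewrite -rcost0; exact: measurable_rcost.
- move=> v v0; apply: (@cvg_comp _ _ _ (fun N => (N + size u)%N) (fun N => cost N v x y) \oo \oo).
    exact: cvg_addnr.
  exact: cvg_cost.
- by move=> N v v0; exact: cost_ge0.
- move=> N v v0; rewrite yE.
  by have [] := cost_word x d0 v0 (leq_addl N (size u)).
Qed.

Lemma cvg_eint_rcost x y :
  eint (fun v => rcost (tail N x y) N v x y) @[N --> \oo] -->
     eint (fun v => travel_a Pw S v x y).
Proof.
have [u yE] := word_between x y.
suff: eint (fun v => travel_a Pw S v x y) \is a fin_num /\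
  (eint (fun v => rcost (tail N x y) N v x y) @[N --> \oo] -->
     eint (fun v => travel_a Pw S v x y)) by case.
apply: (cvg_eint (u := u)) => //.
- by move=> N; exact: measurable_rcost.
- by move=> v v0; exact: cvg_rcost_tail.
- by move=> N v v0; exact: rcost_tail_ge0.
- move=> N v v0; apply: le_trans (rcost_tail_le _ _ _ v0) _.
  have [e0] := cost_word x d0 v0 (leqnn (size u)); rewrite -yE => ?.
  by rewrite -yE in e0; apply: le_trans (travel_a_le_cost v0 e0) _.
Qed.

End expected.

End travel.

(** * Expected costs and the Lyapunov exponent *)

Section shift.
Context (R : realType) (d : nat).
Local Notation site := 'rV[int]_d.
Context (dO : measure_display) (Omega : measurableType dO) (P : probability Omega R).
Variables (V : site -> {RV P >-> R}) (F : distribution_function R).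

Lemma iid_shift b : iid_potential V F -> iid_potential (fun z => V (z + b)) F.
Proof.
move=> [V0 Vc Vi]; split => [z w|z t|J B mB]; [exact: V0|exact: Vc|].
pose sh (z : site) : site := z + b.
have -> : \bigcap_(i in [set` J]) (V (i + b) @^-1` B i) =
    \bigcap_(i in [set` [fset sh z | z in J]%fset]) (V i @^-1` B (i - b)).
  apply/seteqP; split => w H i /=.
    by move=> /imfsetP[z /= zJ ->]; rewrite addrK; exact: H.
  move=> iJ; have := H (sh i); rewrite /= /sh addrK; apply.
  by apply/imfsetP; exists i.
rewrite (Vi _ (fun i => B (i - b)))//.
rewrite big_imfset/=; last by move=> z z' _ _ /addIr.
by apply: eq_bigr => z _; rewrite /sh addrK.
Qed.

End shift.

Section comparison.
Context (R : realType) (d : nat).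
Local Notation site := 'rV[int]_d.
Context (dO : measure_display) (Omega : measurableType dO) (P : probability Omega R).
Context (dO' : measure_display) (Omega' : measurableType dO') (P' : probability Omega' R).
Variables (V : site -> {RV P >-> R}) (V' : site -> {RV P' >-> R}).
Variables (F F' G : distribution_function R).
Hypotheses (hV : iid_potential V F) (hV' : iid_potential V' F').
Hypotheses (G1 : class_D1 G) (GF : forall t, G t <= F t) (GF' : forall t, G t <= F' t).
Variables (L : seq site) (Psi : (site -> R) -> R) (B : R).
Hypotheses (uL : uniq L) (B0 : 0 <= B).
Hypothesis Psi0 : forall v, (forall z, 0 <= v z) -> 0 <= Psi v.
Hypothesis lip : forall v v' : site -> R, Psi v - Psi v' <= B * \sum_(z <- L) `|v z - v' z|.
Hypothesis mPsi : measurable_fun setT (fun w => Psi (fun z => V z w)).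
Hypothesis mPsi' : measurable_fun setT (fun w => Psi (fun z => V' z w)).

(** Expectations are limits of grid means along the multiples of any [q], so a bound
    for grid means passes to them. *)
Lemma eint_compare (q m1 : nat) (delta : R) : (0 < q)%N ->
  (forall r, (0 < r)%N -> (m1 <= q * r)%N ->
    gexp L F (q * r) (q * r * (q * r)) Psi -
    gexp L F' (q * r) (q * r * (q * r)) Psi <= delta) ->
  (eint V Psi <= eint V' Psi + delta%:E)%E.
Proof.
move=> q0 H; apply/lee_addgt0Pr => e e0.
have e2 : 0 < e / 2 by rewrite divr_gt0.
have [m2 _ T] := transfer hV uL G1 GF B0 Psi0 lip mPsi e2.
have [m3 _ T'] := transfer hV' uL G1 GF' B0 Psi0 lip mPsi' e2.
pose r := (maxn m1 (maxn m2 m3)).+1.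
have rq : (maxn m1 (maxn m2 m3) <= q * r)%N.
  by rewrite (@leq_trans r)// ?leqnSn// leq_pmull.
move: rq; rewrite !geq_max => /andP[r1 /andP[r2 r3]].
have [T1 _] := T _ r2; have [_ T2] := T' _ r3; have {}H := H r isT r1.
rewrite /eint; apply: (le_trans T1).
move: T2; case: (\int[P']_w _)%E => [i| |]; rewrite ?lee_fin -?EFinD ?lee_fin ?leey//.
by move=> ?; lra.
Qed.

Lemma eint_wass (q : nat) (e : R) : (0 < q)%N ->
  (forall r M, (0 < r)%N -> wass F F' (q * r) M <= e) ->
  (eint V Psi <= eint V' Psi + (B * (size L)%:R * (2 * e))%:E)%E.
Proof.
move=> q0 He; apply: (@eint_compare q 0) => // r r0 _.
apply: le_trans (gexp_wass _ _ (df_is_df F) (df_is_df F') B0 lip) _.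
by rewrite ler_wpM2l ?mulr_ge0// ler_wpM2l// He.
Qed.

End comparison.

Section expectations.
Context (R : realType) (d : nat) (dW : measure_display) (W : measurableType dW).
Local Notation site := 'rV[int]_d.
Variables (Pw : site -> probability W R) (S : nat -> W -> site).
Hypotheses (d0 : (0 < d)%N) (hS : simple_random_walk Pw S).

Let ta (x y : site) := fun v : site -> R => travel_a Pw S v x y.

Definition sites N (x : site) : seq site := undup (ball N x).

Lemma sub_sites N x : {subset ball N x <= sites N x}.
Proof. by move=> z; rewrite mem_undup. Qed.

Section one_environment.
Context (dO : measure_display) (Omega : measurableType dO) (P : probability Omega R).
Variables (V : site -> {RV P >-> R}) (F G : distribution_function R).
Hypotheses (hV : iid_potential V F) (G1 : class_D1 G) (GF : forall t, G t <= F t).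

Definition mean_cost x y : R := fine (eint V (ta x y)).

Lemma eint_fin x y : eint V (ta x y) = (mean_cost x y)%:E.
Proof.
have [u yE] := word_between x y.
by rewrite fineK//; have [] := cvg_eint_cost d0 hS hV G1 GF yE.
Qed.

Lemma mean_cost_ge0 x y : 0 <= mean_cost x y.
Proof.
have [V0 _ _] := hV; rewrite fine_ge0//; apply: integral_ge0 => w _.
by rewrite lee_fin; apply: travel_a_ge0 => // z.
Qed.

Lemma measurable_ta x y : measurable_fun setT (fun w => (ta x y (fun z => V z w))%:E).
Proof. by apply/measurable_EFinP; exact: (measurable_travel_a d0 hS hV). Qed.

Let ta0 x y w : 0 <= ta x y (fun z => V z w).
Proof. by have [V0 _ _] := hV; apply: travel_a_ge0 => // s. Qed.

Let eint_taD x y z : (\int[P]_w (ta x y (fun s => V s w) + ta y z (fun s => V s w))%:E =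
  (mean_cost x y + mean_cost y z)%:E)%E.
Proof.
rewrite EFinD -!eint_fin; under eq_integral do rewrite EFinD.
by apply: ge0_integralD => // [w _||w _|]; rewrite ?lee_fin//; exact: measurable_ta.
Qed.

Let measurable_taD x y z : measurable_fun setT
  (fun w => (ta x y (fun s => V s w) + ta y z (fun s => V s w))%:E).
Proof.
by apply/measurable_EFinP; apply: measurable_funD; exact: (measurable_travel_a d0 hS hV).
Qed.

Lemma mean_cost_triangle x y z : mean_cost x z <= mean_cost x y + mean_cost y z.
Proof.
have [V0 _ _] := hV; rewrite -lee_fin -eint_taD -eint_fin.
apply: ge0_le_integral.
- exact: measurableT.
- by move=> w _; rewrite lee_fin.
- exact: measurable_ta.
- exact: measurable_taD.
- by move=> w _; rewrite lee_fin; apply: travel_a_triangle => // s.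
Qed.

Lemma mean_cost_separated x y z (T : site -> Prop) :
  T x -> (forall x', T x' -> x' != y -> x' != z /\ forall s, T (x' + step s)) ->
  mean_cost x y + mean_cost y z <= mean_cost x z.
Proof.
move=> Tx HT; have [V0 _ _] := hV; rewrite -lee_fin -eint_taD -eint_fin.
apply: ge0_le_integral.
- exact: measurableT.
- by move=> w _; rewrite lee_fin addr_ge0.
- exact: measurable_taD.
- exact: measurable_ta.
- by move=> w _; rewrite lee_fin; apply: (travel_a_separated d0 hS _ Tx HT) => s.
Qed.

(** The grid means depend on the law of the potential only, and translated
    potentials have the same law. *)
Lemma mean_cost_shift x y b : mean_cost (x + b) (y + b) = mean_cost x y.
Proof.
have [u yE] := word_between x y.
have yE' : y + b = x + b + \sum_(s <- u) step s by rewrite yE addrAC.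
have [_ c1] := cvg_eint_cost d0 hS hV G1 GF yE.
have [_ c2] := cvg_eint_cost d0 hS hV G1 GF yE'.
rewrite /mean_cost -(cvg_lim _ c1)// -(cvg_lim _ c2)//.
suff -> : (fun N => eint V (fun v => cost (N + size u) v x y)) =
    (fun N => eint V (fun v => cost (N + size u) v (x + b) (y + b))) by [].
apply/funext => N.
have hVb := iid_shift b hV; set Vb := fun z => V (z + b) in hVb.
have -> : eint V (fun v => cost (N + size u) v (x + b) (y + b)) =
    eint Vb (fun v => cost (N + size u) v x y).
  apply: eq_integral => w _; congr EFin; rewrite /cost; congr (- ln _).
  by rewrite -(@esum_to_shift R d (N + size u) (fun z => V z w)).
pose L := sites (N + size u) x.
have lip (v v' : site -> R) : cost (N + size u) v x y - cost (N + size u) v' x y <=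
    (N + size u)%:R * \sum_(z <- L) `|v z - v' z|.
  rewrite -!rcost0; apply: rcost_lipschitz => //; first exact: undup_uniq.
  exact: sub_sites.
have c0 (v : site -> R) : (forall z, 0 <= v z) -> 0 <= cost (N + size u) v x y.
  exact: cost_ge0.
have mc (U : site -> {RV P >-> R}) :
    measurable_fun setT (fun w => cost (N + size u) (fun z => U z w) x y).
  by under eq_fun do rewrite -rcost0; exact: measurable_rcost.
apply/eqP; rewrite eq_le; apply/andP; split; rewrite -[leRHS]adde0.
  apply: (@eint_compare R d _ _ _ _ _ _ V Vb F F G hV hVb G1 GF GF L _ _ (undup_uniq _) (ler0n R (N + size u)) c0 lip (mc V) (mc Vb) 1 0) => // r _ _.
  by rewrite subrr.
apply: (@eint_compare R d _ _ _ _ _ _ Vb V F F G hVb hV G1 GF GF L _ _ (undup_uniq _) (ler0n R (N + size u)) c0 lip (mc Vb) (mc V) 1 0) => // r _ _.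
by rewrite subrr.
Qed.

Lemma mean_cost_subadditive x j k :
  mean_cost 0 (x *+ (j + k)) <= mean_cost 0 (x *+ j) + mean_cost 0 (x *+ k).
Proof.
have E : x *+ k + x *+ j = x *+ (j + k) by rewrite addrC -mulrnDr.
have := mean_cost_triangle 0 (x *+ j) (x *+ (j + k)).
by have := mean_cost_shift 0 (x *+ k) (x *+ j); rewrite add0r E => ->.
Qed.

Lemma lyapunovP x : exists2 alpha : R,
  n%:R^-1 * mean_cost 0 (x *+ n) @[n --> \oo] --> alpha &
  lyapunov Pw S V x = alpha%:E.
Proof.
have [alpha ha] := fekete (fun n => mean_cost_ge0 0 (x *+ n)) (mean_cost_subadditive x).
exists alpha => //; apply: cvg_lim => //.
have -> : (fun n => (n%:R^-1)%:E * 'E_P[fun w => travel_a Pw S (fun z => V z w) 0 (x *+ n)])%E =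
    (fun n => (n%:R^-1 * mean_cost 0 (x *+ n))%:E).
  by apply/funext => n; rewrite unlock EFinM -eint_fin.
by apply/cvg_EFin => //; exact: nearW.
Qed.

End one_environment.

Section two_environments.
Context (dO : measure_display) (Omega : measurableType dO) (P : probability Omega R).
Context (dO' : measure_display) (Omega' : measurableType dO') (P' : probability Omega' R).
Variables (V : site -> {RV P >-> R}) (V' : site -> {RV P' >-> R}).
Variables (F F' G : distribution_function R).
Hypotheses (hV : iid_potential V F) (hV' : iid_potential V' F').
Hypotheses (G1 : class_D1 G) (GF : forall t, G t <= F t) (GF' : forall t, G t <= F' t).

Lemma eint_rcost_wass (r0 : R) N x y q e : 0 <= r0 ->
  (forall v : site -> R, (forall z, 0 <= v z) -> 0 <= rcost r0 N v x y) -> (0 < q)%N ->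
  (forall r M, (0 < r)%N -> wass F F' (q * r) M <= e) ->
  (eint V (fun v => rcost r0 N v x y) <= eint V' (fun v => rcost r0 N v x y) +
     (N%:R * (size (sites N x))%:R * (2 * e))%:E)%E.
Proof.
move=> r00 rc0 q0 He.
apply: (@eint_wass R d _ _ _ _ _ _ V V' F F' G hV hV' G1 GF GF' (sites N x) _ N%:R _ _ rc0 _ _ _ q) => //.
- exact: undup_uniq.
- move=> v v'; apply: rcost_lipschitz => //; first exact: undup_uniq.
  exact: sub_sites.
- exact: measurable_rcost.
- exact: measurable_rcost.
Qed.

(** [gexp_lipschitz] with the mesh sent to zero and then [N] to infinity; both are
    possible because the constant depends on neither. *)
Lemma mean_cost_lipschitz (lam C : R) (k0 : nat) (eta delta B e : R) q
    (u : seq ('I_d * bool)) x :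
  0 <= lam -> 0 <= C ->
  (forall (v : site -> R) N x y z, (forall s, lam <= v s) ->
    occup N v x y z <= C * visit N v x y z) ->
  (forall t, 0 <= t -> t < lam -> F t = 0) ->
  (forall t, 0 <= t -> t < lam -> F' t = 0) ->
  lam <= k0%:R -> 2^-1 <= F k0%:R ->
  0 < eta -> 0 < delta -> delta <= 1 -> F eta <= 1 - delta -> F' eta <= 1 - delta ->
  (forall m M, (0 < m)%N -> gmean F m M <= B) ->
  0 <= e -> (0 < q)%N -> (forall r M, (0 < r)%N -> wass F F' (q * r) M <= e) ->
  mean_cost V x (x + \sum_(s <- u) step s) <=
  mean_cost V' x (x + \sum_(s <- u) step s) + e * lip_const d lam C k0 eta delta B * (size u)%:R.
Proof.
move=> lam0 C0 occC Fl F'l lamk0 Fk0 eta0 delta0 delta1 Fe F'e HB e0 q0 He.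
set y := x + _; set K := e * _ * _.
have [_ c1] := cvg_eint_cost d0 hS hV G1 GF (erefl y).
have [_ c2] := cvg_eint_cost d0 hS hV' G1 GF' (erefl y).
have L0 : 0 <= lip_const d lam C k0 eta delta B.
  have B0 : 0 <= B.
    apply: le_trans (HB 1%N 0%N isT); by rewrite /gmean big_ord0 mul0r.
  have e1 : 0 < 1 - expR (- eta) by rewrite subr_gt0 -expR0 ltr_expR oppr_lt0.
  have e2 := expR_gt0 (- eta).
  rewrite /lip_const !mulr_ge0 ?expR_ge0 ?addr_ge0//.
    by rewrite ln_ge0// ler1n muln_gt0.
  rewrite invr_ge0 oppr_ge0 ln_le0//; nra.
have key N : (eint V (fun v => cost (N + size u) v x y) <=
    eint V' (fun v => cost (N + size u) v x y) + K%:E)%E.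
  pose L := sites (N + size u) x.
  have lip (v v' : site -> R) : cost (N + size u) v x y - cost (N + size u) v' x y <=
      (N + size u)%:R * \sum_(z <- L) `|v z - v' z|.
    rewrite -!rcost0; apply: rcost_lipschitz => //; first exact: undup_uniq.
    exact: sub_sites.
  have co0 (v : site -> R) : (forall z, 0 <= v z) -> 0 <= cost (N + size u) v x y.
    exact: cost_ge0.
  have mc : measurable_fun setT (fun w => cost (N + size u) (fun z => V z w) x y).
    by under eq_fun do rewrite -rcost0; exact: measurable_rcost.
  have mc' : measurable_fun setT (fun w => cost (N + size u) (fun z => V' z w) x y).
    by under eq_fun do rewrite -rcost0; exact: measurable_rcost.
  (* The cap, which equals the inverse mesh, must exceed both k0 and eta. *)
  pose m1 := maxn k0.+1 (Num.truncn eta).+1.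
  apply: (@eint_compare R d _ _ _ _ _ _ V V' F F' G hV hV' G1 GF GF' L _ _ (undup_uniq _)
    (ler0n R (N + size u)) co0 lip mc mc' q m1) => // r r0 rm.
  have m0 : (0 < q * r)%N by rewrite muln_gt0 q0.
  have mM : (q * r * (q * r))%:R / (q * r)%:R = (q * r)%:R :> R.
    by rewrite natrM mulfK// pnatr_eq0 -lt0n.
  move: rm; rewrite geq_max => /andP[rk re].
  apply: le_trans (gexp_lipschitz (undup_uniq _) d0 (leq_addl N (size u)) (@sub_sites _ _)
    lam0 C0 occC m0 (df_is_df F) (df_is_df F') Fl F'l _ _ _ lamk0 Fk0 eta0 delta0 delta1 Fe F'e
    (HB _ _ m0)) _.
  - by rewrite mM (le_trans lamk0)// ler_nat ltnW.
  - rewrite mM (le_trans (ltW (truncnS_gt eta)))// ler_nat//.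
  - by rewrite ltn_pmul2r.
  - by rewrite /K ler_wpM2r// ler_wpM2r// He.
rewrite -lee_fin EFinD -(eint_fin hV G1 GF) -(eint_fin hV' G1 GF').
have c3 : (eint V' (fun v => cost (N + size u) v x y) + K%:E @[N --> \oo] -->
    eint V' (ta x y) + K%:E)%E.
  apply: cvgeD => //; first by rewrite fin_num_adde_defl.
  exact: cvg_cst.
by apply: (lee_cvg_to c1 c3); apply: nearW.
Qed.

End two_environments.

End expectations.

(** * Weak limits and fixed endpoints *)

Section weak_limits.
Context (R : realType).
Implicit Types F G : distribution_function R.

Lemma right_continuity F (t e : R) : 0 < e -> exists2 s, t < s & F s < F t + e.
Proof.
move=> e0; have /cvgrPdist_lt/(_ e e0) H := (cumulative_is_right_continuous F : right_continuous F) t.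
near t^'+ => s; exists s; first by near: s; exact: nbhs_right_gt.
have : `|F t - F s| < e by near: s.
by rewrite ltr_norml => /andP[? _]; lra.
Unshelve. all: by end_near. Qed.

(** The inequality holds at points of continuity of [F] and extends by right
    continuity. *)
Lemma weak_limit_ge (Fn : nat -> distribution_function R) F G :
  (forall n t, G t <= Fn n t) -> weak_cvg Fn F -> forall t, G t <= F t.
Proof.
move=> GFn FnF t; rewrite leNgt; apply/negP => FG.
have gap : 0 < G t - F t by rewrite subr_gt0.
have [s ts Fs] := @right_continuity F t _ gap.
have [r [tr rs /FnF cr]] := continuity_point (df_is_df F).1 ts.
have : G t <= F r.
  apply: le_trans ((df_is_df G).1 _ _ (ltW tr)) _.
  rewrite -(cvg_lim _ cr)//; apply: limr_ge; first exact: cvgP cr.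
  by apply: nearW => n; exact: GFn.
by have := (df_is_df F).1 _ _ (ltW rs); lra.
Qed.

Lemma weak_limit_vanish (Fn : nat -> distribution_function R) F (lam t : R) :
  (forall n, Fn n lam = 0) -> weak_cvg Fn F -> t < lam -> F t = 0.
Proof.
move=> Fl FnF tl; have [r [tr rl /FnF cr]] := continuity_point (df_is_df F).1 tl.
have Fr : F r = 0.
  rewrite -(cvg_lim _ cr)//; apply/cvg_lim => //; apply: cvg_near_cst.
  apply: nearW => n; have [Fh F01] := df_is_df (Fn n); case/andP: (F01 r) => r0 _.
  have := Fh _ _ (ltW rl); rewrite Fl => r1.
  by apply/eqP; rewrite eq_le r1 r0.
have [Fh F01] := df_is_df F; case/andP: (F01 t) => t0 _.
have := Fh _ _ (ltW tr); rewrite Fr => t1.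
by apply/eqP; rewrite eq_le t1 t0.
Qed.

(** As [F 0 < 1], the laws of the sequence eventually put a fixed mass above a fixed
    positive level; this gives a common bound below one for their Laplace
    transforms. *)
Lemma weak_limit_mass (Fn : nat -> distribution_function R) F :
  F 0 < 1 -> weak_cvg Fn F -> exists eta delta : R,
  [/\ 0 < eta, 0 < delta, delta <= 1, F eta <= 1 - delta &
      \forall n \near \oo, Fn n eta <= 1 - delta].
Proof.
move=> F0 FnF.
have gap : 0 < 1 - F 0 by rewrite subr_gt0.
have [s s0 Fs] := @right_continuity F 0 _ gap.
have [eta [eta0 etas ceta]] := continuity_point (df_is_df F).1 s0.
have Feta : F eta < 1 by have := (df_is_df F).1 _ _ (ltW etas); lra.
have /andP[Fe0 _] := (df_is_df F).2 eta.
exists eta, ((1 - F eta) / 2); split => //; try lra.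
have d0 : 0 < (1 - F eta) / 2 by lra.
have /cvgrPdist_lt/(_ _ d0) H := FnF _ ceta.
near=> n; have : `|F eta - Fn n eta| < (1 - F eta) / 2 by near: n.
by rewrite ltr_norml => /andP[? _]; lra.
Unshelve. all: by end_near. Qed.

Lemma df_median G (lam : R) : exists k0 : nat, lam <= k0%:R /\ 2^-1 <= G k0%:R.
Proof.
have h0 : 0 < 2^-1 :> R by [].
have /cvgrPdist_lt/(_ _ h0) H := cvg_comp _ _ (@cvgr_idn R) (cumulativey G).
near \oo => k0; exists k0; split; first by near: k0; exact: nbhs_infty_ger.
have : `|1 - G k0%:R| < 2^-1 by near: k0.
by rewrite ltr_norml => /andP[_ ?]; lra.
Unshelve. all: by end_near. Qed.

End weak_limits.

Lemma step1 (s : 'I_1 * bool) : (step s : 'rV[int]_1) 0 0 = (-1) ^+ s.2.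
Proof. by case: s => i b; rewrite step_coord (ord1 i) mulr1. Qed.

(** On the line a nearest-neighbour path from the origin to [x *+ k.+1] passes
    through [x *+ k]; the half-line before [x *+ k] is the separating set. *)
Lemma separated_line (x : 'rV[int]_1) k : exists T : 'rV[int]_1 -> Prop, T 0 /\
  forall x', T x' -> x' != x *+ k -> x' != x *+ k.+1 /\ forall s, T (x' + step s).
Proof.
have rv_eq (a b : 'rV[int]_1) : (a == b) = (a 0 0 == b 0 0).
  apply/eqP/eqP => [->//|ab]; apply/matrixP => i j.
  by rewrite (ord1 i) (ord1 j).
have E j : (x *+ j) 0 0 = x 0 0 *+ j by rewrite mulmxnE.
have [x0|x0|x0] := ltgtP (x 0 0) 0.
- exists (fun s => x 0 0 *+ k <= s 0 0); split.
    by rewrite mxE mulrn_wle0// ltW.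
  move=> x' Tx; rewrite !rv_eq !E => xk.
  have lt : x 0 0 *+ k < x' 0 0 by rewrite lt_neqAle eq_sym xk.
  split; first by rewrite mulrS; apply/eqP => h; move: lt; rewrite h; lia.
  move=> [i b]; rewrite mxE step1 /=.
  by move: (x 0 0 *+ k) (x' 0 0) lt => p r lt; case: b; rewrite /= ?expr0 ?expr1; lia.
- exists (fun s => s 0 0 <= x 0 0 *+ k); split.
    by rewrite mxE mulrn_wge0// ltW.
  move=> x' Tx; rewrite !rv_eq !E => xk.
  have lt : x' 0 0 < x 0 0 *+ k by rewrite lt_neqAle xk.
  split; first by rewrite mulrS; apply/eqP => h; move: lt; rewrite h; lia.
  move=> [i b]; rewrite mxE step1 /=.
  by move: (x 0 0 *+ k) (x' 0 0) lt => p r lt; case: b; rewrite /= ?expr0 ?expr1; lia.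
- exists (fun s => s = 0); split => // x' ->; rewrite rv_eq E x0 mul0rn mxE eqxx.
  by [].
Qed.

Section fixed_endpoint.
Context (R : realType) (d : nat) (dW : measure_display) (W : measurableType dW).
Local Notation site := 'rV[int]_d.
Variables (Pw : site -> probability W R) (S : nat -> W -> site).
Hypotheses (d0 : (0 < d)%N) (hS : simple_random_walk Pw S).
Variables (Fn : nat -> distribution_function R) (G F : distribution_function R).
Hypotheses (G1 : class_D1 G) (GFn : forall n t, G t <= Fn n t) (FnF : weak_cvg Fn F).
Variables (dOn : nat -> measure_display) (Omegan : forall n, measurableType (dOn n))
  (Pn : forall n, probability (Omegan n) R)
  (Vn : forall n, site -> {RV (Pn n) >-> R}).
Hypothesis hVn : forall n, iid_potential (Vn n) (Fn n).
Variables (dO : measure_display) (Omega : measurableType dO)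
  (P : probability Omega R) (V : site -> {RV P >-> R}).
Hypothesis hV : iid_potential V F.

Let GF : forall t, G t <= F t. Proof. exact: weak_limit_ge GFn FnF. Qed.

(** At fixed endpoints the cost lies between two functions of finitely many sites,
    [rcost 0] and [rcost tail], whose expectations are close for [N] large; for
    each of them [eint_rcost_wass] compares the two laws. *)
Lemma mean_cost_continuous x y :
  mean_cost Pw S (Vn n) x y @[n --> \oo] --> mean_cost Pw S V x y.
Proof.
apply/cvgrPdist_le => e e0; have e2 : 0 < e / 2 by rewrite divr_gt0.
have [u yE] := word_between x y.
have [_ c1] := cvg_eint_cost d0 hS hV G1 GF yE.
have c2 := @cvg_eint_rcost _ _ _ _ _ _ d0 hS _ _ _ _ _ _ hV G1 GF x y.
rewrite (eint_fin d0 hS hV G1 GF) in c1 c2.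
move: c1 c2 => /fine_cvgP[f1 /cvgrPdist_lt/(_ _ e2)[N1 _ H1]].
move=> /fine_cvgP[f2 /cvgrPdist_lt/(_ _ e2) H2].
case: f1 => M1 _ f1.
pose N := (maxn N1 M1 + size u)%N.
have ub : (eint V (fun v => rcost 0 N v x y) <= (mean_cost Pw S V x y + e / 2)%:E)%E.
  have := H1 _ (leq_maxl N1 M1); have := f1 _ (leq_maxr N1 M1); rewrite /= -/N.
  rewrite (_ : (fun v => rcost 0 N v x y) = (fun v => cost N v x y)); last first.
    by apply/funext => v; rewrite rcost0.
  move=> /fineK <-; rewrite lee_fin ltr_norml => /andP[? _]; lra.
have [N' lb] : exists N', ((mean_cost Pw S V x y - e / 2)%:E <=
    eint V (fun v => rcost (tail Pw S N' x y) N' v x y))%E.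
  near \oo => N'; exists N'.
  have : `|mean_cost Pw S V x y - fine (eint V (fun v => rcost (tail Pw S N' x y) N' v x y))| < e / 2.
    by near: N'.
  have : eint V (fun v => rcost (tail Pw S N' x y) N' v x y) \is a fin_num by near: N'.
  by move=> /fineK <-; rewrite lee_fin ltr_norml /= => /andP[_ ?]; lra.
pose K : R := N%:R * (size (sites N x))%:R + N'%:R * (size (sites N' x))%:R.
have K0 : 0 <= K by rewrite addr_ge0 ?mulr_ge0.
(* N and the tail range are fixed first; then the two laws are close enough for
   the soft estimate at both ranges. *)
pose e' : R := e / (4 * (K + 1)).
have e'0 : 0 < e' by rewrite divr_gt0// mulr_gt0//; lra.
have e'2 : 0 <= 2 * e' by lra.
have Ke : K * (2 * e') <= e / 2.
  rewrite /e' mulrA mulrA ler_pdivrMr; last by rewrite mulr_gt0//; lra.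
  by nra.
have [q q0 Hq] := wass_small G1 GFn GF FnF e'0.
near=> n; have Hw : forall r M, (0 < r)%N -> wass F (Fn n) (q * r) M <= e'.
  by near: n; exact: Hq.
have Hw' r M : (0 < r)%N -> wass (Fn n) F (q * r) M <= e' by rewrite wassC; exact: Hw.
have [V0 _ _] := hV; have [Vn0 _ _] := hVn n.
have m1 N0 r0 : measurable_fun setT (fun w => (rcost r0 N0 (fun z => Vn n z w) x y)%:E).
  by apply/measurable_EFinP; exact: measurable_rcost.
have mt := measurable_ta d0 hS (hVn n) x y.
have up : mean_cost Pw S (Vn n) x y <= mean_cost Pw S V x y + e.
  have c0 (v : site -> R) : (forall z, 0 <= v z) -> 0 <= rcost 0 N v x y.
    by rewrite rcost0; exact: cost_ge0.
  have := eint_rcost_wass (hVn n) hV G1 (GFn n) GF (lexx 0) c0 q0 Hw'.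
  move=> /le_trans/(_ (leeD2r _ ub)); rewrite -EFinD => H.
  rewrite -lee_fin -(eint_fin d0 hS (hVn n) G1 (GFn n)).
  apply: (@le_trans _ _ (eint (Vn n) (fun v => rcost 0 N v x y))).
    apply: ge0_le_integral.
    - exact: measurableT.
    - by move=> w _; rewrite lee_fin; apply: travel_a_ge0 => // z.
    - exact: mt.
    - exact: m1.
    - move=> w _; rewrite lee_fin rcost0.
      have [e00 _] := cost_word x d0 (fun z => Vn0 z w) (leq_addl _ _ : (size u <= N)%N).
      by rewrite -yE in e00; apply: (travel_a_le_cost d0 hS) => // z; exact: Vn0.
  apply: (le_trans H); rewrite lee_fin -addrA lerD2l.
  have : N%:R * (size (sites N x))%:R * (2 * e') <= K * (2 * e').
    by rewrite ler_wpM2r// /K lerDl mulr_ge0.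
  lra.
have lo : mean_cost Pw S V x y - e <= mean_cost Pw S (Vn n) x y.
  have c0 (v : site -> R) : (forall z, 0 <= v z) -> 0 <= rcost (tail Pw S N' x y) N' v x y.
    exact: rcost_tail_ge0.
  have := eint_rcost_wass hV (hVn n) G1 GF (GFn n) (tail_ge0 d0 hS N' x y) c0 q0 Hw.
  move=> /(le_trans lb) H.
  have : (eint (Vn n) (fun v => rcost (tail Pw S N' x y) N' v x y) <=
      (mean_cost Pw S (Vn n) x y)%:E)%E.
    rewrite -(eint_fin d0 hS (hVn n) G1 (GFn n)); apply: ge0_le_integral.
    - exact: measurableT.
    - by move=> w _; rewrite lee_fin; apply: c0 => z; exact: Vn0.
    - exact: m1.
    - exact: mt.
    - by move=> w _; rewrite lee_fin; apply: rcost_tail_le => // z; exact: Vn0.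
  move=> /(leeD2r (N'%:R * (size (sites N' x))%:R * (2 * e'))%:E)/(le_trans H).
  rewrite -EFinD lee_fin.
  have : N'%:R * (size (sites N' x))%:R * (2 * e') <= K * (2 * e').
    by rewrite ler_wpM2r// /K lerDr mulr_ge0.
  lra.
by rewrite ler_norml; apply/andP; split; lra.
Unshelve. all: by end_near. Qed.

End fixed_endpoint.

(** * Continuity of the Lyapunov exponent *)

Lemma slope_le (R : realType) (a b : nat -> R) (la lb c : R) :
  k%:R^-1 * a k @[k --> \oo] --> la -> k%:R^-1 * b k @[k --> \oo] --> lb ->
  (forall k, a k <= b k + c * k%:R) -> la <= lb + c.
Proof.
move=> ca cb ab; rewrite -lerBlDl; apply: (cvg_le_bound (cvgB ca cb)).
near=> k; have k0 : 0 < k%:R :> R by rewrite ltr0n; near: k; exact: nbhs_infty_gt.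
rewrite -mulrBr ler_pdivrMl// mulrC lerBlDl; exact: ab.
Unshelve. all: by end_near. Qed.

(** In dimension one the cost is additive along the line, so the limit defining the
    exponent is attained at once. *)
Lemma lyapunov_line (R : realType) (dW : measure_display) (W : measurableType dW)
  (Pw : 'rV[int]_1 -> probability W R) (S : nat -> W -> 'rV[int]_1)
  (hS : simple_random_walk Pw S)
  (dO : measure_display) (Omega : measurableType dO) (P : probability Omega R)
  (V : 'rV[int]_1 -> {RV P >-> R}) (F G : distribution_function R) :
  iid_potential V F -> class_D1 G -> (forall t, G t <= F t) ->
  forall (x : 'rV[int]_1) (alpha : R),
  n%:R^-1 * mean_cost Pw S V 0 (x *+ n) @[n --> \oo] --> alpha ->
  alpha = mean_cost Pw S V 0 x.
Proof.
move=> hV G1 GF x alpha ha; have d1 : (0 < 1)%N by [].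
pose A := fun k => mean_cost Pw S V 0 (x *+ k).
have sub := mean_cost_subadditive d1 hS hV G1 GF x.
have AS k : A k.+1 = A k + A 1%N.
  apply/eqP; rewrite eq_le -{1}addn1 sub/=.
  have [T [T0 HT]] := separated_line x k.
  have := mean_cost_separated d1 hS hV G1 GF T0 HT.
  have := mean_cost_shift d1 hS hV G1 GF 0 x (x *+ k).
  by rewrite add0r -mulrS => -> h; rewrite /A mulr1n.
have A0 : A 0%N = 0.
  by have := AS 0%N; rewrite -[X in X = _]add0r => /addIr/esym.
have AE k : A k = k%:R * A 1%N.
  by elim: k => [|k IH]; rewrite ?mul0r// AS IH -natr1 mulrDl mul1r.
have -> : mean_cost Pw S V 0 x = A 1%N by rewrite /A mulr1n.
rewrite -(cvg_lim _ ha)//; apply/cvg_lim => //; apply: cvg_near_cst.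
near=> n; have n0 : (0 < n)%N by near: n; exact: nbhs_infty_gt.
by rewrite -/(A n) AE mulKf// pnatr_eq0 -lt0n.
Unshelve. all: by end_near. Qed.

Lemma sum_flatten_nseq (d : nat) (u : seq ('I_d * bool)) k :
  \sum_(s <- flatten (nseq k u)) step s = (\sum_(s <- u) step s) *+ k.
Proof. by elim: k => [|k IH]; rewrite /= ?big_nil// big_cat /= IH mulrS. Qed.

Lemma size_flatten_nseq (T : Type) (u : seq T) k : size (flatten (nseq k u)) = (k * size u)%N.
Proof. by elim: k => //= k IH; rewrite size_cat IH mulSn. Qed.

Theorem theorem1 (R : realType) (d : nat) (hd : (1 <= d)%N)
  (dW : measure_display) (W : measurableType dW)
  (Pw : 'rV[int]_d -> probability W R) (S : nat -> W -> 'rV[int]_d)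
  (hS : simple_random_walk Pw S)
  (Fn : nat -> distribution_function R) (G F : distribution_function R)
  (hFn : forall n, class_D (Fn n))
  (hG : class_D1 G)
  (hGFn : forall n t, G t <= Fn n t)
  (h2 : d = 2%N -> exists2 lambda : R, 0 < lambda & forall n, Fn n lambda = 0)
  (hF : class_D F)
  (hw : weak_cvg Fn F)
  (dOn : nat -> measure_display) (Omegan : forall n, measurableType (dOn n))
  (Pn : forall n, probability (Omegan n) R)
  (Vn : forall n, 'rV[int]_d -> {RV (Pn n) >-> R})
  (hVn : forall n, iid_potential (Vn n) (Fn n))
  (dO : measure_display) (Omega : measurableType dO)
  (P : probability Omega R) (V : 'rV[int]_d -> {RV P >-> R})
  (hV : iid_potential V F) :
  forall x : 'rV[int]_d,
    lyapunov Pw S (Vn n) x @[n --> \oo] --> lyapunov Pw S V x.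
Proof.
move=> x; have GF := weak_limit_ge hGFn hw.
have [alpha ha la] := lyapunovP hd hS hV hG GF x.
have /choice[al hal] n : exists a : R,
    (k%:R^-1 * mean_cost Pw S (Vn n) 0 (x *+ k) @[k --> \oo] --> a) /\
    lyapunov Pw S (Vn n) x = a%:E.
  by have [a h1 h2'] := lyapunovP hd hS (hVn n) hG (hGFn n) x; exists a.
rewrite la (_ : (fun n => _) = (fun n => (al n)%:E)); last first.
  by apply/funext => n; rewrite (hal n).2.
apply/cvg_EFin; first exact: nearW.
rewrite (_ : _ \o _ = al)//.
(* The walk on the line is recurrent and no killing is assumed, so local times
   are not bounded; additivity replaces the estimate. *)
have [d1|d1] := eqVneq d 1%N.
  subst d; rewrite (lyapunov_line hS hV hG GF ha).
  have -> : al = fun n => mean_cost Pw S (Vn n) 0 x.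
    by apply/funext => n; exact: (lyapunov_line hS (hVn n) hG (hGFn n) (hal n).1).
  exact: (mean_cost_continuous hd hS hG hGFn hw hVn hV).
(* In dimension two lam is the killing rate; in higher dimension transience
   allows lam = 0. *)
have [lam [lam0 lamd Fl Fnl]] : exists lam : R, [/\ 0 <= lam, 0 < lam \/ (3 <= d)%N,
    forall t, 0 <= t -> t < lam -> F t = 0 &
    forall n t, 0 <= t -> t < lam -> Fn n t = 0].
  have [d2|d2] := eqVneq d 2%N.
    have [lam lam0 Flam] := h2 d2; exists lam; split; [exact: ltW|by left| |].
      by move=> t _ tl; exact: weak_limit_vanish Flam hw tl.
    move=> n t _ tl; have [Fh F01] := df_is_df (Fn n); case/andP: (F01 t) => t0 _.
    by have := Fh _ _ (ltW tl); rewrite Flam => t1; apply/eqP; rewrite eq_le t1 t0.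
  exists 0; split => //; first by right; move: hd d1 d2; case: (d) => [|[|[|]]].
    by move=> t t0; rewrite ltNge t0.
  by move=> n t t0; rewrite ltNge t0.
have [C C0 occC] := local_time_bound hd lam0 lamd.
have [k0 [lamk0 Gk0]] := df_median G lam.
have [eta [delta [eta0 delta0 delta1 Feta Fneta]]] := weak_limit_mass hF.2 hw.
have [B HB] := gmean_bounded hG.
have [u uE] := word_exists x.
pose C1 := lip_const d lam C k0 eta delta B * (size u)%:R.
have C10 : 0 < `|C1| + 1 by rewrite ltr_pwDr.
apply/cvgrPdist_le => e e0.
(* The constant C1 does not depend on n, and both costs are compared along the
   same k-fold repetition of a path to x. *)
pose e' := e / (`|C1| + 1).
have e'0 : 0 < e' by rewrite divr_gt0.
have e'C : e' * C1 <= e.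
  rewrite /e' mulrAC ler_pdivrMr// ler_pM2l// (le_trans (ler_norm _))// lerDl//.
have [q q0 Hq] := wass_small hG hGFn GF hw e'0.
near=> n.
have Hw : forall r M, (0 < r)%N -> wass F (Fn n) (q * r) M <= e'.
  by near: n; exact: Hq.
have Hw' r M : (0 < r)%N -> wass (Fn n) F (q * r) M <= e' by rewrite wassC; exact: Hw.
have Fnn : Fn n eta <= 1 - delta by near: n.
have word k : 0 + \sum_(s <- flatten (nseq k u)) step s = x *+ k.
  by rewrite add0r sum_flatten_nseq uE.
have lo : alpha <= al n + e' * C1.
  apply: (slope_le ha (hal n).1) => k.
  have := mean_cost_lipschitz hd hS hV (hVn n) hG GF (hGFn n) (flatten (nseq k u)) 0
    lam0 C0 occC Fl (Fnl n) lamk0 (le_trans Gk0 (GF _)) eta0 delta0 delta1 Feta Fnn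
    (fun m M m0 => HB F m M m0 GF) (ltW e'0) q0 Hw.
  rewrite word size_flatten_nseq natrM => /le_trans; apply.
  by rewrite lerD2l /C1 [k%:R * _]mulrC !mulrA.
have hi : al n <= alpha + e' * C1.
  apply: (slope_le (hal n).1 ha) => k.
  have := mean_cost_lipschitz hd hS (hVn n) hV hG (hGFn n) GF (flatten (nseq k u)) 0
    lam0 C0 occC (Fnl n) Fl lamk0 (le_trans Gk0 (hGFn n _)) eta0 delta0 delta1 Fnn Feta
    (fun m M m0 => HB (Fn n) m M m0 (hGFn n)) (ltW e'0) q0 Hw'.
  rewrite word size_flatten_nseq natrM => /le_trans; apply.
  by rewrite lerD2l /C1 [k%:R * _]mulrC !mulrA.
by rewrite ler_norml; apply/andP; split; lra.
Unshelve. all: by end_near. Qed.
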